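(* Let $\Phi$ be a real-valued invariant of compact combinatorial manifolds (with or without boundary) under PL isomorphisms (that is, $\Phi(M,\xi)=\Phi(M',\xi')$ whenever the compact combinatorial manifolds $(M,\xi)$ and $(M',\xi')$ are PL-homeomorphic) that depends only on the number of simplices in each dimension (that is, $\Phi(M,\xi)=\Phi(M',\xi')$ whenever the compact combinatorial manifolds $(M,\xi)$ and $(M',\xi')$ have the same $\mathbf{f}$-vector). If $(M_1^n,\xi_1)$ and $(M_2^n,\xi_2)$ are two compact combinatorial $n$-manifolds with nonempty boundary such that $\chi(M_1^n)=\chi(M_2^n)$ and $\chi(\partial M_1^n)=\chi(\partial M_2^n)$, then $\Phi(M_1^n,\xi_1)=\Phi(M_2^n,\xi_2)$.
   Context: A combinatorial $n$-manifold $(M^n,\xi)$ is a topological $n$-manifold $M^n$, possibly with boundary, together with a triangulation $\xi$ by a simplicial complex (taken up to simplicial isomorphism) in which the link of every vertex is a PL $(n-1)$-sphere or, for vertices on the boundary, a PL $(n-1)$-ball. Manifolds are not assumed connected. For compact $M^n$, $f_k(M^n,\xi)$ is the number of $k$-simplices of $\xi$ and the $\mathbf{f}$-vector is $\mathbf{f}(M^n,\xi)=(f_0(M^n,\xi),\dots,f_n(M^n,\xi))$. $\chi$ denotes the Euler characteristic. PL means piecewise linear. *)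

(* Defs.v *)
From HB Require Import structures.
From mathcomp Require Import all_boot all_order all_algebra finmap.
From mathcomp Require Import all_classical all_reals all_analysis.
Set Implicit Arguments.
Unset Strict Implicit.
Unset Printing Implicit Defensive.
Import Order.TTheory GRing.Theory Num.Theory.
Import numFieldNormedType.Exports.
Local Open Scope classical_set_scope.
Local Open Scope ring_scope.

(* A simplex of R^N is identified with the finite set of its vertices.  The
   empty set is not a simplex. *)
Definition hull (R : realType) (N : nat) (s : {fset 'rV[R]_N}) : set 'rV[R]_N :=
  [set x | exists w : 'rV[R]_N -> R,
     [/\ (forall v, v \in s -> 0 <= w v),
         \sum_(v <- s) w v = 1 &
         x = \sum_(v <- s) w v *: v]].

Definition affinely_independent (R : realType) (N : nat)
    (s : {fset 'rV[R]_N}) : Prop :=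
  forall w : 'rV[R]_N -> R,
    \sum_(v <- s) w v = 0 -> \sum_(v <- s) w v *: v = 0 ->
    forall v, v \in s -> w v = 0.

Definition is_complex (R : realType) (N : nat)
    (K : {fset {fset 'rV[R]_N}}) : Prop :=
  [/\ fset0 \notin K,
      (forall s t : {fset 'rV[R]_N},
         s \in K -> t != fset0 -> (t `<=` s)%fset -> t \in K),
      (forall s, s \in K -> affinely_independent s) &
      (forall s t, s \in K -> t \in K ->
         hull s `&` hull t `<=` hull (s `&` t)%fset)].

Definition polyhedron (R : realType) (N : nat)
    (K : {fset {fset 'rV[R]_N}}) : set 'rV[R]_N :=
  [set x | exists2 s, s \in K & hull s x].

Definition link (R : realType) (N : nat) (K : {fset {fset 'rV[R]_N}})
    (v : 'rV[R]_N) : {fset {fset 'rV[R]_N}} :=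
  [fset t in K | (v \notin t) && ((v |` t)%fset \in K)]%fset.

Definition face_number (R : realType) (N : nat)
    (K : {fset {fset 'rV[R]_N}}) (k : nat) : nat :=
  #|` [fset s in K | #|` s| == k.+1]%fset|.

Definition euler_char (R : realType) (N : nat)
    (K : {fset {fset 'rV[R]_N}}) : int :=
  \sum_(s <- K) (-1) ^+ #|` s|.-1.

Definition subdivision (R : realType) (N : nat)
    (K' K : {fset {fset 'rV[R]_N}}) : Prop :=
  [/\ is_complex K', polyhedron K' = polyhedron K &
      forall s, s \in K' -> exists2 t, t \in K & hull s `<=` hull t].

Definition affine_on (R : realType) (N P : nat) (s : {fset 'rV[R]_N})
    (f : 'rV[R]_N -> 'rV[R]_P) : Prop :=
  forall w : 'rV[R]_N -> R,
    (forall v, v \in s -> 0 <= w v) -> \sum_(v <- s) w v = 1 ->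
    f (\sum_(v <- s) w v *: v) = \sum_(v <- s) w v *: f v.

(* Only the restriction of f to the polyhedron of K matters; it is continuous,
   being affine on each simplex of a finite complex. *)
Definition pl_map (R : realType) (N P : nat) (K : {fset {fset 'rV[R]_N}})
    (L : {fset {fset 'rV[R]_P}}) (f : 'rV[R]_N -> 'rV[R]_P) : Prop :=
  f @` polyhedron K `<=` polyhedron L /\
  exists2 K', subdivision K' K & forall s, s \in K' -> affine_on s f.

Definition pl_homeomorphic (R : realType) (N P : nat)
    (K : {fset {fset 'rV[R]_N}}) (L : {fset {fset 'rV[R]_P}}) : Prop :=
  exists (f : 'rV[R]_N -> 'rV[R]_P) (g : 'rV[R]_P -> 'rV[R]_N),
    [/\ pl_map K L f, pl_map L K g,
        (forall x, polyhedron K x -> g (f x) = x) &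
        (forall y, polyhedron L y -> f (g y) = y)].

Definition basis_vertices (R : realType) (m : nat) : {fset 'rV[R]_m} :=
  [fset (delta_mx 0 i : 'rV[R]_m) | i in 'I_m]%fset.

(* It has m vertices, hence dimension m - 1. *)
Definition std_simplex (R : realType) (m : nat) : {fset {fset 'rV[R]_m}} :=
  (fpowerset (basis_vertices R m) `\ fset0)%fset.

Definition std_simplex_boundary (R : realType) (m : nat) :
    {fset {fset 'rV[R]_m}} :=
  (std_simplex R m `\ basis_vertices R m)%fset.

(* PL spheres and balls of dimension n - 1.  The (-1)-sphere is empty; the
   (-1)-ball plays no role, as a 0-manifold has no boundary points. *)
Definition pl_sphere_pred (R : realType) (n N : nat)
    (L : {fset {fset 'rV[R]_N}}) : Prop :=
  pl_homeomorphic L (std_simplex_boundary R n.+1).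

Definition pl_ball_pred (R : realType) (n N : nat)
    (L : {fset {fset 'rV[R]_N}}) : Prop :=
  pl_homeomorphic L (std_simplex R n).

Definition homeomorphic (R : realType) (N P : nat)
    (A : set 'rV[R]_N) (B : set 'rV[R]_P) : Prop :=
  exists (f : 'rV[R]_N -> 'rV[R]_P) (g : 'rV[R]_P -> 'rV[R]_N),
    [/\ f @` A `<=` B, g @` B `<=` A,
        (forall x, A x -> g (f x) = x), (forall y, B y -> f (g y) = y) &
        {within A, continuous f} /\ {within B, continuous g}].

(* For n = 0 this is the whole of R^0. *)
Definition half_space (R : realType) (n : nat) : set 'rV[R]_n :=
  [set y | forall i : 'I_n, i = 0%N :> nat -> 0 <= y 0 i].

(* Second countability and the Hausdorff property are inherited from R^N. *)
Definition is_manifold (R : realType) (n N : nat) (X : set 'rV[R]_N) : Prop :=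
  forall x, X x ->
    exists (U : set 'rV[R]_N) (V : set 'rV[R]_n),
      [/\ open U, U x, open V & homeomorphic (X `&` U) (V `&` @half_space R n)].

Definition manifold_interior (R : realType) (n N : nat) (X : set 'rV[R]_N) :
    set 'rV[R]_N :=
  [set x | X x /\
    exists (U : set 'rV[R]_N) (V : set 'rV[R]_n),
      [/\ open U, U x, open V & homeomorphic (X `&` U) V]].

Definition manifold_boundary (R : realType) (n N : nat) (X : set 'rV[R]_N) :
    set 'rV[R]_N :=
  X `\` manifold_interior n X.

Definition is_comb_manifold (R : realType) (n N : nat)
    (K : {fset {fset 'rV[R]_N}}) : Prop :=
  [/\ is_complex K,
      is_manifold n (polyhedron K) &
      forall v : 'rV[R]_N, [fset v]%fset \in K ->
        (manifold_interior n (polyhedron K) v -> pl_sphere_pred n (link K v)) /\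
        (manifold_boundary n (polyhedron K) v -> pl_ball_pred n (link K v))].

(* A compact combinatorial n-manifold (M, xi): the triangulation xi is a finite
   geometric complex in some R^N, and M is its polyhedron.  Simplicially
   isomorphic complexes are PL homeomorphic. *)
Record comb_manifold (R : realType) (n : nat) := CombManifold {
  ambient_dim : nat;
  triangulation : {fset {fset 'rV[R]_ambient_dim}};
  comb_manifoldP : is_comb_manifold n triangulation
}.

Definition manifold_space (R : realType) (n : nat) (M : comb_manifold R n) :
    set 'rV[R]_(ambient_dim M) :=
  polyhedron (triangulation M).
Arguments manifold_space {R n} M _.

Definition boundary (R : realType) (n : nat) (M : comb_manifold R n) :
    set 'rV[R]_(ambient_dim M) :=
  manifold_boundary n (manifold_space M).
Arguments boundary {R n} M _.

(* The subcomplex of the triangulation carried by the topological boundary; it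
   triangulates that boundary, and is used to compute its Euler characteristic. *)
Definition boundary_complex (R : realType) (n : nat) (M : comb_manifold R n) :
    {fset {fset 'rV[R]_(ambient_dim M)}} :=
  [fset s in triangulation M | `[< (hull s `<=` boundary M)%classic >]]%fset.

Definition f_vector (R : realType) (n : nat) (M : comb_manifold R n) : seq nat :=
  mkseq (face_number (triangulation M)) n.+1.

(* Phi is defined on the compact combinatorial manifolds of all dimensions. *)
Definition pl_invariant (R : realType)
    (Phi : forall n, comb_manifold R n -> R) : Prop :=
  forall (n n' : nat) (M : comb_manifold R n) (M' : comb_manifold R n'),
    pl_homeomorphic (triangulation M) (triangulation M') ->
    Phi n M = Phi n' M'.

Definition depends_only_on_f_vector (R : realType)
    (Phi : forall n, comb_manifold R n -> R) : Prop :=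
  forall (n n' : nat) (M : comb_manifold R n) (M' : comb_manifold R n'),
    f_vector M = f_vector M' -> Phi n M = Phi n' M'.

(* Main.v *)
Require Import Defs.
From HB Require Import structures.
From mathcomp Require Import all_boot all_order all_algebra finmap.
From mathcomp Require Import all_classical all_reals all_analysis.
From mathcomp Require Import ring lra zify.
Set Implicit Arguments.
Unset Strict Implicit.
Unset Printing Implicit Defensive.
Import Order.TTheory GRing.Theory Num.Theory.
Import numFieldNormedType.Exports.
Local Open Scope classical_set_scope.
Local Open Scope ring_scope.

(* A stellar subdivision keeps the polyhedron and changes the face polynomial
   f_K = sum over the simplices s of X^|s| by an amount that depends only on the
   link of the starred face.  Two kinds of places where this link is known occur
   in every n-manifold with boundary: an n-simplex sigma, and a boundary facet
   tau of an n-simplex.  Starring there, and then starring a face spanned by the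
   new vertex and k old ones, adds to f_K multiples by X (1 + X) of
     [k] [n + 1 - k]   and   (1 + X) [k] [n - k],   [k] = (1 + X)^k - X^k,
   and integer combinations of these give every integer polynomial of degree < n.
   Equal Euler characteristics mean that f_M1 - f_M2 is divisible by X (1 + X),
   so M1 and M2 have subdivisions with the same f-vector.

   A boundary facet is found in the link of a boundary vertex, which is PL
   homeomorphic to a simplex.  Its points are boundary points because otherwise
   the half-space, hence the whole manifold, would have empty boundary. *)

(** * Barycentric coordinates and stellar subdivisions *)

Section Barycentric.
Local Open Scope fset_scope.
Local Open Scope ring_scope.
Variables (R : realType) (N : nat).
Local Notation V := 'rV[R]_N.
Implicit Types (s t F : {fset V}) (K L : {fset {fset V}}) (a x v : V) (w : V -> R).

(** Subdivision only refines, so negative coefficients in the integer combinations are handled by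
    pairs: whether [Phi] agrees on all pairs whose face polynomials differ by X (1 + X) c is a
    property of c, and a move applied to one or the other member of a pair shifts c both ways. The
    shifts that preserve this property form a group. For n > 1 the interior moves alone are not
    enough: [k] [n + 1 - k] is multiplied by (-1)^(n + 1) under X -> -1 - X, a Dehn-Sommerville
    symmetry, which the factor 1 + X of the boundary moves breaks. Each move must again yield a
    combinatorial manifold. The link of an old vertex is at most starred, so its PL type survives
    once PL homeomorphisms are known to compose. The link of a new vertex is explicit, but whether
    it has to be a sphere or a ball depends on the topological position of that vertex, which is
    found without homology. Dimension is controlled by counting: finitely many simplices with too
    few vertices cannot a larger one. *)

Definition barycentric s w x : Prop :=
  [/\ forall v, 0 <= w v, forall v, v \notin s -> w v = 0,
      \sum_(v <- s) w v = 1 & x = \sum_(v <- s) w v *: v].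

Lemma sum_fset_incl (W : nmodType) s t (f : V -> W) :
  s `<=` t -> (forall v, v \in t -> v \notin s -> f v = 0) ->
  \sum_(v <- t) f v = \sum_(v <- s) f v.
Proof. by move=> st f0; rewrite -(big_fset_incl _ st). Qed.

Lemma sum_fset_big (W : nmodType) s t u (f : V -> W) :
  s `<=` u -> t `<=` u -> (forall v, v \notin s -> f v = 0) ->
  (forall v, v \notin t -> f v = 0) ->
  \sum_(v <- s) f v = \sum_(v <- t) f v.
Proof.
move=> su tu fs ft.
by rewrite -(sum_fset_incl su) ?(sum_fset_incl tu)// => v _; [exact: ft|exact: fs].
Qed.

Lemma sum_fset_eq (W : nmodType) s t (f : V -> W) :
  (forall v, v \notin s -> f v = 0) -> (forall v, v \notin t -> f v = 0) ->
  \sum_(v <- s) f v = \sum_(v <- t) f v.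
Proof. by apply: (@sum_fset_big _ s t (s `|` t)); rewrite ?fsubsetUl ?fsubsetUr. Qed.

(** The weights are made zero off [s], so that the weights of a point in different simplices can be
    compared as functions on the whole space. *)
Lemma hullP s x : hull s x <-> exists w, barycentric s w x.
Proof.
split=> [[w [w0 w1 xE]]|[w [w0 ws w1 xE]]]; last by exists w.
exists (fun v => if v \in s then w v else 0); split.
- by move=> v; case: ifPn => // /w0.
- by move=> v /negbTE ->.
- by rewrite -w1; apply: eq_big_seq => v /= ->.
- by rewrite xE; apply: eq_big_seq => v /= ->.
Qed.

Lemma barycentric_hull s w x : barycentric s w x -> hull s x.
Proof. by move=> b; apply/hullP; exists w. Qed.

Lemma barycentricS s t w x : s `<=` t -> barycentric s w x -> barycentric t w x.
Proof.
move=> st [w0 ws w1 xE]; split => //.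
- by move=> v vt; apply: ws; apply: contra vt; apply: (fsubsetP st).
- by rewrite (sum_fset_incl st)// => v _; exact: ws.
- by rewrite (sum_fset_incl st)// => v _ /ws ->; rewrite scale0r.
Qed.

Lemma hullS s t x : s `<=` t -> hull s x -> hull t x.
Proof. by move=> st /hullP[w /(barycentricS st) b]; apply/hullP; exists w. Qed.

Lemma barycentric_restrict s t w x : barycentric s w x ->
  (forall v, v \notin t -> w v = 0) -> barycentric t w x.
Proof.
move=> [w0 ws w1 xE] wt; split => //.
- by rewrite -w1; apply: sum_fset_eq.
- by rewrite xE; apply: sum_fset_eq => v => [/ws|/wt] ->; rewrite scale0r.
Qed.

Lemma affinely_independent_uniq s (w w' : V -> R) : affinely_independent s ->
  \sum_(v <- s) w v = \sum_(v <- s) w' v ->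
  \sum_(v <- s) w v *: v = \sum_(v <- s) w' v *: v ->
  forall v, v \in s -> w v = w' v.
Proof.
move=> ai e1 e2 v vs; apply/eqP; rewrite -subr_eq0; apply/eqP.
apply: (ai (fun v => w v - w' v)) => //; first by rewrite sumrB e1 subrr.
by under eq_bigr do rewrite scalerBl; rewrite sumrB e2 subrr.
Qed.

Lemma barycentric_inj s w w' x : affinely_independent s ->
  barycentric s w x -> barycentric s w' x -> w =1 w'.
Proof.
move=> ai [_ ws w1 xE] [_ ws' w1' xE'] v; have [vs|vs] := boolP (v \in s).
  by apply: (affinely_independent_uniq ai) => //; rewrite ?w1 -?xE.
by rewrite ws ?ws'.
Qed.

Lemma affinely_independentS s t : s `<=` t ->
  affinely_independent t -> affinely_independent s.
Proof.
move=> st ai w w0 wv0 v vs.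
pose w' v := if v \in s then w v else 0.
have := ai w'; rewrite /w'.
have E (W : nmodType) (f : V -> W) :
    \sum_(v <- t) (if v \in s then f v else 0) = \sum_(v <- s) f v.
  rewrite (sum_fset_incl st); last by move=> u _ /negbTE ->.
  by apply: eq_big_seq => u /= ->.
rewrite E => /(_ w0).
have -> : \sum_(v <- t) (if v \in s then w v else 0) *: v = 0.
  by under eq_bigr => u _ do rewrite (fun_if ( *:%R^~ u)) scale0r; rewrite E.
by move=> /(_ erefl v (fsubsetP st v vs)); rewrite vs.
Qed.

(** The intersection condition puts [x] in the hull of the common face, and its weights there,
    extended by zero, are its weights in both simplices. *)
Lemma complex_uniq K s t w w' x : is_complex K -> s \in K -> t \in K ->
  barycentric s w x -> barycentric t w' x -> w =1 w'.
Proof.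
move=> [_ _ Kai KI] sK tK b b'.
have /hullP[w2 b2] : hull (s `&` t) x.
  by apply: (KI s t) => //; split; apply/hullP; [exists w|exists w'].
have b2s := barycentricS (fsubsetIl s t) b2.
have b2t := barycentricS (fsubsetIr s t) b2.
move=> v; rewrite (barycentric_inj (Kai _ sK) b b2s).
by rewrite (barycentric_inj (Kai _ tK) b' b2t).
Qed.

(** Converse of [complex_uniq]: weights that agree are supported on both simplices, hence on their
    intersection. New complexes are verified in this form. *)
Lemma complex_of_uniq K :
  fset0 \notin K ->
  (forall s t, s \in K -> t != fset0 -> t `<=` s -> t \in K) ->
  (forall s, s \in K -> affinely_independent s) ->
  (forall s t w w' x, s \in K -> t \in K ->
     barycentric s w x -> barycentric t w' x -> w =1 w') -> is_complex K.
Proof.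
move=> K0 Kf Kai Ku; split=> // s t sK tK x [/hullP[w b] /hullP[w' b']].
have e := Ku _ _ _ _ _ sK tK b b'.
apply/hullP; exists w; apply: (barycentric_restrict b) => v.
rewrite inE negb_and => /orP[]; first by case: b => _ + _ _; apply.
by rewrite e; case: b' => _ + _ _; apply.
Qed.

Lemma complex_sub K L : is_complex K -> L `<=` K ->
  (forall s t, s \in L -> t != fset0 -> t `<=` s -> t \in L) -> is_complex L.
Proof.
move=> [K0 Kf Kai KI] /fsubsetP LK Lf; split => //.
- by apply: contra K0; apply: LK.
- by move=> s /LK; apply: Kai.
- by move=> s t /LK sK /LK tK; apply: KI.
Qed.

Definition vertices K : {fset V} := \bigcup_(s <- K) s.

Lemma verticesP K v : reflect (exists2 s, s \in K & v \in s) (v \in vertices K).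
Proof. by apply: (iffP (bigfcupP _ _ _ _)) => [[s /andP[sK _] vs]|[s sK vs]]; exists s; rewrite ?sK. Qed.

Lemma complex_vertex K s v : is_complex K -> s \in K -> v \in s -> [fset v] \in K.
Proof.
move=> [_ Kf _ _] sK vs; apply: (Kf s) => //; last by rewrite fsub1set.
by apply/fset0Pn; exists v; rewrite inE.
Qed.

Lemma complex_face K s t : is_complex K -> s \in K -> t != fset0 -> t `<=` s -> t \in K.
Proof. by case=> _ Kf _ _; apply: Kf. Qed.

Lemma complex_neq0 K s : is_complex K -> s \in K -> s != fset0.
Proof. by case=> K0 _ _ _; apply: contraTneq => ->. Qed.

Lemma barycentric1 v : barycentric [fset v] (fun u => (u == v)%:R) v.
Proof.
split; first by move=> u; rewrite ler0n.
- by move=> u; rewrite inE => /negbTE ->.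
- by rewrite big_seq_fset1 eqxx.
- by rewrite big_seq_fset1 eqxx scale1r.
Qed.

Lemma barycentric_exists_pos s w x : barycentric s w x -> exists2 v, v \in s & 0 < w v.
Proof.
move=> [w0 ws w1 _]; apply: contrapT => H.
have: \sum_(v <- s) w v = 0.
  apply: big1_seq => v /= vs; apply/eqP; rewrite eq_le w0 andbT leNgt.
  by apply/negP => ?; apply: H; exists v.
by rewrite w1 => /eqP; rewrite oner_eq0.
Qed.

Definition open_simplex F : set V :=
  [set x | exists2 c, barycentric F c x & forall v, v \in F -> 0 < c v].

(* Stellar subdivision of K at F with apex a.  When F = [fset a] it returns K,
   so that relabelling an apex is covered as well. *)
Definition star K F a : {fset {fset V}} :=
  [fset s in fpowerset (a |` vertices K) | [&& s != fset0, ~~ (F `<=` s `\ a)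
     & (if a \in s then (s `\ a) `|` F else s) \in K]].

(** The ambient powerset in [star] serves only to make it a finite set; membership in it follows
    from the other conditions. *)
Lemma in_star K F a s : F != fset0 ->
  (s \in star K F a) = [&& s != fset0, ~~ (F `<=` s `\ a)
     & (if a \in s then (s `\ a) `|` F else s) \in K].
Proof.
move=> F0; rewrite !inE /= fpowersetE; apply: andb_idl => /and3P[s0 Fs sK].
apply/fsubsetP => v vs; rewrite in_fset1U.
have [//|va] := eqVneq v a; apply/verticesP.
by case: ifP sK => _ sK; eexists; try exact: sK; rewrite // !inE va vs.
Qed.
End Barycentric.

Section Star.
Local Open Scope fset_scope.
Local Open Scope ring_scope.
Variables (R : realType) (N : nat).
Local Notation V := 'rV[R]_N.
Implicit Types (s t F : {fset V}) (K L : {fset {fset V}}) (a x v : V) (w : V -> R).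

(** As a vertex of [K], [a] has all its weight at itself, whereas its weights on [F] are all
    positive. *)
Lemma open_simplex_apex K F a s : is_complex K -> F \in K -> open_simplex F a ->
  s \in K -> a \in s -> F = [fset a].
Proof.
move=> cK FK [c bc c0] sK asK.
have aK := complex_vertex cK sK asK.
have e := complex_uniq cK FK aK bc (barycentric1 a).
have : F `<=` [fset a].
  apply/fsubsetP => v vF; rewrite inE; apply: contraTT (c0 _ vF).
  by rewrite e => /negbTE ->; rewrite ltxx.
by rewrite fsubset1 (negbTE (complex_neq0 cK FK)) orbF => /eqP.
Qed.

(** Weights over the old vertices: the weight at the apex is redistributed over [F] in the
    proportions [c] that define the apex. *)
Definition apex_lift (c : V -> R) a w v := (if v == a then 0 else w v) + w a * c v.

Definition star_carrier F a s := if a \in s then (s `\ a) `|` F else s.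

Lemma barycentric_star_carrier F a c s w x : barycentric F c a ->
  barycentric s w x -> barycentric (star_carrier F a s) (apex_lift c a w) x.
Proof.
move=> bF [w0 ws w1 xE]; rewrite /star_carrier /apex_lift.
have [c0 cF c1 aE] := bF.
case: ifPn => [as_|as_]; last first.
  have wa : w a = 0 by apply: ws.
  have e v : (if v == a then 0 else w v) + w a * c v = w v.
    by rewrite wa mul0r addr0; case: eqP => // ->.
  split.
  - by move=> v; rewrite e.
  - by move=> v; rewrite e; apply: ws.
  - by under eq_bigr do rewrite e.
  - by under eq_bigr do rewrite e.
have E (W : lmodType R) (f : V -> W) :
    \sum_(v <- (s `\ a) `|` F) ((if v == a then 0 else w v) + w a * c v) *: f v
    = \sum_(v <- s `\ a) w v *: f v + w a *: \sum_(v <- F) c v *: f v.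
  under eq_bigr do rewrite scalerDl; rewrite big_split /=; congr (_ + _).
    rewrite (@sum_fset_incl _ _ _ (s `\ a)) ?fsubsetUl//.
      by apply: eq_big_seq => v /=; rewrite !inE => /andP[/negbTE ->].
    move=> v _; rewrite !inE; case: eqP => /=; rewrite ?scale0r// => _ /ws ->.
    by rewrite scale0r.
  rewrite scaler_sumr (@sum_fset_incl _ _ _ F) ?fsubsetUr//.
    by apply: eq_bigr => v _; rewrite scalerA.
  by move=> v _ /cF ->; rewrite mulr0 scale0r.
split.
- move=> v; apply: addr_ge0; last exact: mulr_ge0.
  by case: ifP.
- move=> v; rewrite !inE negb_or negb_and negbK => /andP[h /cF ->].
  by rewrite mulr0 addr0; case: ifP h => //= _ /ws.
- have := E R^o (fun=> 1); rewrite /GRing.scale /=.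
  under eq_bigr do rewrite mulr1; move=> ->.
  under eq_bigr do rewrite mulr1; under [X in _ + _ * X]eq_bigr do rewrite mulr1.
  by rewrite c1 mulr1 -w1 (big_fsetD1 a as_) /= addrC.
- by rewrite E -aE xE (big_fsetD1 a as_) /= addrC.
Qed.

Lemma star_complex K F a : is_complex K -> F \in K -> open_simplex F a ->
  is_complex (star K F a).
Proof.
move=> cK FK oF; have [c bF cpos] := oF.
have F0 := complex_neq0 cK FK.
have [c0 cF c1 aE] := bF.
have carK s : s \in star K F a -> star_carrier F a s \in K.
  by rewrite in_star// => /and3P[].
(* Some vertex [u] of [F] is missing from [t] without [a]. There the lifted weight is exactly w' a *
   c u, while the lift of [w] is at least w a * c u. Exchanging the roles gives the reverse
   inequality. *)
have uniq s t w w' x : s \in star K F a -> t \in star K F a ->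
    barycentric s w x -> barycentric t w' x -> w a <= w' a.
  move=> sS tS bw bw'.
  have e := complex_uniq cK (carK _ sS) (carK _ tS)
    (barycentric_star_carrier bF bw) (barycentric_star_carrier bF bw').
  move: tS; rewrite in_star// => /and3P[_ + _] => /fsubsetPn[u uF].
  rewrite !inE negb_and negbK => ut.
  have := e u; rewrite /apex_lift.
  have -> : (if u == a then 0 else w' u) = 0.
    by case: ifP ut => //= _; case: bw' => _ + _ _; apply.
  rewrite add0r => eu; rewrite -(ler_pM2r (cpos _ uF)) -eu lerDr.
  by case: ifP => // _; case: bw.
apply: complex_of_uniq.
- by rewrite in_star// eqxx.
- move=> s t; rewrite !in_star// => /and3P[s0 Fs sK] t0 ts; rewrite t0 /=.
  apply/andP; split; first by apply: contra Fs => /fsubset_trans; apply; apply: fsetSD.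
  case: ifPn => at_.
    move: sK; rewrite (fsubsetP ts _ at_) => sK.
    apply: (complex_face cK sK); last by apply: fsetSU; apply: fsetSD.
    by apply: contraNneq F0 => e; rewrite -fsubset0 -e fsubsetUr.
  apply: (complex_face cK sK) => //; case: ifP => // as_.
  apply/fsubsetP => v vt; rewrite !inE (fsubsetP ts _ vt) andbT.
  by rewrite (contraNneq _ at_)// => <-.
- move=> s; rewrite in_star// => /and3P[s0 Fs sK].
  move: sK; case: ifPn => [as_ sK|_]; last by case: cK => _ _ + _; apply.
  move=> u us uv.
  have /fsubsetPn[z zF zs] := Fs.
  pose T := s `\ a `|` F.
  have aiT : affinely_independent T by case: cK => _ _ + _; apply.
  pose u' v := (if (v == a) || (v \notin s) then 0 else u v) + u a * c v.
  have E (W : lmodType R) (f : V -> W) : \sum_(v <- T) u' v *: f v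
      = \sum_(v <- s `\ a) u v *: f v + u a *: \sum_(v <- F) c v *: f v.
    under eq_bigr do rewrite scalerDl; rewrite big_split /=; congr (_ + _).
      rewrite (@sum_fset_incl _ _ _ (s `\ a)) ?fsubsetUl//.
        by apply: eq_big_seq => v /=; rewrite !inE => /andP[/negbTE -> ->].
      by move=> v _; rewrite !inE negb_and negbK => ->; rewrite scale0r.
    rewrite scaler_sumr (@sum_fset_incl _ _ _ F) ?fsubsetUr//.
      by apply: eq_bigr => v _; rewrite scalerA.
    by move=> v _ /cF ->; rewrite mulr0 scale0r.
  have e1 : \sum_(v <- T) u' v = 0.
    have := E R^o (fun=> 1); rewrite /GRing.scale /=.
    under eq_bigr do rewrite mulr1; move=> ->.
    under eq_bigr do rewrite mulr1; under [X in _ + _ * X]eq_bigr do rewrite mulr1.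
    by rewrite c1 mulr1 -[RHS]us (big_fsetD1 a as_) /= addrC.
  have e2 : \sum_(v <- T) u' v *: v = 0.
    by rewrite E -aE -[RHS]uv (big_fsetD1 a as_) /= addrC.
  have u'0 := aiT _ e1 e2.
  have ua : u a = 0.
    have := u'0 z; rewrite /u' !inE zF orbT => /(_ isT).
    move: zs; rewrite !inE negb_and negbK => ->; rewrite add0r.
    by move/eqP; rewrite mulf_eq0 (gt_eqF (cpos _ zF)) orbF => /eqP.
  move=> v vs; have [-> //|va] := eqVneq v a.
  by have := u'0 v; rewrite /u' !inE (negbTE va) vs ua mul0r addr0 => ->.
- move=> s t w w' x sS tS bw bw' v.
  have wa : w a = w' a.
    by apply/eqP; rewrite eq_le (uniq _ _ _ _ _ sS tS bw bw') (uniq _ _ _ _ _ tS sS bw' bw).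
  have [-> //|va] := eqVneq v a.
  have := complex_uniq cK (carK _ sS) (carK _ tS)
    (barycentric_star_carrier bF bw) (barycentric_star_carrier bF bw') v.
  by rewrite /apex_lift (negbTE va) wa => /addIr.
Qed.

Lemma hull_star_carrier F a s x : open_simplex F a ->
  hull s x -> hull (star_carrier F a s) x.
Proof.
move=> [c bF _] /hullP[w bw].
exact: barycentric_hull (barycentric_star_carrier bF bw).
Qed.

Lemma star_subdivision K F a : is_complex K -> F \in K -> open_simplex F a ->
  subdivision (star K F a) K.
Proof.
move=> cK FK oF; have [c bF cpos] := oF.
have F0 := complex_neq0 cK FK.
have carK s : s \in star K F a -> star_carrier F a s \in K.
  by rewrite in_star// => /and3P[].
split; first exact: star_complex.
- apply/seteqP; split=> x [s sS sx].
    by exists (star_carrier F a s); [exact: carK|exact: hull_star_carrier].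
  have fresh := open_simplex_apex cK FK oF sS.
  have [Fs|Fs] := boolP (F `<=` s); last first.
    exists s => //; rewrite in_star//.
    have as_ : a \notin s by apply: contra Fs => a_s; rewrite (fresh a_s) fsub1set.
    by rewrite (negbTE as_) sS (complex_neq0 cK sS) (mem_fsetD1 as_) Fs.
  have [c0 cF c1 aE] := bF.
  have /hullP[w bw] := sx; have [w0 ws w1 xE] := bw.
  (* The ratio w u / c u is the largest multiple of the apex that can be subtracted from [x] with
     all weights staying nonnegative; subtracting it removes [u], so the remaining simplex no longer
     contains [F]. *)
  have [u uF umin] : exists2 u, u \in F & forall v, v \in F -> w u / c u <= w v / c v.
    have [z zF] := fset0Pn _ F0.
    pose i0 : F := [` zF].
    case: (@arg_minP _ _ _ i0 predT (fun i : F => w (val i) / c (val i)) isT) => i _ h.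
    by exists (val i) => [|v vF]; [exact: valP|exact: (h [` vF])].
  have cu := cpos _ uF.
  pose l := w u / c u.
  have l0 : 0 <= l by apply: divr_ge0 => //; exact: ltW.
  pose w' v := if v == a then l else w v - l * c v.
  have [aF|aF] := boolP (a \in F).
    exists s => //; have Fa := fresh (fsubsetP Fs _ aF).
    rewrite in_star// (complex_neq0 cK sS) /= Fa fsub1set !inE eqxx /=.
    case: ifP => // as_; suff -> : s `\ a `|` [fset a] = s by [].
    by rewrite fsetUC fsetD1K.
  have as_ : a \notin s by apply: contra aF => /fresh ->; rewrite inE.
  have ua : u != a by apply: contraNneq aF => <-.
  exists (a |` (s `\ u)).
    rewrite in_star// fset1U1 fsetU1K; last by rewrite !inE negb_and as_ orbT.
    apply/and3P; split.
    - by apply/fset0Pn; exists a; rewrite fset1U1.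
    - by apply/fsubsetPn; exists u => //; rewrite !inE eqxx.
    - suff -> : s `\ u `|` F = s by [].
      apply/fsetP => v; rewrite !inE; have [->|/=] := eqVneq v u; first by rewrite uF (fsubsetP Fs _ uF).
      by move=> _; apply: orb_idr; apply: (fsubsetP Fs).
  apply: (@barycentric_hull _ _ _ w').
  have as2 : a \notin s `\ u by rewrite !inE negb_and as_ orbT.
  have us : u \in s by exact: (fsubsetP Fs).
  have wu : w u - l * c u = 0 by rewrite /l mulfVK ?subrr// gt_eqF.
  have E (W : lmodType R) (f : V -> W) : \sum_(v <- a |` (s `\ u)) w' v *: f v
      = l *: f a + (\sum_(v <- s) w v *: f v - l *: \sum_(v <- F) c v *: f v).
    rewrite big_fsetU1//= {1}/w' eqxx; congr (_ + _).
    have -> : \sum_(v <- F) c v *: f v = \sum_(v <- s) c v *: f v.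
      by rewrite (sum_fset_incl Fs)// => v _ /cF ->; rewrite scale0r.
    rewrite scaler_sumr -sumrB (big_fsetD1 u us) /= scalerA -scalerBl wu scale0r add0r.
    apply: eq_big_seq => v vs; rewrite /w' scalerA -scalerBl.
    by rewrite ifN//; apply: contraNneq as2 => <-.
  split.
  - move=> v; rewrite /w'; case: eqP => // _; rewrite subr_ge0.
    have [vF|vF] := boolP (v \in F); last by rewrite cF// mulr0.
    by rewrite -ler_pdivlMr ?cpos//; apply: umin.
  - move=> v; rewrite !inE negb_or negb_and negbK => /andP[va /orP[/eqP ->|vs]].
      by rewrite /w' (negbTE ua).
    rewrite /w' (negbTE va) ws// cF ?mulr0 ?subrr//.
    by apply: contra vs; apply: (fsubsetP Fs).
  - have := E R^o (fun=> 1); rewrite /GRing.scale /=.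
    under eq_bigr do rewrite mulr1; move=> ->.
    under eq_bigr do rewrite mulr1; under [X in _ + (_ - _ * X)]eq_bigr do rewrite mulr1.
    by rewrite c1 w1 mulr1 addrCA subrr addr0.
  - by rewrite E -aE -xE addrCA subrr addr0.
- move=> s sS; exists (star_carrier F a s); first exact: carK.
  by move=> x; apply: hull_star_carrier.
Qed.
End Star.

(** * Simplices as intersections of half-spaces *)

Section HalfSpaces.
Local Open Scope fset_scope.
Local Open Scope ring_scope.
Variables (R : realType) (N : nat).
Local Notation V := 'rV[R]_N.
Implicit Types (s t : {fset V}) (K L : {fset {fset V}}) (x y v : V) (w : V -> R).

(* The last entry of c is the constant term. *)
Definition eval_affine (c : 'cV[R]_(N + 1)) y : R := (row_mx y 1%:M *m c) 0 0.

(** The appended entry 1 turns affine independence of the vertices into linear independence of the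
    rows. *)
Definition homogenize s : 'M[R]_(#|` s|, N + 1) :=
  \matrix_i row_mx (nth 0 s i) 1%:M.

Lemma sum_fset_nth (W : nmodType) s (f : V -> W) :
  \sum_(v <- s) f v = \sum_(i < #|` s|) f (nth 0 s i).
Proof. by rewrite (big_nth 0) big_mkord. Qed.

Lemma mul_homogenize s (u : 'rV[R]_(#|` s|)) : u *m homogenize s =
  row_mx (\sum_i u 0 i *: nth 0 s i) (\sum_i u 0 i)%:M.
Proof.
rewrite mulmx_sum_row; apply/rowP => j; rewrite summxE.
case: (split_ordP j) => k ->.
  rewrite row_mxEl summxE; apply: eq_bigr => i _.
  by rewrite [LHS]mxE [X in _ * X]mxE [X in _ * X]mxE row_mxEl [RHS]mxE.
rewrite row_mxEr ord1 mxE eqxx mulr1n; apply: eq_bigr => i _.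
by rewrite [LHS]mxE [X in _ * X]mxE [X in _ * X]mxE row_mxEr mxE mulr1.
Qed.

Lemma row_free_homogenize s : affinely_independent s -> row_free (homogenize s).
Proof.
move=> ai; apply: inj_row_free => u; rewrite mul_homogenize => /rowP e.
have e1 : \sum_i u 0 i *: nth 0 s i = 0.
  by apply/rowP => j; have := e (lshift 1 j); rewrite row_mxEl => ->; rewrite !mxE.
have e2 : \sum_i u 0 i = 0.
  by have := e (rshift N ord0); rewrite row_mxEr !mxE eqxx.
pose w v := if insub (index v s) is Some i then u 0 i else 0.
have wE (i : 'I_#|` s|) : w (nth 0 s i) = u 0 i.
  rewrite /w index_uniq ?fset_uniq// insubT// => h; congr (u 0 _).
  exact/val_inj.
apply/rowP => i; rewrite mxE -wE; apply: ai.
- by rewrite sum_fset_nth; under eq_bigr do rewrite wE.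
- by rewrite sum_fset_nth; under eq_bigr do rewrite wE.
- exact: mem_nth.
Qed.

Lemma mul_col00 m k (M : 'M[R]_(1, m)) (X : 'M[R]_(m, k)) j :
  (M *m col j X) 0 0 = (M *m X) 0 j.
Proof. by rewrite colE mulmxA -colE mxE. Qed.

(** The columns of a right inverse B of the homogenized vertex matrix A read off the weights. The
    hull is cut out by nonnegativity of these weights together with the equations B A = 1 on the
    homogenized point, each written as two inequalities. *)
Lemma affine_coordinates s : affinely_independent s ->
  exists (C : V -> 'cV[R]_(N + 1)) (H : seq 'cV[R]_(N + 1)),
    (forall w, \sum_(v <- s) w v = 1 -> forall v, v \in s ->
       eval_affine (C v) (\sum_(v <- s) w v *: v) = w v) /\
    (forall y, hull s y <-> forall c, c \in H -> 0 <= eval_affine c y).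
Proof.
move=> ai; pose A := homogenize s; pose B := pinvmx A.
have AB : A *m B = 1%:M by apply: mulmxVp; exact: row_free_homogenize.
pose C v := if insub (index v s) is Some i then col i B else 0.
have rowE w : \sum_(v <- s) w v = 1 -> row_mx (\sum_(v <- s) w v *: v) 1%:M
    = (\row_i w (nth 0 s i)) *m A.
  move=> w1; rewrite mul_homogenize; congr row_mx.
    by rewrite sum_fset_nth; apply: eq_bigr => i _; rewrite mxE.
  by rewrite -w1 sum_fset_nth; congr (_%:M); apply: eq_bigr => i _; rewrite mxE.
exists C, ([seq col i B | i <- enum 'I_#|` s|] ++ [seq col j (B *m A - 1%:M) | j <- enum 'I_(N + 1)]
  ++ [seq col j (1%:M - B *m A) | j <- enum 'I_(N + 1)]); split.
  move=> w w1 v vs; rewrite /eval_affine rowE// /C.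
  have vi : (index v s < #|` s|)%N by rewrite index_mem.
  by rewrite insubT mul_col00 -mulmxA AB mulmx1 mxE nth_index.
move=> y; split.
  move=> [w [w0 w1 ->]] c; rewrite /eval_affine rowE//.
  rewrite !mem_cat => /or3P[]/mapP[i _ ->]; rewrite mul_col00.
  - by rewrite -mulmxA AB mulmx1 mxE w0// mem_nth.
  - by rewrite mulmxBr mulmxA -(mulmxA _ A B) AB !mulmx1 subrr mxE.
  - by rewrite mulmxBr mulmxA -(mulmxA _ A B) AB !mulmx1 subrr mxE.
move=> Hc; pose u := row_mx y 1%:M *m B.
have u0 i : 0 <= u 0 i.
  have : col i B \in [seq col i B | i <- enum 'I_#|` s|] by apply: map_f; rewrite mem_enum.
  by move=> h; have := Hc (col i B); rewrite mem_cat h => /(_ isT); rewrite /eval_affine mul_col00.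
have uA : u *m A = row_mx y 1%:M.
  apply/rowP => j; apply/eqP; rewrite -mulmxA eq_le -subr_ge0 -[X in _ && X]subr_ge0.
  have h X : col j X \in [seq col j X | j <- enum 'I_(N + 1)] by apply: map_f; rewrite mem_enum.
  apply/andP; split.
  - have := Hc (col j (1%:M - B *m A)); rewrite !mem_cat h !orbT => /(_ isT).
    by rewrite /eval_affine mul_col00 mulmxBr mulmx1 mulmxA !mxE.
  - have := Hc (col j (B *m A - 1%:M)); rewrite !mem_cat h !orbT => /(_ isT).
    by rewrite /eval_affine mul_col00 mulmxBr mulmx1 mulmxA !mxE.
move: uA; rewrite mul_homogenize => /eq_row_mx[uy u1].
pose w v := if insub (index v s) is Some i then u 0 i else 0.
have wE (i : 'I_#|` s|) : w (nth 0 s i) = u 0 i.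
  rewrite /w index_uniq ?fset_uniq// insubT// => h; congr (u 0 _).
  exact/val_inj.
exists w; split.
- by move=> v _; rewrite /w; case: insubP.
- rewrite sum_fset_nth; under eq_bigr do rewrite wE.
  by move/rowP/(_ 0): u1; rewrite !mxE eqxx.
- by rewrite sum_fset_nth -uy; under [RHS]eq_bigr do rewrite wE.
Qed.
End HalfSpaces.

(** * Subdivisions and composition of PL maps *)

Section Subdivisions.
Local Open Scope fset_scope.
Local Open Scope ring_scope.
Variables (R : realType) (N : nat).
Local Notation V := 'rV[R]_N.
Implicit Types (s t : {fset V}) (K L : {fset {fset V}}) (a x y v : V) (w : V -> R).

Lemma mem_hull s v : v \in s -> hull s v.
Proof.
move=> vs; apply: (@hullS _ _ [fset v]); first by rewrite fsub1set.
exact: barycentric_hull (barycentric1 v).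
Qed.

Lemma hull_vertices s t (w : V -> R) : (forall v, v \in s -> hull t v) ->
  exists g : V -> V -> R, forall v, v \in s -> barycentric t (g v) v.
Proof.
move=> h; have [g gP] : {g : V -> V -> R & forall v, v \in s -> barycentric t (g v) v}.
  apply: (@choice _ _ (fun v g => v \in s -> barycentric t g v)) => v.
  have [vs|vs] := boolP (v \in s); last by exists (fun=> 0).
  by have /hullP[u bu] := h _ vs; exists u.
by exists g.
Qed.

Lemma sum_barycentric s t (g : V -> V -> R) (w : V -> R) (W : lmodType R) (f : V -> W) :
  \sum_(v <- s) w v *: \sum_(u <- t) g v u *: f u =
  \sum_(u <- t) (\sum_(v <- s) w v * g v u) *: f u.
Proof.
under eq_bigr do rewrite scaler_sumr; rewrite exchange_big /=.
apply: eq_bigr => u _; rewrite scaler_suml; apply: eq_bigr => v _.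
by rewrite scalerA.
Qed.

Lemma convex_combination s t (g : V -> V -> R) (w : V -> R) :
  (forall v, v \in s -> barycentric t (g v) v) ->
  (forall v, v \in s -> 0 <= w v) -> \sum_(v <- s) w v = 1 ->
  barycentric t (fun u => \sum_(v <- s) w v * g v u) (\sum_(v <- s) w v *: v).
Proof.
move=> gb w0 w1; split.
- move=> u; rewrite big_seq; apply: sumr_ge0 => v vs; apply: mulr_ge0; first exact: w0.
  by case: (gb _ vs).
- by move=> u ut; apply: big1_seq => v /= vs; case: (gb _ vs) => _ -> //; rewrite mulr0.
- rewrite exchange_big /= -[RHS]w1; apply: eq_big_seq => v /= vs.
  by rewrite -mulr_sumr; case: (gb _ vs) => _ _ -> _; rewrite mulr1.
- rewrite -(sum_barycentric s t g w id); apply: eq_big_seq => v /= vs; congr (_ *: _).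
  by case: (gb _ vs).
Qed.

Lemma hull_convex s t : (forall v, v \in s -> hull t v) -> forall x, hull s x -> hull t x.
Proof.
move=> h x [w [w0 w1 ->]]; have [g gb] := hull_vertices w h.
exact: barycentric_hull (convex_combination gb w0 w1).
Qed.

(** This is [affine_on] for an arbitrary target module, so that real-valued functions are covered as
    well. *)
Definition affine_map (W : lmodType R) s (f : V -> W) : Prop :=
  forall w, (forall v, v \in s -> 0 <= w v) -> \sum_(v <- s) w v = 1 ->
    f (\sum_(v <- s) w v *: v) = \sum_(v <- s) w v *: f v.

Lemma affine_map_sub (W : lmodType R) s t (f : V -> W) :
  (forall v, v \in s -> hull t v) -> affine_map t f -> affine_map s f.
Proof.
move=> h af w w0 w1; have [g gb] := hull_vertices w h.
have [b0 _ b1 bE] := convex_combination gb w0 w1.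
rewrite bE af// -(sum_barycentric s t g w f).
apply: eq_big_seq => v /= vs; congr (_ *: _).
have [g0 _ g1 {2}->] := gb _ vs; rewrite af//.
Qed.

Lemma affine_map_hull (W : lmodType R) s t (f : V -> W) :
  (hull s `<=` hull t)%classic -> affine_map t f -> affine_map s f.
Proof. by move=> h; apply: affine_map_sub => v /mem_hull /h. Qed.

Lemma affine_ge0 s (h : V -> R) x : affine_map s (h : V -> R^o) ->
  (forall v, v \in s -> 0 <= h v) -> hull s x -> 0 <= h x.
Proof.
move=> ah h0 [w [w0 w1 ->]]; rewrite ah// big_seq; apply: sumr_ge0 => v vs.
by apply: mulr_ge0; [exact: w0|exact: h0].
Qed.

Lemma affine_le0 s (h : V -> R) x : affine_map s (h : V -> R^o) ->
  (forall v, v \in s -> h v <= 0) -> hull s x -> h x <= 0.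
Proof.
move=> ah h0 [w [w0 w1 ->]]; rewrite ah// big_seq; apply: sumr_le0 => v vs.
by apply: mulr_ge0_le0; [exact: w0|exact: h0].
Qed.

Lemma subdivision_refl K : is_complex K -> subdivision K K.
Proof. by move=> cK; split => // s sK; exists s. Qed.

Lemma subdivision_trans K1 K2 K3 :
  subdivision K1 K2 -> subdivision K2 K3 -> subdivision K1 K3.
Proof.
move=> [c1 p1 h1] [_ p2 h2]; split => //; first by rewrite p1.
move=> s /h1[t tK st]; have [u uK tu] := h2 _ tK; exists u => //.
exact: subset_trans st tu.
Qed.

Definition same_sign s (h : V -> R) : Prop :=
  (forall v, v \in s -> 0 <= h v) \/ (forall v, v \in s -> h v <= 0).

Lemma same_sign_hull s t (h : V -> R) : affine_map t (h : V -> R^o) ->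
  (hull s `<=` hull t)%classic -> same_sign t h -> same_sign s h.
Proof.
move=> ah st [] ht; [left|right] => v /mem_hull /st.
  exact: affine_ge0.
exact: affine_le0.
Qed.

Definition crossings K (h : V -> R) : {fset V * V} :=
  [fset p in vertices K `*` vertices K |
    [&& h p.1 < 0, 0 < h p.2 & [fset p.1; p.2] \in K]].

Lemma in_crossings K h u v : ((u, v) \in crossings K h) =
  [&& h u < 0, 0 < h v & [fset u; v] \in K].
Proof.
rewrite !inE /=; apply: andb_idl => /and3P[_ _ uvK].
by apply/andP; split; apply/verticesP; exists [fset u; v]; rewrite ?fset21 ?fset22.
Qed.

(* Starring an edge with ends of opposite sign at its zero of h removes that
   crossing and creates none. *)
Lemma same_sign_subdivision K (h : V -> R) : is_complex K ->
  (forall s, s \in K -> affine_map s (h : V -> R^o)) ->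
  exists2 K', subdivision K' K & forall s, s \in K' -> same_sign s h.
Proof.
have [n] := ubnP #|` crossings K h|; elim: n K => // n IHn K ltn cK ah.
have [c0|] := eqVneq (crossings K h) fset0.
  exists K; first exact: subdivision_refl.
  move=> s sK; have [[u us hu]|hs] := pselect (exists2 u, u \in s & h u < 0).
    right => v vs; rewrite leNgt; apply/negP => hv.
    suff : (u, v) \in crossings K h by rewrite c0 inE.
    rewrite in_crossings hu hv; apply: (complex_face cK sK).
      by apply/fset0Pn; exists u; rewrite fset21.
    by apply/fsubsetP => z; rewrite !inE => /orP[]/eqP ->.
  by left => v vs; rewrite leNgt; apply/negP => hv; apply: hs; exists v.
move=> /fset0Pn[[u v]]; rewrite in_crossings => /and3P[hu hv eK].
have uv : u != v by apply/eqP => uv; move: (lt_trans hu hv); rewrite uv ltxx.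
have d0 : 0 < h v - h u by rewrite subr_gt0 (lt_trans hu).
pose c z := if z == u then h v / (h v - h u) else if z == v then - h u / (h v - h u) else 0.
have cpos z : z \in [fset u; v] -> 0 < c z.
  rewrite !inE /c; case: eqP => [_ _|_ /= ->]; first exact: divr_gt0.
  by apply: divr_gt0 => //; rewrite oppr_gt0.
pose a := \sum_(z <- [fset u; v]) c z *: z.
have E (W : nmodType) (f : V -> W) : \sum_(z <- [fset u; v]) f z = f u + f v.
  by rewrite big_fsetU1 ?inE//= big_seq_fset1.
have cu : c u = h v / (h v - h u) by rewrite /c eqxx.
have cv : c v = - h u / (h v - h u) by rewrite /c eq_sym (negbTE uv) eqxx.
have c1 : \sum_(z <- [fset u; v]) c z = 1.
  by rewrite E cu cv -mulrDl divff ?gt_eqF.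
have bc : barycentric [fset u; v] c a.
  split => //.
  - move=> z; have [/cpos/ltW //|] := boolP (z \in [fset u; v]).
    by rewrite !inE negb_or /c => /andP[/negbTE -> /negbTE ->].
  - by move=> z; rewrite !inE negb_or /c => /andP[/negbTE -> /negbTE ->].
have ha : h a = 0.
  rewrite (ah _ eK)//; last by move=> z /cpos/ltW.
  rewrite E cu cv /GRing.scale /=; field; exact: lt0r_neq0.
have oa : open_simplex [fset u; v] a by exists c.
have F0 := complex_neq0 cK eK.
have sub := star_subdivision cK eK oa.
have [c' p' h'] := sub.
have [||K' sK' sg] := IHn (star K [fset u; v] a) _ c'.
- rewrite -ltnS; apply: leq_trans ltn; rewrite ltnS; apply: fproper_ltn_card.
  apply: (@fsub_proper_trans _ (crossings K h `\ (u, v))).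
    apply/fsubsetP => -[p q]; rewrite in_crossings => /and3P[hp hq].
    rewrite in_star// => /and3P[_ sa].
    have an : a \notin [fset p; q].
      by rewrite !inE; apply/negP => /orP[]/eqP e; move: hp hq; rewrite -e ha ltxx.
    rewrite (negbTE an) => pqK; move: sa; rewrite mem_fsetD1// => sa.
    rewrite in_fsetD1 in_crossings hp hq pqK !andbT.
    by apply: contra sa => /eqP[-> ->]; exact: fsubset_refl.
  by apply: fproperD1; rewrite in_crossings hu hv.
- by move=> s /h'[t tK st]; apply: affine_map_hull st (ah _ tK).
by exists K' => //; apply: subdivision_trans sub.
Qed.

(** The functions can be treated one after the other, because a constant sign on a simplex passes to
    every simplex inside it. *)
Lemma same_sign_subdivision_seq (I : eqType) K (hs : seq I) (h : I -> V -> R) :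
  is_complex K ->
  (forall i s, i \in hs -> s \in K -> affine_map s (h i : V -> R^o)) ->
  exists2 K', subdivision K' K &
    forall i s, i \in hs -> s \in K' -> same_sign s (h i).
Proof.
elim: hs K => [|i hs IH] K cK ah; first by exists K => //; exact: subdivision_refl.
have [|K1 sK1 sg1] := same_sign_subdivision cK (h := h i).
  by move=> s; apply: ah; rewrite mem_head.
have [c1 _ h1] := sK1.
have [|K2 sK2 sg2] := IH K1 c1.
  move=> j s js /h1[t tK st]; apply: affine_map_hull st (ah j _ _ tK).
  by rewrite inE js orbT.
have [_ _ h2] := sK2.
exists K2; first exact: subdivision_trans sK1.
move=> j s; rewrite inE => /predU1P[->|js]; last exact: sg2.
move=> /h2[t tK st]; apply: same_sign_hull st (sg1 _ tK).
have [u uK tu] := h1 _ tK; apply: affine_map_hull tu (ah _ _ _ uK).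
by rewrite mem_head.
Qed.
End Subdivisions.

Section PLMaps.
Local Open Scope fset_scope.
Local Open Scope ring_scope.
Variable (R : realType).

Lemma affine_map_comp (N P : nat) (W : lmodType R) (s : {fset 'rV[R]_N})
    (t : {fset 'rV[R]_P}) (f : 'rV[R]_N -> 'rV[R]_P) (g : 'rV[R]_P -> W) :
  affine_map s f -> (forall v, v \in s -> hull t (f v)) -> affine_map t g ->
  affine_map s (g \o f).
Proof.
move=> af st ag w w0 w1 /=; rewrite af//.
have [k kP] : {k : 'rV[R]_N -> 'rV[R]_P -> R & forall v, v \in s -> barycentric t (k v) (f v)}.
  apply: (@choice _ _ (fun v g => v \in s -> barycentric t g (f v))) => v.
  have [vs|vs] := boolP (v \in s); last by exists (fun=> 0).
  by have /hullP[u bu] := st _ vs; exists u.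
pose b u := \sum_(v <- s) w v * k v u.
have D (W' : lmodType R) (e : 'rV[R]_P -> W') :
    \sum_(v <- s) w v *: \sum_(u <- t) k v u *: e u = \sum_(u <- t) b u *: e u.
  under eq_bigr do rewrite scaler_sumr; rewrite exchange_big /=.
  apply: eq_bigr => u _; rewrite scaler_suml; apply: eq_bigr => v _.
  by rewrite scalerA.
have -> : \sum_(v <- s) w v *: f v = \sum_(u <- t) b u *: u.
  rewrite -(D _ id); apply: eq_big_seq => v /= vs; congr (_ *: _).
  by case: (kP _ vs).
rewrite ag.
- rewrite -D; apply: eq_big_seq => v /= vs; congr (_ *: _).
  by have [k0 _ k1 ->] := kP _ vs; rewrite ag.
- move=> u _; rewrite /b big_seq; apply: sumr_ge0 => v vs.
  by apply: mulr_ge0; [exact: w0|case: (kP _ vs)].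
- rewrite exchange_big /= -[RHS]w1; apply: eq_big_seq => v /= vs.
  by rewrite -mulr_sumr; case: (kP _ vs) => _ _ -> _; rewrite mulr1.
Qed.

Lemma eval_affine_affine (N : nat) (s : {fset 'rV[R]_N}) c :
  affine_map s (eval_affine c : 'rV[R]_N -> R^o).
Proof.
move=> w _ w1; rewrite /eval_affine /GRing.scale /=.
have -> : row_mx (\sum_(v <- s) w v *: v) (1%:M : 'M[R]_1) =
    \sum_(v <- s) w v *: row_mx v (1%:M : 'M[R]_1).
  apply/rowP => j; rewrite summxE; case: (split_ordP j) => k ->.
    by rewrite row_mxEl summxE; apply: eq_bigr => v _; rewrite [LHS]mxE [RHS]mxE row_mxEl.
  rewrite row_mxEr ord1 mxE eqxx mulr1n -[LHS]w1; apply: eq_bigr => v _.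
  by rewrite [RHS]mxE row_mxEr mxE eqxx mulr1.
rewrite mulmx_suml summxE; apply: eq_bigr => v _.
by rewrite -scalemxAl mxE.
Qed.

(** [K1] is cut along the pullbacks under [f] of all half-spaces that bound simplices of [L1]. On a
    simplex of the result none of these functions changes sign, so its image lies in any simplex of
    [L1] that contains the image of its barycentre. *)
Lemma pl_map_comp (N P Q : nat) (K : {fset {fset 'rV[R]_N}})
    (L : {fset {fset 'rV[R]_P}}) (M : {fset {fset 'rV[R]_Q}}) f g :
  pl_map K L f -> pl_map L M g -> pl_map K M (g \o f).
Proof.
move=> [fKL [K1 sK1 af]] [gLM [L1 sL1 ag]]; split.
  move=> _ [x Kx <-]; apply: gLM; exists (f x) => //.
  by apply: fKL; exists x.
have [cK1 pK1 hK1] := sK1; have [cL1 pL1 hL1] := sL1.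
have [H HP] : {H : {fset 'rV[R]_P} -> seq 'cV[R]_(P + 1) & forall t, t \in L1 ->
    forall y, hull t y <-> forall c, c \in H t -> 0 <= eval_affine c y}.
  apply: (@choice _ _ (fun t H => t \in L1 -> forall y, hull t y <->
     forall c, c \in H -> 0 <= eval_affine c y)) => t.
  have [tL|_] := boolP (t \in L1); last by exists [::].
  have [_ [H [_ hH]]] : _ := affine_coordinates (let: And4 _ _ h _ := cL1 in h _ tL).
  by exists H.
pose hs := flatten [seq H t | t <- L1].
have [|K2 sK2 sg] := @same_sign_subdivision_seq _ _ _ K1 hs (fun c => eval_affine c \o f) cK1.
  move=> c s _ sK; apply: (@affine_map_comp _ _ _ s [fset f v | v in s]).
  - exact: af.
  - by move=> v vs; apply: mem_hull; apply: in_imfset.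
  - exact: eval_affine_affine.
exists K2; first exact: subdivision_trans sK2 sK1.
have [cK2 pK2 hK2] := sK2.
move=> s sK.
have [s1 s1K ss1] := hK2 _ sK.
have afs : affine_map s f by apply: affine_map_hull ss1 (af _ s1K).
have s0 := complex_neq0 cK2 sK.
pose k : R := #|` s|%:R^-1.
have card0 : #|` s|%:R != 0 :> R by rewrite pnatr_eq0 cardfs_eq0.
have k0 : 0 < k by rewrite invr_gt0 lt0r card0 ler0n.
have k1 : \sum_(v <- s) k = 1.
  by rewrite big_const_seq count_predT iter_addr addr0 -mulr_natr mulVf.
pose p := \sum_(v <- s) k *: v.
have sp : hull s p by exists (fun=> k); split => // *; exact: ltW.
have [t tL tfp] : polyhedron L1 (f p).
  rewrite pL1; apply: fKL; exists p => //.
  by rewrite -pK1 -pK2; exists s.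
suff stf v : v \in s -> hull t (f v).
  exact: (affine_map_comp afs stf (ag _ tL)).
move=> vs; apply/(HP _ tL) => c cH.
have fp0 : 0 <= eval_affine c (f p) by apply: (HP _ tL _).1.
have chs : c \in hs by apply/flatten_mapP; exists t.
have [h|h] := sg _ _ chs sK; first exact: h.
(* The other sign: the function is nonpositive at every vertex but nonnegative at the barycentre
   [p], which averages the vertices. So no vertex can have a negative value. *)
have ac : affine_map s (eval_affine c \o f : _ -> R^o).
  apply: (@affine_map_comp _ _ _ s [fset f v | v in s]) => //.
  - by move=> u us; apply: mem_hull; apply: in_imfset.
  - exact: eval_affine_affine.
have := ac (fun=> k) (fun _ _ => ltW k0) k1; rewrite -/p /= => e.
move: fp0; rewrite e (big_fsetD1 v vs) /= => fp0.
have : 0 <= k * eval_affine c (f v).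
  apply: le_trans fp0 _; rewrite gerDl big_seq; apply: sumr_le0 => u.
  by rewrite !inE => /andP[_ us]; apply: mulr_ge0_le0; [exact: ltW|exact: h].
by rewrite pmulr_rge0.
Qed.

Lemma pl_homeomorphic_trans (N P Q : nat) (K : {fset {fset 'rV[R]_N}})
    (L : {fset {fset 'rV[R]_P}}) (M : {fset {fset 'rV[R]_Q}}) :
  pl_homeomorphic K L -> pl_homeomorphic L M -> pl_homeomorphic K M.
Proof.
move=> [f [g [f_pl g_pl gf fg]]] [f' [g' [f_pl' g_pl' gf' fg']]].
exists (f' \o f), (g \o g'); split; [exact: pl_map_comp f_pl f_pl'|exact: pl_map_comp g_pl' g_pl| |].
- move=> x Kx /=; rewrite gf' ?gf//.
  by case: f_pl => h _; apply: h; exists x.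
- move=> x Kx /=; rewrite fg ?fg'//.
  by case: g_pl' => h _; apply: h; exists x.
Qed.

Lemma pl_homeomorphic_sym (N P : nat) (K : {fset {fset 'rV[R]_N}})
    (L : {fset {fset 'rV[R]_P}}) : pl_homeomorphic K L -> pl_homeomorphic L K.
Proof. by move=> [f [g [f_pl g_pl gf fg]]]; exists g, f. Qed.

Lemma subdivision_pl_homeomorphic (N : nat) (K K' : {fset {fset 'rV[R]_N}}) :
  subdivision K' K -> pl_homeomorphic K' K.
Proof.
move=> sK; have [cK' pK' _] := sK.
exists id, id; split => //; split.
- by move=> _ [x Kx <-]; rewrite -pK'.
- by exists K'; first exact: subdivision_refl.
- by move=> _ [x Kx <-]; rewrite pK'.
- by exists K'.
Qed.
End PLMaps.

(** * Simplicial isomorphisms and links of stellar subdivisions *)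

Section SimplicialMaps.
Local Open Scope fset_scope.
Local Open Scope ring_scope.
Variable (R : realType).

(** Well defined by [complex_uniq]. Off the polyhedron the value 0 is a mere default. *)
Lemma simplicial_extension (N : nat) (K : {fset {fset 'rV[R]_N}}) (W : lmodType R)
    (phi : 'rV[R]_N -> W) : is_complex K ->
  exists f : 'rV[R]_N -> W, forall s w x, s \in K -> barycentric s w x ->
    f x = \sum_(v <- s) w v *: phi v.
Proof.
move=> cK; have [f fP] : {f : 'rV[R]_N -> W & forall x s w, s \in K ->
    barycentric s w x -> f x = \sum_(v <- s) w v *: phi v}.
  apply: (@choice _ _ (fun x y => forall s w, s \in K ->
    barycentric s w x -> y = \sum_(v <- s) w v *: phi v)) => x.
  have [[s [w [sK bw]]]|h] := pselect (exists s w, s \in K /\ barycentric s w x).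
    exists (\sum_(v <- s) w v *: phi v) => t w' tK bw'.
    under [RHS]eq_bigr do rewrite -(complex_uniq cK sK tK bw bw').
    apply: sum_fset_eq => v; first by case: bw => _ + _ _ => /[apply] ->; rewrite scale0r.
    rewrite (complex_uniq cK sK tK bw bw').
    by case: bw' => _ + _ _ => /[apply] ->; rewrite scale0r.
  by exists 0 => s w sK bw; case: h; exists s, w.
by exists f => s w x; apply: fP.
Qed.

Lemma simplicial_pl_map (N P : nat) (K : {fset {fset 'rV[R]_N}})
    (L : {fset {fset 'rV[R]_P}}) (phi f : 'rV[R]_N -> 'rV[R]_P) (psi g : 'rV[R]_P -> 'rV[R]_N) :
  is_complex K ->
  (forall s w x, s \in K -> barycentric s w x -> f x = \sum_(v <- s) w v *: phi v) ->
  (forall s w x, s \in L -> barycentric s w x -> g x = \sum_(v <- s) w v *: psi v) ->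
  (forall s, s \in K -> [fset phi v | v in s] \in L) ->
  (forall s v, s \in K -> v \in s -> psi (phi v) = v) ->
  pl_map K L f /\ forall x, polyhedron K x -> g (f x) = x.
Proof.
move=> cK fP gP KL psiK.
have phi_inj s : s \in K -> {in s &, injective phi}.
  by move=> sK u v us vs e; rewrite -(psiK _ _ sK us) e (psiK _ _ sK vs).
pose w' (s : {fset 'rV[R]_N}) (w : 'rV[R]_N -> R) u := if u \in [fset phi v | v in s] then w (psi u) else 0.
have E (W : nmodType) (s : {fset 'rV[R]_N}) w (h : 'rV[R]_P -> R -> W) : s \in K ->
    \sum_(u <- [fset phi v | v in s]) h u (w' s w u) = \sum_(v <- s) h (phi v) (w v).
  move=> sK; rewrite big_imfset /=; last exact: phi_inj sK.
  apply: eq_big_seq => v vs; rewrite /w' in_imfset//.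
  by rewrite (psiK _ _ sK vs).
have fb (s : {fset 'rV[R]_N}) w x : s \in K -> barycentric s w x ->
    barycentric [fset phi v | v in s] (w' s w) (f x).
  move=> sK bw; have [w0 ws w1 xE] := bw; split.
  - by move=> u; rewrite /w'; case: ifP.
  - by move=> u; rewrite /w' => /negbTE ->.
  - by rewrite (E _ _ _ (fun _ r => r)).
  - by rewrite (E _ _ _ (fun u r => r *: u))// (fP _ _ _ sK bw).
split; last first.
  move=> x [s sK /hullP[w bw]]; rewrite (gP _ _ _ (KL _ sK) (fb _ _ _ sK bw)).
  rewrite (E _ _ _ (fun u r => r *: psi u))//; case: (bw) => _ _ _ ->.
  by apply: eq_big_seq => v vs; rewrite (psiK _ _ sK vs).
split.
  move=> _ [x [s sK /hullP[w bw]] <-]; exists [fset phi v | v in s]; first exact: KL.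
  exact: barycentric_hull (fb _ _ _ sK bw).
exists K; first exact: subdivision_refl.
have fv s v : s \in K -> v \in s -> f v = phi v.
  move=> sK vs; rewrite (fP _ _ _ (complex_vertex cK sK vs) (barycentric1 v)).
  by rewrite big_seq_fset1 eqxx scale1r.
move=> s sK w w0 w1.
have [u bu] : exists u, barycentric s u (\sum_(v <- s) w v *: v).
  by apply/hullP; exists w.
rewrite (fP _ _ _ sK bu); apply: eq_big_seq => v vs; rewrite (fv _ _ sK vs).
congr (_ *: _); case: bu => _ _ u1 uE.
apply: (affinely_independent_uniq _ _ _ vs); last by rewrite uE.
  by case: cK => _ _ + _; apply.
by rewrite u1 w1.
Qed.

Lemma simplicial_iso_pl_homeomorphic (N P : nat) (K : {fset {fset 'rV[R]_N}})
    (L : {fset {fset 'rV[R]_P}}) (phi : 'rV[R]_N -> 'rV[R]_P) (psi : 'rV[R]_P -> 'rV[R]_N) :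
  is_complex K -> is_complex L ->
  (forall s, s \in K -> [fset phi v | v in s] \in L) ->
  (forall t, t \in L -> [fset psi v | v in t] \in K) ->
  (forall s v, s \in K -> v \in s -> psi (phi v) = v) ->
  (forall t u, t \in L -> u \in t -> phi (psi u) = u) ->
  pl_homeomorphic K L.
Proof.
move=> cK cL KL LK psiK phiK.
have [f fP] := simplicial_extension phi cK.
have [g gP] := simplicial_extension psi cL.
have [f_pl gf] := simplicial_pl_map cK fP gP KL psiK.
have [g_pl fg] := simplicial_pl_map cL gP fP LK phiK.
by exists f, g.
Qed.
End SimplicialMaps.

Section Links.
Local Open Scope fset_scope.
Local Open Scope ring_scope.
Variables (R : realType) (N : nat).
Local Notation V := 'rV[R]_N.
Implicit Types (s t F : {fset V}) (K L : {fset {fset V}}) (a b x y v u : V).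

Lemma exists_open_simplex F : F != fset0 -> exists a, open_simplex F a.
Proof.
move=> F0; pose k : R := #|` F|%:R^-1.
have card0 : #|` F|%:R != 0 :> R by rewrite pnatr_eq0 cardfs_eq0.
have k0 : 0 < k by rewrite invr_gt0 lt0r card0 ler0n.
pose c v := if v \in F then k else 0.
have E (W : nmodType) (h : V -> R -> W) :
    \sum_(v <- F) h v (c v) = \sum_(v <- F) h v k.
  by apply: eq_big_seq => v vF; rewrite /c vF.
exists (\sum_(v <- F) k *: v), c; last by move=> v; rewrite /c => ->.
split.
- by move=> v; rewrite /c; case: ifP => // _; exact: ltW.
- by move=> v /negbTE; rewrite /c => ->.
- rewrite (E _ (fun _ r => r)).
  by rewrite big_const_seq count_predT iter_addr addr0 -mulr_natr mulVf.
- by rewrite (E _ (fun v r => r *: v)).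
Qed.

(** Exchanges the names of two apexes and so identifies the complexes starred with one or the
    other. *)
Definition swap a b v := if v == a then b else if v == b then a else v.

Lemma swapK a b : involutive (swap a b).
Proof.
move=> v; rewrite /swap; have [->|va] := eqVneq v a.
  by case: eqP => [->|_]; rewrite ?eqxx.
by have [->|vb] := eqVneq v b; rewrite ?eqxx ?(negbTE va) ?(negbTE vb).
Qed.

Lemma swap_id a b s : a \notin s -> b \notin s -> [fset swap a b v | v in s] = s.
Proof.
move=> as_ bs; have e v : v \in s -> swap a b v = v.
  move=> vs; rewrite /swap ifN ?ifN//; first by apply: contraNneq bs => <-.
  by apply: contraNneq as_ => <-.
apply/fsetP => v; apply/imfsetP/idP => [[u /= us ->]|vs]; first by rewrite e.
by exists v; rewrite ?e.
Qed.

Lemma swap_simplex a b s : a \in s -> b \notin s ->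
  [fset swap a b v | v in s] = b |` (s `\ a).
Proof.
move=> as_ bs; apply/fsetP => v; rewrite !inE; apply/imfsetP/idP.
  move=> [u /= us ->]; rewrite /swap; have [_|ua] := eqVneq u a; first by rewrite eqxx.
  have ub : u != b by apply: contraNneq bs => <-.
  by rewrite !(negbTE ub) us ?ua.
move=> /orP[/eqP ->|/andP[va vs]].
  by exists a; rewrite // /swap eqxx.
exists v; rewrite // /swap (negbTE va) ifN//.
by apply: contraNneq bs => <-.
Qed.

Lemma star_swap L F a b s : F != fset0 ->
  (forall t, t \in L -> a \in t -> F = [fset a]) ->
  (forall t, t \in L -> b \in t -> F = [fset b]) ->
  s \in star L F a -> [fset swap a b v | v in s] \in star L F b.
Proof.
move=> F0 ha hb; have [<-|ab] := eqVneq a b.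
  suff -> : [fset swap a a v | v in s] = s by [].
  apply/fsetP => v; apply/imfsetP/idP => [[u /= us ->]|vs].
    by rewrite /swap; case: eqP => // <-.
  by exists v; rewrite // /swap; case: eqP.
rewrite in_star// => /and3P[s0 Fs]; case: ifPn => [as_|as_] sL.
  have bs : b \notin s.
    apply/negP => bs; have Fb : F = [fset b].
      by apply: (hb _ sL); rewrite !inE bs eq_sym ab.
    by move: Fs; rewrite Fb fsub1set !inE bs eq_sym ab.
  rewrite swap_simplex// in_star// fset1U1 fsetU1K; last by rewrite !inE negb_and bs orbT.
  rewrite Fs sL !andbT; apply/fset0Pn; exists b; exact: fset1U1.
rewrite mem_fsetD1// in Fs.
have bs : b \notin s by apply: contra Fs => bs; rewrite (hb _ sL bs) fsub1set.
by rewrite swap_id// in_star// s0 (negbTE bs) (mem_fsetD1 bs) Fs sL.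
Qed.

(** In a link the apex is only a label and does not lie in the starred face. Renaming it to a point
    [b] of the open simplex [F] is a simplicial isomorphism, and the star at [b] is a true
    subdivision of [L]. *)
Lemma star_pl_homeomorphic L F a : is_complex L -> F \in L ->
  (forall s, s \in L -> a \notin s) -> is_complex (star L F a) ->
  pl_homeomorphic (star L F a) L.
Proof.
move=> cL FL aL cS; have F0 := complex_neq0 cL FL.
have [b ob] := exists_open_simplex F0.
have hb t := open_simplex_apex cL FL ob (s := t).
have ha t : t \in L -> a \in t -> F = [fset a] by move=> /aL /negbTE ->.
apply: pl_homeomorphic_trans (subdivision_pl_homeomorphic (star_subdivision cL FL ob)).
have swapC : swap b a =1 swap a b.
  move=> v; rewrite /swap; case: (eqVneq v a) => [->|va]; first by case: eqP.
  by case: eqP.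
apply: (@simplicial_iso_pl_homeomorphic _ _ _ _ _ (swap a b) (swap a b) cS).
- exact: star_complex.
- by move=> s; apply: star_swap.
- move=> s sS; have := star_swap F0 hb ha sS.
  suff -> : [fset swap b a v | v in s] = [fset swap a b v | v in s] by [].
  by apply/fsetP => v; apply/imfsetP/imfsetP => -[u us ->]; exists u; rewrite ?swapC.
- by move=> s v _ _; rewrite swapK.
- by move=> s v _ _; rewrite swapK.
Qed.

Lemma star_notin L F a : is_complex L -> F != fset0 -> F \notin L ->
  (forall s, s \in L -> a \notin s) -> star L F a = L.
Proof.
move=> cL F0 FL aL; apply/fsetP => s; rewrite in_star//.
apply/and3P/idP => [[s0 Fs]|sL].
  case: ifPn => // as_ h; have : F \in L by apply: (complex_face cL h) => //; exact: fsubsetUr.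
  by rewrite (negbTE FL).
have as_ := aL _ sL; rewrite (negbTE as_) (mem_fsetD1 as_); split => //.
  exact: complex_neq0 sL.
by apply: contra FL => /(complex_face cL sL F0).
Qed.

Lemma in_link K v t : is_complex K ->
  (t \in link K v) = [&& t != fset0, v \notin t & v |` t \in K].
Proof.
move=> cK; rewrite !inE /=; apply/and3P/and3P => -[h1 h2 h3]; split => //.
  exact: complex_neq0 h1.
by apply: (complex_face cK h3) => //; exact: fsubsetU1.
Qed.

Lemma link_complex K v : is_complex K -> is_complex (link K v).
Proof.
move=> cK; apply: (complex_sub cK); first by apply/fsubsetP => t; rewrite !inE => /andP[].
move=> s t; rewrite !in_link// => /and3P[s0 vs vsK] t0 ts; rewrite t0 /=.
apply/andP; split; first by apply: contra vs; apply: (fsubsetP ts).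
apply: (complex_face cK vsK); last exact: fsetUS.
by apply/fset0Pn; exists v; rewrite fset1U1.
Qed.

(** This is why old vertices keep links of the same PL type: starring [K] only stars their links,
    with the same label [a]. *)
Lemma link_star K F a v : is_complex K -> is_complex (star K F a) ->
  F `\ v != fset0 -> v != a -> (forall s, s \in K -> a \notin s) ->
  link (star K F a) v = star (link K v) (F `\ v) a.
Proof.
move=> cK cS Fv0 va aK; have F0 : F != fset0.
  by apply: contraNneq Fv0 => ->; rewrite fset0D.
apply/fsetP => t; rewrite in_link// in_star// in_star//.
have [t0|t0] /= := eqVneq t fset0; first by [].
have -> : v |` t != fset0 by apply/fset0Pn; exists v; rewrite fset1U1.
rewrite [a \in v |` t]in_fset1U eq_sym (negbTE va) /=.
have -> : (F `<=` (v |` t) `\ a) = (F `\ v `<=` t `\ a).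
  apply/fsubsetP/fsubsetP => h u.
    rewrite !inE => /andP[uv uF]; have := h _ uF.
    by rewrite !inE (negbTE uv).
  move=> uF; rewrite !inE; have [->|uv] /= := eqVneq u v; first by rewrite va.
  by have := h u; rewrite !inE uv uF /=; apply.
have [vt|vt] /= := boolP (v \in t).
  symmetry; apply/negbTE; rewrite negb_and; apply/orP; right.
  case: ifP => _; rewrite in_link// !negb_and negbK ?vt ?orbT//.
  by rewrite !inE vt va orbT.
case: ifPn => at_; last by rewrite in_link// t0 vt.
rewrite in_link//; congr (_ && _).
have -> : (t `\ a `|` F `\ v != fset0).
  by apply: contraNneq Fv0 => e; rewrite -fsubset0 -e fsubsetUr.
have -> : v \notin t `\ a `|` F `\ v by rewrite !inE eqxx (negbTE vt) andbF.
suff -> : (v |` t) `\ a `|` F = v |` (t `\ a `|` F `\ v) by [].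
apply/fsetP => u; rewrite !inE; have [->|uv] /= := eqVneq u v; first by rewrite va.
by [].
Qed.
End Links.

(** * Invariance of dimension, and free faces of PL balls *)

Section Dimension.
Local Open Scope fset_scope.
Local Open Scope ring_scope.
Variable (R : realType).

Lemma eval_affineE N (c : 'cV[R]_(N + 1)) y :
  eval_affine c y = (y *m usubmx c) 0 0 + dsubmx c 0 0.
Proof. by rewrite /eval_affine -{1}[c]vsubmxK mul_row_col mul1mx mxE. Qed.

Lemma eval_affine_line N (c : 'cV[R]_(N + 1)) (e : R) y z :
  eval_affine c ((1 - e) *: y + e *: z) =
  (1 - e) * eval_affine c y + e * eval_affine c z.
Proof.
rewrite !eval_affineE mulmxDl -!scalemxAl mxE [X in X + _ + _]mxE [X in _ + X + _]mxE.
by ring.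
Qed.

(** The homogenized matrix of [t] has smaller rank than that of [s], so some column of its cokernel
    does not vanish on the rows of [s]. *)
Lemma separating_functional N (s t : {fset 'rV[R]_N}) :
  affinely_independent s -> (#|` t| < #|` s|)%N ->
  exists2 c : 'cV[R]_(N + 1), forall v, v \in t -> eval_affine c v = 0 &
    exists2 v, v \in s & eval_affine c v != 0.
Proof.
move=> ai ts; pose A := homogenize s; pose B := homogenize t.
have : ~~ (A <= B)%MS.
  apply/negP => /mxrankS; have /eqP -> := row_free_homogenize ai.
  by rewrite leqNgt (leq_ltn_trans (rank_leq_row _)).
have E (u : {fset 'rV[R]_N}) c (i : 'I_#|` u|) :
    eval_affine c (nth 0 u i) = (homogenize u *m c) i 0.
  have -> : (homogenize u *m c) i 0 = (row i (homogenize u *m c)) 0 0 by rewrite [RHS]mxE.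
  by rewrite row_mul rowK.
rewrite submxE => /matrix0Pn[i [j AB]].
exists (col j (cokermx B)) => [v vt|].
  have vi : (index v t < #|` t|)%N by rewrite index_mem.
  rewrite -(nth_index 0 vt) (E t _ (Ordinal vi)).
  by rewrite colE mulmxA mulmx_coker mul0mx mxE.
exists (nth 0 s i); first exact: mem_nth.
by rewrite E colE mulmxA -colE mxE.
Qed.

Lemma hull_eval_affine0 N (t : {fset 'rV[R]_N}) c x :
  (forall v, v \in t -> eval_affine c v = 0) -> hull t x -> eval_affine c x = 0.
Proof.
move=> c0 [w [w0 w1 ->]]; rewrite (eval_affine_affine c w0 w1).
by apply: big1_seq => v /= vt; rewrite c0// scaler0.
Qed.

Lemma nonroot_nat (p : {poly R}) : p != 0 -> exists k : nat, ~~ root p k.+1%:R.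
Proof.
move=> p0; apply: contrapT => /forallNP h.
suff : (size [seq k.+1%:R : R | k <- iota 0 (size p)] < size p)%N.
  by rewrite size_map size_iota ltnn.
apply: max_poly_roots => //.
  by apply/allP => _ /mapP[k _ ->]; apply/negPn/negP; exact: h.
rewrite map_inj_uniq ?iota_uniq// => i j /eqP.
by rewrite eqr_nat => /eqP[].
Qed.

(* Along the moment curve of s, each lower-dimensional hull is avoided outside
   the roots of a nonzero polynomial. *)
Lemma generic_point N (s : {fset 'rV[R]_N}) (T : seq {fset 'rV[R]_N}) :
  affinely_independent s -> s != fset0 ->
  (forall t, t \in T -> (#|` t| < #|` s|)%N) ->
  exists2 x, open_simplex s x & forall t, t \in T -> ~ hull t x.
Proof.
move=> ai s0 Ts.
have [c cP] : {c : {fset 'rV[R]_N} -> 'cV[R]_(N + 1) & forall t, t \in T ->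
    (forall v, v \in t -> eval_affine (c t) v = 0) /\
    exists2 v, v \in s & eval_affine (c t) v != 0}.
  apply: (@choice _ _ (fun t c => t \in T -> (forall v, v \in t -> eval_affine c v = 0) /\
    exists2 v, v \in s & eval_affine c v != 0)) => t.
  have [tT|_] := boolP (t \in T); last by exists 0.
  by have [c ct cs] := separating_functional ai (Ts _ tT); exists c.
pose P t := \poly_(i < #|` s|) eval_affine (c t) (nth 0 s i).
have P0 t : t \in T -> P t != 0.
  move=> /cP[_ [v vs]]; apply: contraNneq => /polyP/(_ (index v s)).
  by rewrite coef_poly index_mem vs nth_index// coef0 => ->.
have [|k] := @nonroot_nat (\prod_(t <- T) P t).
  by rewrite prodf_seq_neq0; apply/allP => t tT /=; exact: P0.
set l : R := k.+1%:R => nr.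
have l0 : 0 < l by rewrite ltr0n.
pose S := \sum_(v <- s) l ^+ index v s.
have S0 : 0 < S.
  have /fset0Pn[v vs] := s0; rewrite /S (big_fsetD1 v vs) /=.
  apply: ltr_wpDr; last exact: exprn_gt0.
  by apply: sumr_ge0 => u _; apply: exprn_ge0; exact: ltW.
pose w v := if v \in s then l ^+ index v s / S else 0.
have wE (W : nmodType) (h : 'rV[R]_N -> R -> W) :
    \sum_(v <- s) h v (w v) = \sum_(v <- s) h v (l ^+ index v s / S).
  by apply: eq_big_seq => v vs; rewrite /w vs.
have wpos v : v \in s -> 0 < w v.
  by rewrite /w => ->; apply: divr_gt0 => //; exact: exprn_gt0.
have w1 : \sum_(v <- s) w v = 1.
  by rewrite (wE _ (fun _ r => r)) -mulr_suml divff// gt_eqF.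
exists (\sum_(v <- s) w v *: v).
  exists w => //; split => //; last by move=> v /negbTE; rewrite /w => ->.
  move=> v; have [/wpos/ltW //|vs] := boolP (v \in s).
  by rewrite /w (negbTE vs).
move=> t tT /(hull_eval_affine0 (cP _ tT).1).
rewrite eval_affine_affine//; last by move=> v /wpos/ltW.
move: nr; rewrite /root horner_prod prodf_seq_neq0 => /allP/(_ _ tT) /= /negP h e.
apply: h; rewrite horner_poly; apply/eqP; apply: (mulIf (invr_neq0 (lt0r_neq0 S0))).
rewrite mul0r mulr_suml -[RHS]e sum_fset_nth; apply: eq_bigr => i _.
rewrite /w mem_nth// index_uniq ?fset_uniq// /GRing.scale /=.
by rewrite -mulrA mulrC.
Qed.

(** Dimension theory by general position: a generic point of [s] escapes every hull with fewer
    vertices. *)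
Lemma hull_cover_card N (s : {fset 'rV[R]_N}) (T : seq {fset 'rV[R]_N}) :
  affinely_independent s -> s != fset0 ->
  (forall x, hull s x -> exists2 t, t \in T & hull t x) ->
  exists2 t, t \in T & (#|` s| <= #|` t|)%N.
Proof.
move=> ai s0 cover; apply: contrapT => H.
have [|x [w bw _] hx] := generic_point (T := T) ai s0.
  by move=> t tT; rewrite ltnNge; apply/negP => ?; apply: H; exists t.
by have [t tT /(hx _ tT)] := cover _ (barycentric_hull bw).
Qed.

Lemma hull_sub_card N (s t : {fset 'rV[R]_N}) :
  affinely_independent s -> (forall x, hull s x -> hull t x) -> (#|` s| <= #|` t|)%N.
Proof.
move=> ai st; have [->|s0] := eqVneq s fset0; first by rewrite cardfs0.
have [|u] := hull_cover_card (T := [:: t]) ai s0; last by rewrite inE => /eqP ->.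
by move=> x /st; exists t; rewrite ?inE.
Qed.

Section AffineImage.
Variables (N P : nat) (s : {fset 'rV[R]_N}) (f : 'rV[R]_N -> 'rV[R]_P).
Hypothesis (f_affine : affine_map s f).

Lemma affine_map_vertex_inj :
  {in hull s &, injective f} -> {in s &, injective f}.
Proof. by move=> inj u v us vs; apply: inj; rewrite inE; exact: mem_hull. Qed.

Lemma hull_image x : hull s x -> hull [fset f v | v in s] (f x).
Proof.
move=> [w [w0 w1 ->]]; rewrite f_affine//.
have h v : v \in s -> hull [fset f v | v in s] (f v).
  by move=> vs; apply: mem_hull; exact: in_imfset.
have [g gP] : {g : 'rV[R]_N -> 'rV[R]_P -> R & forall v, v \in s ->
    barycentric [fset f v | v in s] (g v) (f v)}.
  apply: (@choice _ _ (fun v g => v \in s -> barycentric [fset f v | v in s] g (f v))) => v.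
  have [vs|vs] := boolP (v \in s); last by exists (fun=> 0).
  by have /hullP[u bu] := h _ vs; exists u.
apply: (@barycentric_hull _ _ _ (fun u => \sum_(v <- s) w v * g v u)); split.
- move=> u; rewrite big_seq; apply: sumr_ge0 => v vs.
  by apply: mulr_ge0; [exact: w0|case: (gP _ vs)].
- by move=> u us; apply: big1_seq => v /= vs; case: (gP _ vs) => _ -> //; rewrite mulr0.
- rewrite exchange_big /= -[RHS]w1; apply: eq_big_seq => v vs.
  by rewrite -mulr_sumr; case: (gP _ vs) => _ _ -> _; rewrite mulr1.
- under [RHS]eq_bigr do rewrite scaler_suml; rewrite exchange_big /=.
  apply: eq_big_seq => v vs; have [_ _ _ {1}->] := gP _ vs.
  by rewrite scaler_sumr; apply: eq_bigr => u _; rewrite scalerA.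
Qed.

Hypothesis (f_inj : {in s &, injective f}).

Lemma sum_image (W : nmodType) (h : 'rV[R]_P -> W) :
  \sum_(u <- [fset f v | v in s]) h u = \sum_(v <- s) h (f v).
Proof. by rewrite big_imfset. Qed.

Lemma hull_image_inv y : hull [fset f v | v in s] y -> exists2 x, hull s x & f x = y.
Proof.
move=> [w [w0 w1 ->]]; rewrite sum_image in w1.
have wf v : v \in s -> 0 <= w (f v) by move=> vs; apply: w0; exact: in_imfset.
exists (\sum_(v <- s) w (f v) *: v); first by exists (w \o f).
by rewrite (f_affine wf w1) sum_image.
Qed.

Lemma card_image_fset : #|` [fset f v | v in s]| = #|` s|.
Proof. exact: card_in_imfset. Qed.
End AffineImage.

(** A relation among the image vertices, scaled by k / M to keep the weights nonnegative, moves the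
    barycentre of [s] to a point of the hull with the same image. By injectivity the two points
    coincide, so the relation is trivial. *)
Lemma affinely_independent_image N P (s : {fset 'rV[R]_N}) (f : 'rV[R]_N -> 'rV[R]_P) :
  affine_map s f -> affinely_independent s -> {in hull s &, injective f} ->
  affinely_independent [fset f v | v in s].
Proof.
move=> af ai inj u; have vinj := affine_map_vertex_inj inj.
rewrite !(sum_image vinj) => u0 uv0 _ /imfsetP[v /= vs ->].
have s0 : s != fset0 by apply/fset0Pn; exists v.
pose M := 1 + \sum_(v <- s) `|u (f v)|.
have M0 : 0 < M by rewrite ltr_pwDl// sumr_ge0.
pose k : R := #|` s|%:R^-1.
have card0 : #|` s|%:R != 0 :> R by rewrite pnatr_eq0 cardfs_eq0.
have k0 : 0 < k by rewrite invr_gt0 lt0r card0 ler0n.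
have k1 : \sum_(v <- s) k = 1.
  by rewrite big_const_seq count_predT iter_addr addr0 -mulr_natr mulVf.
pose w z := k + k / M * u (f z).
have w0 z : z \in s -> 0 <= w z.
  move=> zs; have : - M <= u (f z).
    rewrite lerNl; apply: le_trans (ler_norm _) _; rewrite normrN /M (big_fsetD1 z zs) /=.
    by rewrite addrCA lerDl addr_ge0// sumr_ge0.
  rewrite /w => h; have -> : k + k / M * u (f z) = k / M * (M + u (f z)).
    by rewrite mulrDr mulfVK// gt_eqF.
  by apply: mulr_ge0; [exact/ltW/divr_gt0|rewrite -lerBlDl sub0r].
have w1 : \sum_(z <- s) w z = 1 by rewrite big_split /= -mulr_sumr u0 mulr0 addr0.
have k0' z : z \in s -> 0 <= k by move=> _; exact: ltW.
have e : \sum_(z <- s) w z *: z = \sum_(z <- s) k *: z.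
  apply: inj; rewrite ?inE.
  - by exists w.
  - by exists (fun=> k).
  rewrite (af _ w0 w1) (af _ k0' k1).
  under eq_bigr do rewrite scalerDl -scalerA.
  by rewrite big_split /= -[X in _ + X]scaler_sumr uv0 scaler0 addr0.
have := affinely_independent_uniq ai (w := w) (w' := fun=> k).
rewrite w1 k1 => /(_ erefl e _ vs); rewrite /w => /eqP.
rewrite -subr_eq0 addrAC subrr add0r mulf_eq0 (gt_eqF (divr_gt0 k0 M0)) /=.
by move/eqP.
Qed.
End Dimension.

(** * Carriers of points and short segments *)

Section Supports.
Local Open Scope fset_scope.
Local Open Scope ring_scope.
Variables (R : realType) (N : nat).
Local Notation V := 'rV[R]_N.
Implicit Types (s t r F : {fset V}) (K L : {fset {fset V}}) (a b p x y z v u : V).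

Lemma open_simplex_hull r p : open_simplex r p -> hull r p.
Proof. by move=> [c bc _]; exact: barycentric_hull bc. Qed.

Lemma exists_support K x : is_complex K -> polyhedron K x ->
  exists2 r, r \in K & open_simplex r x.
Proof.
move=> cK [s sK /hullP[w bw]]; have [w0 ws w1 xE] := bw.
pose r := [fset v in s | 0 < w v].
have rs : r `<=` s by apply/fsubsetP => v; rewrite !inE => /andP[].
exists r; last first.
  exists w; last by move=> v; rewrite !inE => /andP[].
  apply: (barycentric_restrict bw) => v; rewrite !inE negb_and => /orP[/ws //|].
  by move=> h; apply/eqP; rewrite eq_le w0 leNgt h.
apply: (complex_face cK sK) => //.
have [v vs wv] := barycentric_exists_pos bw.
by apply/fset0Pn; exists v; rewrite !inE vs.
Qed.

Lemma open_simplex_sub K r s p : is_complex K -> r \in K -> s \in K ->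
  open_simplex r p -> hull s p -> r `<=` s.
Proof.
move=> cK rK sK [c bc cpos] /hullP[w bw]; apply/fsubsetP => v vr.
have e := complex_uniq cK rK sK bc bw v.
apply: contraTT (cpos _ vr) => vs; rewrite e.
by case: bw => _ -> //; rewrite ltxx.
Qed.

(** The weights of [p] are positive combinations of those of the vertices of [r]. A vertex of [r]
    with positive weight outside [t] would give [p] positive weight there, but [p] is supported on
    [t]. *)
Lemma open_simplex_hull_sub K r t s p : is_complex K -> t \in K -> s \in K ->
  open_simplex r p -> open_simplex t p -> (forall x, hull r x -> hull s x) ->
  forall x, hull r x -> hull t x.
Proof.
move=> cK tK sK [c bc cpos] [d bd dpos] rs.
have [c0 cr c1 pE] := bc.
have [g gP] := hull_vertices c (fun v vr => rs v (mem_hull vr)).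
have := convex_combination gP (fun v _ => c0 v) c1; rewrite -pE => bp.
have e := complex_uniq cK tK sK bd bp.
apply: hull_convex => v vr; apply: (@barycentric_hull _ _ _ (g v)).
apply: (barycentric_restrict (gP _ vr)) => u ut.
have [_ du _ _] := bd; have := e u; rewrite du// (big_fsetD1 v vr) /= => /esym/eqP.
have gnn z : z \in r -> 0 <= g z u by move=> zr; case: (gP _ zr).
rewrite paddr_eq0.
- by rewrite mulf_eq0 (gt_eqF (cpos _ vr)) => /andP[/eqP].
- by apply: mulr_ge0 => //; exact: gnn.
- rewrite big_seq; apply: sumr_ge0 => z; rewrite !inE => /andP[_ zr].
  by apply: mulr_ge0 => //; exact: gnn.
Qed.

(** A hull that misses [y] violates a bounding inequality strictly at [y], by an amount [a]. With
    [b] bounding the functional at [z], the violation persists as long as e * (a + b) < a. Finitely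
    many hulls allow a common bound. *)
Lemma hull_segment T y z :
  (forall t, t \in T -> affinely_independent t) ->
  exists2 d : R, 0 < d & forall e t, 0 < e < d -> t \in (T : seq {fset V}) ->
    hull t ((1 - e) *: y + e *: z) -> hull t y.
Proof.
elim: T => [|t T IH] ai; first by exists 1.
have [|d d0 dT] := IH; first by move=> u uT; apply: ai; rewrite inE uT orbT.
have [ty|ty] := pselect (hull t y).
  by exists d => // e u he; rewrite inE => /predU1P[->|] //; exact: dT.
have [_ [H [_ HP]]] := affine_coordinates (ai _ (mem_head _ _)).
have [c cH cy] : exists2 c, c \in H & eval_affine c y < 0.
  apply: contrapT => h; apply: ty; apply/HP => c cH.
  by rewrite leNgt; apply/negP => ?; apply: h; exists c.
pose a := - eval_affine c y; pose b := `|eval_affine c z|.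
have a0 : 0 < a by rewrite oppr_gt0.
have ab : 0 < a + b by apply: ltr_wpDr => //; exact: normr_ge0.
exists (Num.min d (a / (a + b))); first by rewrite lt_min d0 divr_gt0.
move=> e u; rewrite lt_min => /andP[e0 /andP[ed]].
rewrite ltr_pdivlMr// => eab; rewrite inE => /predU1P[->|uT]; last by apply: dT; rewrite ?e0.
move=> /HP/(_ _ cH); rewrite eval_affine_line.
have ez : e * eval_affine c z <= e * b by apply: ler_wpM2l; [exact: ltW|exact: ler_norm].
rewrite leNgt => /negP[]; have -> : eval_affine c y = - a by rewrite opprK.
apply: le_lt_trans (_ : (1 - e) * - a + e * b < 0); first by rewrite lerD2l.
have -> : (1 - e) * - a + e * b = e * (a + b) - a by ring.
by rewrite subr_lt0.
Qed.

(** With [M] bounding all quotients [|m v| / w v], the step 1 / (M + 2) works; the summand 2 instead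
    of 1 keeps it strictly below 1 when M = 0. *)
Lemma small_step r (w m : V -> R) : (forall v, v \in r -> 0 < w v) ->
  exists2 e : R, 0 < e < 1 & forall v, v \in r -> 0 <= (1 - e) * w v + e * m v.
Proof.
move=> wpos; pose M := \sum_(v <- r) `|m v| / w v.
have tpos v : v \in r -> 0 <= `|m v| / w v.
  by move=> vr; apply: divr_ge0 => //; exact/ltW/wpos.
have M0 : 0 <= M by rewrite /M big_seq; apply: sumr_ge0 => v /tpos.
have M2 : 0 < M + 2 by rewrite ltr_wpDl.
exists (M + 2)^-1.
  by rewrite invr_gt0 M2 invf_lt1//; move: M0; lra.
move=> v vr.
have : `|m v| / w v <= M.
  rewrite /M (big_fsetD1 v vr) /= lerDl big_seq; apply: sumr_ge0 => u.
  by rewrite !inE => /andP[_ /tpos].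
rewrite ler_pdivrMr ?wpos// => h.
have -> : (1 - (M + 2)^-1) * w v + (M + 2)^-1 * m v = ((M + 1) * w v + m v) / (M + 2).
  by field; exact: lt0r_neq0.
apply: divr_ge0; last exact: ltW.
have := ler_norm (- m v); rewrite normrN; have := wpos _ vr; move: h; lra.
Qed.
End Supports.

Section StandardSimplex.
Local Open Scope fset_scope.
Local Open Scope ring_scope.
Variable (R : realType).

Definition full_simplex N (s : {fset 'rV[R]_N}) : {fset {fset 'rV[R]_N}} :=
  fpowerset s `\ fset0.

Lemma in_full_simplex N (s t : {fset 'rV[R]_N}) :
  (t \in full_simplex s) = (t != fset0) && (t `<=` s).
Proof. by rewrite in_fsetD1 fpowersetE. Qed.

Lemma full_simplex_complex N (s : {fset 'rV[R]_N}) :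
  affinely_independent s -> is_complex (full_simplex s).
Proof.
move=> ai; apply: complex_of_uniq.
- by rewrite in_full_simplex eqxx.
- move=> t u; rewrite !in_full_simplex => /andP[_ ts] -> ut /=.
  exact: fsubset_trans ts.
- by move=> t; rewrite in_full_simplex => /andP[_ ts]; exact: affinely_independentS ai.
- move=> t u w w' x; rewrite !in_full_simplex => /andP[_ ts] /andP[_ us] bw bw'.
  exact: (barycentric_inj ai (barycentricS ts bw) (barycentricS us bw')).
Qed.

Variable n : nat.
Local Notation e i := (delta_mx 0 i : 'rV[R]_n).
Local Notation B := (basis_vertices R n).

Lemma delta_mx0_inj : injective (fun i : 'I_n => e i).
Proof.
move=> i j /rowP/(_ i); rewrite !mxE !eqxx /=.
by case: eqP => // _ /eqP; rewrite oner_eq0.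
Qed.

Lemma in_basis_vertices v : reflect (exists i, v = e i) (v \in B).
Proof. by apply: (iffP (imfsetP _ _ _ _)) => [[i _ ->]|[i ->]]; exists i. Qed.

Lemma sum_basis_vertices (W : nmodType) (f : 'rV[R]_n -> W) :
  \sum_(v <- B) f v = \sum_i f (e i).
Proof.
rewrite big_imfset /=; last by move=> i j _ _; exact: delta_mx0_inj.
by rewrite big_enum.
Qed.

Lemma basis_vertices_independent : affinely_independent B.
Proof.
move=> w _; rewrite sum_basis_vertices => w0 _ /in_basis_vertices[i ->].
move/rowP/(_ i): w0; rewrite summxE mxE (bigD1 i)//= !mxE !eqxx mulr1 big1 ?addr0//.
by move=> j ji; rewrite !mxE eqxx eq_sym (negbTE ji) mulr0.
Qed.

Lemma card_basis_vertices : #|` B| = n.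
Proof. by rewrite card_imfset /= ?size_enum_ord//; exact: delta_mx0_inj. Qed.

Lemma hull_basis_vertices (J : pred 'I_n) x :
  hull [fset e i | i in J] x <->
  [/\ forall i, 0 <= x 0 i, \sum_i x 0 i = 1 & forall i, ~~ J i -> x 0 i = 0].
Proof.
have E (W : nmodType) (f : 'rV[R]_n -> W) :
    \sum_(v <- [fset e i | i in J]) f v = \sum_(i | J i) f (e i).
  rewrite big_imfset /=; last by move=> i j _ _; exact: delta_mx0_inj.
  by rewrite big_enum.
split.
  move=> [w [w0]]; rewrite !E => w1 ->.
  have xi i : (\sum_(j | J j) w (e j) *: e j) 0 i = if J i then w (e i) else 0.
    rewrite summxE; case: ifPn => Ji.
      rewrite (bigD1 i)//= !mxE !eqxx mulr1 big1 ?addr0// => j /andP[_ ji].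
      by rewrite !mxE eqxx eq_sym (negbTE ji) mulr0.
    rewrite big1// => j Jj; rewrite !mxE eqxx; case: eqP => [ij|_]; last by rewrite mulr0.
    by rewrite ij Jj in Ji.
  split.
  - by move=> i; rewrite xi; case: ifP => // Ji; apply: w0; apply: in_imfset.
  - by under eq_bigr do rewrite xi; rewrite -big_mkcond.
  - by move=> i /negbTE; rewrite xi => ->.
move=> [x0 x1 xJ].
pose w (v : 'rV[R]_n) := \sum_i v 0 i * x 0 i.
have we i : w (e i) = x 0 i.
  rewrite /w (bigD1 i)//= mxE !eqxx mul1r big1 ?addr0// => j ji.
  by rewrite mxE eqxx (negbTE ji) mul0r.
exists w; rewrite !E; split.
- by move=> _ /imfsetP[i _ ->]; rewrite we.
- under eq_bigr do rewrite we; rewrite -[RHS]x1 [RHS](bigID J) /=.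
  by rewrite [X in _ + X]big1 ?addr0// => i /xJ.
- apply/rowP => i; rewrite summxE; under eq_bigr do rewrite we.
  have [Ji|Ji] := boolP (J i); last first.
    rewrite xJ// big1// => j Jj; rewrite !mxE eqxx; case: eqP => [ij|_]; last by rewrite mulr0.
    by rewrite ij Jj in Ji.
  rewrite (bigD1 i)//= !mxE !eqxx mulr1 big1 ?addr0// => j /andP[_ ji].
  by rewrite !mxE eqxx eq_sym (negbTE ji) mulr0.
Qed.

Lemma std_simplexE : std_simplex R n = full_simplex B.
Proof. by []. Qed.

Lemma std_simplex_complex : is_complex (std_simplex R n).
Proof. exact: full_simplex_complex basis_vertices_independent. Qed.

Lemma std_simplex_card t : t \in std_simplex R n -> (#|` t| <= n)%N.
Proof.
by rewrite in_full_simplex => /andP[_ /fsubset_leq_card]; rewrite card_basis_vertices.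
Qed.
End StandardSimplex.

Section PLDimension.
Local Open Scope fset_scope.
Local Open Scope ring_scope.
Variables (R : realType) (N P : nat).
Variables (K : {fset {fset 'rV[R]_N}}) (L : {fset {fset 'rV[R]_P}}).

(** Two coverings: simplices of [K'] cover [s], so one of them has at least as many vertices, and
    its image, an affinely embedded simplex, is covered by [L]. *)
Lemma pl_homeomorphic_card d : is_complex K -> pl_homeomorphic K L ->
  (forall t, t \in L -> (#|` t| <= d)%N) -> forall s, s \in K -> (#|` s| <= d)%N.
Proof.
move=> cK [f [g [[fKL [K' [cK' pK' _] af]] _ gf _]]] Ld s sK.
have ai : affinely_independent s by case: cK => _ _ + _; apply.
have [x sx|s' s'K ss'] := hull_cover_card (T := K') ai (complex_neq0 cK sK).
  have : polyhedron K' x by rewrite pK'; exists s.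
  by move=> [t tK tx]; exists t.
apply: leq_trans ss' _.
have ai' : affinely_independent s' by case: cK' => _ _ + _; apply.
have inK x : hull s' x -> polyhedron K x by move=> sx; rewrite -pK'; exists s'.
have inj : {in hull s' &, injective f}.
  move=> x y /set_mem /inK sx /set_mem /inK sy e.
  by rewrite -(gf _ sx) e gf.
have vinj := affine_map_vertex_inj inj.
have aif := affinely_independent_image (af _ s'K) ai' inj.
rewrite -(card_image_fset vinj).
have [||t tL] := hull_cover_card (T := L) aif.
- have /fset0Pn[v vs] := complex_neq0 cK' s'K.
  by apply/fset0Pn; exists (f v); apply: in_imfset.
- move=> y /(hull_image_inv (af _ s'K) vinj)[x sx <-].
  have [t tL tx] : polyhedron L (f x) by apply: fKL; exists x => //; exact: inK.
  by exists t.
by move=> h; apply: leq_trans h (Ld _ tL).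
Qed.
End PLDimension.

Section FreeFace.
Local Open Scope fset_scope.
Local Open Scope ring_scope.
Variable (R : realType).

(** Two simplices over [r] on the same side of a hyperplane overlap. By dependence [z2] is an affine
    combination of [z1] and [r], with weights [l]; comparing coordinate [i] shows l z1 > 0, so a
    short step from [q] towards [z2] enters the hull of [z1] and [r]. *)
Lemma half_overlap P (r : {fset 'rV[R]_P}) z1 z2 q (i : 'I_P) :
  z1 \notin r -> z2 \notin z1 |` r ->
  affinely_independent (z1 |` r) -> ~ affinely_independent (z2 |` (z1 |` r)) ->
  (forall v, v \in r -> v 0 i = 0) -> 0 < z1 0 i -> 0 < z2 0 i ->
  open_simplex r q ->
  exists2 e, 0 < e < 1 & hull (z1 |` r) ((1 - e) *: q + e *: z2).
Proof.
move=> z1r z2r ai nai ri z1i z2i [c [c0 cr c1 qE] cpos].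
have [m [m0 mv0 [v0 v0r mv]]] : exists m, [/\ \sum_(v <- z2 |` (z1 |` r)) m v = 0,
    \sum_(v <- z2 |` (z1 |` r)) m v *: v = 0 &
    exists2 v, v \in z2 |` (z1 |` r) & m v != 0].
  apply: contrapT => h; apply: nai => m m0 mv0 v vs; apply/eqP; apply: contrapT => /negP mv.
  by apply: h; exists m; split => //; exists v.
move: m0 mv0; rewrite !(big_fsetU1 _ _ z2r) /= => m0 mv0.
have mz2 : m z2 != 0.
  apply/eqP => mz; move: m0 mv0; rewrite mz scale0r !add0r => m0 mv0.
  have := ai _ m0 mv0 v0; move: v0r; rewrite in_fset1U => /predU1P[e|v0r].
    by move: mv; rewrite e mz eqxx.
  by move=> /(_ v0r) e; move: mv; rewrite e eqxx.
pose l v := - m v / m z2.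
have l1 : \sum_(v <- z1 |` r) l v = 1.
  rewrite -mulr_suml sumrN; move: m0 => /eqP; rewrite addr_eq0 => /eqP <-.
  by rewrite divff.
have lz : \sum_(v <- z1 |` r) l v *: v = z2.
  have -> : \sum_(v <- z1 |` r) l v *: v = - (m z2)^-1 *: \sum_(v <- z1 |` r) m v *: v.
    rewrite scaler_sumr; apply: eq_bigr => v _; rewrite scalerA /l; congr (_ *: _).
    by rewrite !mulNr mulrC.
  move: mv0 => /eqP; rewrite addr_eq0 => /eqP/esym/eqP; rewrite eqr_oppLR => /eqP ->.
  by rewrite scalerN scaleNr opprK scalerA mulVf// scale1r.
have lz1 : 0 < l z1.
  have := congr1 (fun y : 'rV[R]_P => y 0 i) lz; rewrite big_fsetU1//= mxE mxE summxE.
  rewrite big1_seq ?addr0; last by move=> v /= vr; rewrite mxE ri// mulr0.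
  by move=> e; move: z2i; rewrite -e pmulr_lgt0.
have [e /andP[e0 e1] he] := small_step l cpos.
have cz1 : c z1 = 0 by apply: cr.
exists e; first by rewrite e0.
exists (fun v => (1 - e) * c v + e * l v); split.
- move=> v; rewrite in_fset1U => /predU1P[->|/he //].
  by rewrite cz1 mulr0 add0r mulr_ge0 ?ltW.
- rewrite big_split /= -!mulr_sumr l1 big_fsetU1//= cz1 add0r c1; ring.
- under eq_bigr do rewrite scalerDl -(scalerA (1 - e)) -(scalerA e).
  by rewrite big_split /= -!scaler_sumr lz big_fsetU1//= cz1 scale0r add0r -qE.
Qed.

Variables (N m : nat) (L : {fset {fset 'rV[R]_N}}).
Let n := m.+2.
Hypothesis (cL : is_complex L) (L_ball : pl_homeomorphic L (std_simplex R n)).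

(* Take a generic point q in a facet of the standard simplex and its preimage p,
   which lies inside an (n-2)-simplex r of the subdivision.  The images of the
   (n-1)-simplices around r all lie on one side of the facet, so injectivity
   leaves room for only one, whence only one in L around the face carrying p. *)
Lemma pl_ball_free_face :
  exists t t', [/\ t \in L, t' \in L, #|` t| = m.+1, #|` t'| = m.+2 &
    t `<=` t' /\ forall u, u \in L -> t `<=` u -> u = t \/ u = t'].
Proof.
have [f [g [[fLS [L1 sL1 af]] [gSL _] gf fg]]] := L_ball.
have [cL1 pL1 hL1] := sL1.
have Ln u : u \in L -> (#|` u| <= n)%N.
  exact: (pl_homeomorphic_card cL L_ball (@std_simplex_card R n)).
have inL s x : s \in L1 -> hull s x -> polyhedron L x by move=> sL sx; rewrite -pL1; exists s.
have f_inj x y : polyhedron L x -> polyhedron L y -> f x = f y -> x = y.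
  by move=> Lx Ly e; rewrite -(gf _ Lx) e gf.
have inj s : s \in L1 -> {in hull s &, injective f}.
  by move=> sL x y /set_mem/(inL _ _ sL) Lx /set_mem/(inL _ _ sL) Ly; exact: f_inj.
have vinj s (sL : s \in L1) := affine_map_vertex_inj (inj _ sL).
have aiL1 s : s \in L1 -> affinely_independent s by case: cL1 => _ _ + _; apply.
pose im (s : {fset 'rV[R]_N}) := [fset f v | v in s].
have aif s : s \in L1 -> affinely_independent (im s).
  by move=> sL; apply: affinely_independent_image (af _ sL) (aiL1 _ sL) (inj _ sL).
have cardf s : s \in L1 -> #|` im s| = #|` s| by move=> sL; apply: card_image_fset (vinj _ sL).
pose B (J : pred 'I_n) : {fset 'rV[R]_n} := [fset delta_mx 0 i | i in J].
have BT : B predT = basis_vertices R n by [].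
have inS y : polyhedron (std_simplex R n) y <->
    (forall i, 0 <= y 0 i) /\ \sum_i y 0 i = 1.
  split=> [[s]|[y0 y1]].
    rewrite std_simplexE in_full_simplex => /andP[_ /hullS h] /h; rewrite -BT.
    by move=> /hull_basis_vertices[].
  have h : hull (basis_vertices R n) y by rewrite -BT; apply/hull_basis_vertices; split.
  exists (basis_vertices R n) => //; rewrite std_simplexE in_full_simplex fsubset_refl andbT.
  by rewrite -cardfs_gt0 card_basis_vertices.
have fS x : polyhedron L x -> polyhedron (std_simplex R n) (f x).
  by move=> Lx; apply: fLS; exists x.
have f0 x i : polyhedron L x -> 0 <= f x 0 i by move=> /fS/inS[h _]; exact: h.
have vL s v : s \in L1 -> v \in s -> polyhedron L v.
  by move=> sL vs; apply: (inL _ _ sL); exact: mem_hull.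
have im_hull s (J : pred 'I_n) : s \in L1 -> (forall v, v \in s -> forall i, ~~ J i -> f v 0 i = 0) ->
    (#|` s| <= #|` B J|)%N.
  move=> sL sJ; rewrite -cardf//; apply: hull_sub_card; first exact: aif.
  apply: hull_convex => _ /imfsetP[v /= vs ->]; apply/hull_basis_vertices.
  have /inS[h0 h1] := fS _ (vL _ _ sL vs).
  by split => // i; exact: sJ.
have L1n s : s \in L1 -> (#|` s| <= n)%N.
  by move=> sL; rewrite -[X in (_ <= X)%N](card_basis_vertices R n) -BT; exact: im_hull.
(* The chosen facet is the one where coordinate 0 vanishes; positivity of this coordinate marks its
   inner side. *)
pose J0 : pred 'I_n := predC1 ord0.
have cardB0 : #|` B J0| = m.+1.
  rewrite card_imfset /=; last exact: delta_mx0_inj.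
  by rewrite -cardE cardC1 card_ord.
have subB0 : B J0 `<=` B predT.
  by apply/fsubsetP => _ /imfsetP[i _ ->]; exact: in_imfset.
have aiB0 : affinely_independent (B J0).
  by apply: affinely_independentS subB0 _; rewrite BT; exact: basis_vertices_independent.
have [|t|q oq hq] := generic_point
    (T := [seq im s | s <- [seq s <- L1 | (#|` s| < m.+1)%N]]) aiB0.
- by rewrite -cardfs_gt0 cardB0.
- move=> /mapP[s]; rewrite mem_filter => /andP[sm sL] ->.
  by rewrite cardf// cardB0.
have /hull_basis_vertices[q0 q1 qJ] := open_simplex_hull oq.
have q00 : q 0 ord0 = 0 by apply: qJ.
have Sq : polyhedron (std_simplex R n) q by apply/inS.
pose p := g q.
have Lp : polyhedron L p by apply: gSL; exists q.
have fp : f p = q by exact: fg.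
have [r rL1 orp] : exists2 r, r \in L1 & open_simplex r p.
  by apply: exists_support => //; rewrite pL1.
have r_sub s : s \in L1 -> hull s p -> r `<=` s.
  by move=> sL; apply: open_simplex_sub cL1 rL1 sL orp.
have rp := open_simplex_hull orp.
have rJ v : v \in r -> f v 0 ord0 = 0.
  move=> vr; have [w [w0 wr w1 pE] wpos] := orp.
  have w0' u : u \in r -> 0 <= w u by [].
  have := af _ rL1 w w0' w1; rewrite -pE fp => /(congr1 (fun y : 'rV[R]_n => y 0 ord0)).
  rewrite q00 (big_fsetD1 v vr) /= mxE mxE summxE => /esym/eqP.
  rewrite paddr_eq0.
  - by rewrite mulf_eq0 (gt_eqF (wpos _ vr)) => /andP[/eqP].
  - by apply: mulr_ge0 => //; apply: f0; exact: vL vr.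
  - rewrite big_seq; apply: sumr_ge0 => u; rewrite !inE => /andP[_ ur].
    by rewrite mxE; apply: mulr_ge0 => //; apply: f0; exact: vL ur.
(* At most m + 1, since [r] maps into the facet; at least m + 1, since [q] avoids the images of all
   simplices with fewer vertices. *)
have rm : #|` r| = m.+1.
  apply/eqP; rewrite eqn_leq -{1}cardB0 im_hull//=; last first.
    by move=> v /rJ e i; rewrite /J0 /= negbK => /eqP ->.
  rewrite leqNgt; apply/negP => rm; apply: (hq (im r)).
    by apply: map_f; rewrite mem_filter rm.
  by rewrite -fp; apply: hull_image rp; exact: af.
have face_top s : s \in L1 -> r `<=` s -> s <> r -> #|` s| = n /\ exists2 z, z \notin r & s = z |` r.
  move=> sL rs sr.
  have rs' : r `<` s by rewrite fproperEneq rs andbT eq_sym; apply/eqP.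
  have sn : #|` s| = n.
    by apply/eqP; rewrite eqn_leq L1n//=; have := fproper_ltn_card rs'; rewrite rm.
  split=> //; have /fsubsetPn[z zs zr] : ~~ (s `<=` r) by case/andP: rs'.
  exists z => //; apply/eqP; rewrite eq_sym eqEfcard; apply/andP; split.
    by apply/fsubsetP => v; rewrite in_fset1U => /predU1P[->//|]; exact: (fsubsetP rs).
  by rewrite sn cardfsU1 zr rm.
have top_pos z : z |` r \in L1 -> z \notin r -> 0 < f z 0 ord0.
  move=> zrL zr; rewrite lt0r f0 ?andbT; last by apply: vL zrL _; exact: fset1U1.
  apply/eqP => fz0; have : (#|` z |` r| <= #|` B J0|)%N.
    apply: im_hull zrL _ => v; rewrite in_fset1U => vzr i; rewrite /J0 /= negbK => /eqP ->.
    by case/predU1P: vzr => [->//|/rJ].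
  by rewrite cardB0 cardfsU1 zr rm ltnn.
have imU z s : im (z |` s) = f z |` im s.
  apply/fsetP => y; rewrite in_fset1U; apply/imfsetP/predU1P.
    move=> [v /=]; rewrite in_fset1U => /predU1P[->|vs] ->; [by left|right].
    exact: in_imfset.
  move=> [->|/imfsetP[v /= vs ->]]; first by exists z; rewrite //= fset1U1.
  by exists v; rewrite //= in_fset1U vs orbT.
(* Otherwise [half_overlap] yields a point [x2] of [s1] and a point [x1] of [s2] with the same
   image, although [x1] has positive weight at [z2], which is not in [s1]. *)
have unique s1 s2 : s1 \in L1 -> s2 \in L1 -> r `<=` s1 -> r `<=` s2 ->
    s1 <> r -> s2 <> r -> s1 = s2.
  move=> s1L s2L rs1 rs2 s1r s2r.
  have [s1n [z1 z1r s1E]] := face_top _ s1L rs1 s1r.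
  have [s2n [z2 z2r s2E]] := face_top _ s2L rs2 s2r.
  have [z2s1|z2s1] := boolP (z2 \in s1).
    by move: z2s1; rewrite s1E in_fset1U (negbTE z2r) orbF => /eqP <-.
  have Lz2 : polyhedron L z2 by apply: (vL _ _ s2L); rewrite s2E fset1U1.
  have Lz1 : polyhedron L z1 by apply: (vL _ _ s1L); rewrite s1E fset1U1.
  have oq' : open_simplex (im r) q.
    have [w bw wpos] := orp; have [w0 wr w1 pE] := bw.
    have : barycentric (im r) (fun y => if y \in im r then w (g y) else 0) q.
      have gv v : v \in r -> g (f v) = v by move=> vr; apply: gf; exact: vL vr.
      split.
      - by move=> y; case: ifP.
      - by move=> y /negbTE ->.
      - rewrite (sum_image (vinj _ rL1)) -[RHS]w1; apply: eq_big_seq => v vr.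
        by rewrite in_imfset// gv.
      - have w0' u : u \in r -> 0 <= w u by [].
        have := af _ rL1 w w0' w1; rewrite -pE fp => ->.
        rewrite (sum_image (vinj _ rL1)); apply: eq_big_seq => v vr.
        by rewrite in_imfset// gv.
    move=> b; exists (fun y => if y \in im r then w (g y) else 0) => // y yr.
    rewrite yr; move/imfsetP: yr => [v /= vr ->]; rewrite gf; first exact: wpos.
    exact: vL vr.
  have [|||||||e e01 he] := @half_overlap _ (im r) (f z1) (f z2) q ord0 _ _ _ _ _ _ _ oq'.
  - apply/negP => /imfsetP[v /= vr /(f_inj _ _ Lz1 (vL _ _ rL1 vr)) e].
    by rewrite e vr in z1r.
  - rewrite -imU -s1E; apply/negP => /imfsetP[v /= vs /(f_inj _ _ Lz2 (vL _ _ s1L vs)) e].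
    by rewrite e vs in z2s1.
  - by rewrite -imU -s1E; exact: aif.
  - rewrite -imU -s1E => ai.
    have : (#|` f z2 |` im s1| <= #|` B predT|)%N.
      apply: hull_sub_card => //; apply: hull_convex => v; rewrite in_fset1U => h.
      have /inS[h0 h1] : polyhedron (std_simplex R n) v.
        case/predU1P: h => [->|/imfsetP[u /= us ->]]; first exact: fS.
        by apply: fS; exact: vL us.
      by apply/hull_basis_vertices.
    rewrite BT card_basis_vertices cardfsU1 cardf// s1n.
    suff -> : f z2 \notin im s1 by rewrite ltnn.
    apply/negP => /imfsetP[v /= vs /(f_inj _ _ Lz2 (vL _ _ s1L vs)) e].
    by rewrite e vs in z2s1.
  - by move=> _ /imfsetP[v /= vr ->]; exact: rJ.
  - by apply: top_pos => //; rewrite -s1E.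
  - by apply: top_pos => //; rewrite -s2E.
  have [x2 x2s fx2] : exists2 x, hull s1 x & f x = (1 - e) *: q + e *: f z2.
    by move: he; rewrite -imU -s1E; apply: hull_image_inv; [exact: af|exact: vinj].
  have /andP[e0 e1] := e01.
  have [w bw wpos] := orp; have [w0 wr w1 pE] := bw.
  pose x1 := (1 - e) *: p + e *: z2.
  pose w2 v := (1 - e) * w v + e * (v == z2)%:R.
  have bx1 : barycentric s2 w2 x1.
    rewrite s2E; split.
    - move=> v; apply: addr_ge0; apply: mulr_ge0; rewrite ?ler0n// ?subr_ge0; exact: ltW.
    - move=> v; rewrite in_fset1U negb_or => /andP[/negbTE vz vr].
      by rewrite /w2 wr// vz !mulr0 addr0.
    - rewrite big_fsetU1//= {1}/w2 eqxx wr// mulr0 add0r mulr1.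
      under eq_big_seq => v vr.
        rewrite /w2 (_ : (v == z2) = false) ?mulr0 ?addr0; last first.
          by apply/eqP => vz; rewrite vz (negbTE z2r) in vr.
        over.
      by rewrite -mulr_sumr w1 mulr1 addrC subrK.
    - rewrite big_fsetU1//= {1}/w2 eqxx wr// mulr0 add0r mulr1.
      under eq_big_seq => v vr.
        rewrite /w2 (_ : (v == z2) = false) ?mulr0 ?addr0 -?scalerA; last first.
          by apply/eqP => vz; rewrite vz (negbTE z2r) in vr.
        over.
      by rewrite -scaler_sumr -pE addrC.
  have fx1 : f x1 = (1 - e) *: q + e *: f z2.
    have [w20 w2s w21 ->] := bx1.
    have w20' v : v \in s2 -> 0 <= w2 v by [].
    rewrite (af _ s2L _ w20' w21) s2E.
    rewrite big_fsetU1//= {1}/w2 eqxx wr// mulr0 add0r mulr1.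
    under eq_big_seq => v vr.
      rewrite /w2 (_ : (v == z2) = false) ?mulr0 ?addr0 -?scalerA; last first.
        by apply/eqP => vz; rewrite vz (negbTE z2r) in vr.
      over.
    have w0' u : u \in r -> 0 <= w u by [].
    by rewrite -scaler_sumr addrC -(af _ rL1 w w0' w1) -pE fp.
  have x12 : x1 = x2.
    apply: f_inj; [exact: inL (barycentric_hull bx1)|exact: inL x2s|].
    by rewrite fx1 fx2.
  have /hullP[w' bw'] := x2s; rewrite -x12 in bw'.
  have := complex_uniq cL1 s2L s1L bx1 bw' z2.
  rewrite /w2 eqxx wr// mulr0 add0r mulr1 => ew.
  have [_ ws1 _ _] := bw'; move: e0; rewrite ew ws1 ?ltxx//.
(* A short step from [q] towards the vertex opposite the facet. The simplex that carries the
   preimage contains [p], hence [r], and differs from [r] because coordinate 0 is now positive. *)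
have [s [ssL rs sr]] : exists s, [/\ s \in L1, r `<=` s & s <> r].
  pose z : 'rV[R]_n := delta_mx 0 ord0.
  have [t|d d0 hd] := hull_segment q z (T := [seq im s | s <- L1]).
    by move=> /mapP[s sL ->]; exact: aif.
  pose e := Num.min (d / 2) 1.
  have e0 : 0 < e by rewrite lt_min ltr01 divr_gt0.
  have e1 : e <= 1 by rewrite ge_min lexx orbT.
  have ed : e < d by rewrite gt_min ltr_pdivrMr// mulr_natr mulr2n ltrDl d0.
  pose y := (1 - e) *: q + e *: z.
  have Sy : polyhedron (std_simplex R n) y.
    apply/inS; split.
      move=> i; rewrite !mxE; apply: addr_ge0; apply: mulr_ge0; rewrite ?subr_ge0//.
      exact: ltW.
    under eq_bigr do rewrite !mxE; rewrite big_split /= -!mulr_sumr q1 (bigD1 ord0)//=.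
    rewrite ?eqxx big1 ?addr0 ?mulr1 ?subrK// => i /negbTE ->.
    by [].
  have [s sL sy] : polyhedron L1 (g y) by rewrite pL1; apply: gSL; exists y.
  have fy : hull (im s) y.
    by rewrite -(fg _ Sy); apply: hull_image sy; exact: af.
  have : hull (im s) q by apply: hd fy; rewrite ?e0 ?ed//; exact: map_f.
  move=> /(hull_image_inv (af _ sL) (vinj _ sL))[x sx fxq].
  have xp : x = p by apply: f_inj => //; [exact: inL sx|rewrite fp].
  exists s; split => //; first by apply: r_sub => //; rewrite -xp.
  move=> sr; move: fy; rewrite sr => -[w [w0 w1 yE]].
  have : y 0 ord0 = 0.
    rewrite yE summxE; apply: big1_seq => _ /= /imfsetP[v /= vr ->].
    by rewrite mxE rJ// mulr0.
  by rewrite !mxE q00 mulr0 add0r eqxx mulr1 => e00; rewrite e00 ltxx in e0.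
have [sn [z zr sE]] := face_top _ ssL rs sr.
have [t' t'L st'] := hL1 _ ssL.
have t'n : #|` t'| = n.
  apply/eqP; rewrite eqn_leq Ln//= -sn; apply: hull_sub_card st'.
  exact: aiL1.
have [t tL otp] := exists_support cL Lp.
have tt' : t `<=` t'.
  apply: open_simplex_sub cL tL t'L otp _; apply: st'.
  exact: hullS rs rp.
have rt x : hull r x -> hull t x.
  apply: open_simplex_hull_sub cL tL t'L orp otp _ x => x rx.
  by apply: st'; exact: hullS rs rx.
have rtc : (m.+1 <= #|` t|)%N by rewrite -rm; apply: hull_sub_card rt; exact: aiL1.
(* Every segment from [p] into a simplex of [L] starts inside a simplex of [L1] around [r]. By
   [unique] this can only be [r] or [s], which carries the count from [L1] back to [L]. *)
have follow u y : u \in L -> hull u p -> hull u y ->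
    exists2 e, 0 < e < 1 & exists s', [/\ s' \in L1, r `<=` s' & hull s' ((1 - e) *: p + e *: y)].
  move=> uL up uy.
  have [|d d0 hd] := hull_segment p y (T := enum_fset L1); first exact: aiL1.
  pose e := Num.min (d / 2) (1 / 2).
  have e0 : 0 < e by rewrite lt_min !divr_gt0.
  have e1 : e < 1 by rewrite gt_min; apply/orP; right; lra.
  have ed : e < d by rewrite gt_min ltr_pdivrMr// mulr_natr mulr2n ltrDl d0.
  exists e; first by rewrite e0.
  have : hull u ((1 - e) *: p + e *: y).
    move: up uy => /hullP[w [w0 ws w1 pE]] /hullP[w' [w0' ws' w1' yE]].
    apply: (@barycentric_hull _ _ _ (fun v => (1 - e) * w v + e * w' v)); split.
    - by move=> v; apply: addr_ge0; apply: mulr_ge0; rewrite // ?subr_ge0; exact: ltW.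
    - by move=> v vu; rewrite ws// ws'// !mulr0 addr0.
    - by rewrite big_split /= -!mulr_sumr w1 w1' !mulr1 subrK.
    - under [RHS]eq_bigr do rewrite scalerDl -!scalerA.
      by rewrite big_split /= -!scaler_sumr -pE -yE.
  move=> uy'; have [s' s'L s'y] : polyhedron L1 ((1 - e) *: p + e *: y).
    by rewrite pL1; exists u.
  exists s'; split => //; apply: r_sub => //.
  by apply: hd s'y => //; rewrite e0 ed.
have follow_s u y : u \in L -> hull u p -> hull u y ->
    exists2 e, 0 < e < 1 & hull s ((1 - e) *: p + e *: y) /\
      (hull r ((1 - e) *: p + e *: y) \/ hull t' ((1 - e) *: p + e *: y)).
  move=> uL up uy; have [e e01 [s' [s'L rs' s'y]]] := follow _ _ uL up uy.
  exists e => //; have [s'r|s'r] := pselect (s' = r).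
    by rewrite s'r in s'y; split; [exact: hullS rs s'y|left].
  have ss' := unique _ _ s'L ssL rs' rs s'r sr.
  by rewrite ss' in s'y; split => //; right; exact: st'.
have [d bd dpos] := otp.
(* If t = t', then [p] is interior to a simplex containing [z], so the segment from [z] to [p] can
   be prolonged beyond [p]. Its points near [p] would lie in [s] with negative weight at [z]. *)
have tneq : t <> t'.
  move=> tt; have /hullP[u bz] : hull t z.
    by rewrite tt; apply: st'; apply: mem_hull; rewrite sE fset1U1.
  have [e /andP[e0 e1] he] := small_step (fun v => 2 * d v - u v) dpos.
  have ty : hull t (p + e *: (p - z)).
    have [d0 dt d1 dE] := bd; have [u0 ut u1 uE] := bz.
    exists (fun v => (1 - e) * d v + e * (2 * d v - u v)); split => //.
      by rewrite big_split /= -!mulr_sumr sumrB -mulr_sumr d1 u1; ring.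
    have D v : (1 - e) * d v + e * (2 * d v - u v) = d v + e * (d v - u v) by ring.
    under eq_bigr do rewrite D scalerDl -scalerA scalerBl.
    by rewrite big_split /= -scaler_sumr sumrB -dE -uE.
  have [k /andP[k0 k1] [sx _]] := follow_s _ _ tL (open_simplex_hull otp) ty.
  have [w bw wpos] := orp; have [w0 wr w1 pE] := barycentricS rs bw.
  have /hullP[w' bw'] := sx; have [w0' _ w1' xE] := bw'.
  pose w2 v := w v + k * e * (w v - (v == z)%:R).
  have zs : z \in s by rewrite sE fset1U1.
  have D (W : lmodType R) (h : 'rV[R]_N -> W) : \sum_(v <- s) (v == z)%:R *: h v = h z.
    rewrite (big_fsetD1 z zs) /= eqxx scale1r big1_seq ?addr0// => v /=.
    by rewrite !inE => /andP[/negbTE -> _]; rewrite scale0r.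
  have e1' : \sum_(v <- s) w2 v = 1.
    rewrite big_split /= -mulr_sumr sumrB w1.
    by have := D R^o (fun=> 1); rewrite /GRing.scale /=; under eq_bigr do rewrite mulr1; move=> ->; ring.
  have e2' : \sum_(v <- s) w2 v *: v = (1 - k) *: p + k *: (p + e *: (p - z)).
    under eq_bigr do rewrite scalerDl -scalerA scalerBl.
    rewrite big_split /= -scaler_sumr sumrB -pE (D _ id).
    by rewrite (scalerDr k p) (scalerA k e) scalerBl scale1r addrA subrK.
  have := affinely_independent_uniq (aiL1 _ ssL) (w := w2) (w' := w').
  rewrite e1' w1' e2' -xE => /(_ erefl erefl _ zs); rewrite /w2 eqxx.
  have -> : w z = 0 by case: bw => _ -> //.
  rewrite add0r sub0r mulrN1 => ew; have := w0' z.
  by rewrite -ew oppr_ge0 leNgt mulr_gt0.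
have tm : #|` t| = m.+1.
  apply/eqP; rewrite eqn_leq rtc andbT -ltnS -[m.+2]t'n; apply: fproper_ltn_card.
  by rewrite fproperEneq tt' andbT; apply/eqP.
exists t, t'; split => //; split => // u uL tu.
have [->|/eqP ut] := eqVneq u t; [by left|right].
(* A point near [p] on the way to [x] has positive weight at [x] and on all of [t]. It cannot lie in
   the hull of [t], so it lies in that of [t']; hence [t'] consists of [t] and [x], and counting
   vertices gives u = t'. *)
have /fsubsetPn[x xu xt] : ~~ (u `<=` t).
  by apply/negP => ut'; apply: ut; apply/eqP; rewrite eqEfsubset ut'.
have up : hull u p := hullS tu (open_simplex_hull otp).
have [e /andP[e0 e1] [_ hx]] := follow_s _ _ uL up (mem_hull xu).
have [d0 dt d1 dE] := barycentricS tu bd.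
pose w v := (1 - e) * d v + e * (v == x)%:R.
have bw : barycentric u w ((1 - e) *: p + e *: x).
  have D (W : lmodType R) (h : 'rV[R]_N -> W) : \sum_(v <- u) (v == x)%:R *: h v = h x.
    rewrite (big_fsetD1 x xu) /= eqxx scale1r big1_seq ?addr0// => v /=.
    by rewrite !inE => /andP[/negbTE -> _]; rewrite scale0r.
  split.
  - by move=> v; apply: addr_ge0; apply: mulr_ge0; rewrite ?ler0n ?subr_ge0//; exact: ltW.
  - move=> v vu; rewrite /w dt// (_ : (v == x) = false) ?mulr0 ?addr0//.
    by apply/eqP => vx; rewrite vx xu in vu.
  - rewrite big_split /= -!mulr_sumr d1.
    by have := D R^o (fun=> 1); rewrite /GRing.scale /=; under eq_bigr do rewrite mulr1; move=> ->; ring.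
  - under eq_bigr do rewrite scalerDl -!scalerA.
    by rewrite big_split /= -!scaler_sumr -dE (D _ id).
have wx : 0 < w x by rewrite /w eqxx mulr1 ltr_wpDl// mulr_ge0// subr_ge0 ltW.
have wt v : v \in t -> 0 < w v.
  by move=> vt; rewrite /w ltr_pwDl ?mulr_gt0 ?subr_gt0 ?dpos// mulr_ge0 ?ler0n// ltW.
case: hx => [/rt/hullP[w' bw']|/hullP[w' bw']].
  have := complex_uniq cL uL tL bw bw' x; case: bw' => _ /(_ _ xt) -> _ _ e'.
  by rewrite e' ltxx in wx.
have w_t' v : 0 < w v -> v \in t'.
  apply: contraTT => vt'; rewrite (complex_uniq cL uL t'L bw bw' v).
  by case: bw' => _ /(_ _ vt') -> _ _; rewrite ltxx.
have xt' : x |` t = t'.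
  apply/eqP; rewrite eqEfcard cardfsU1 xt tm t'n leqnn andbT.
  by apply/fsubsetP => v; rewrite in_fset1U => /predU1P[->|/wt]; exact: w_t'.
apply/eqP; rewrite eq_sym eqEfcard t'n Ln// andbT -xt'.
by apply/fsubsetP => v; rewrite in_fset1U => /predU1P[->//|]; exact: (fsubsetP tu).
Qed.
End FreeFace.

(** * Interior and boundary points *)

Section ManifoldInterior.
Variable R : realType.

Lemma open_forall (T : topologicalType) (I : finType) (A : I -> set T) :
  (forall i, open (A i)) -> open [set x | forall i, A i x].
Proof.
move=> oA; rewrite (_ : [set x | _] = ~` \bigcup_(i in setT) ~` A i).
  apply: closed_openC; apply: closed_bigcup; first exact: finite_finset.
  by move=> i _; exact: open_closedC.
apply/seteqP; split=> x /=; first by move=> h [i _]; apply; exact: h.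
by move=> h i; apply: contrapT => Aix; apply: h; exists i.
Qed.

Lemma continuous_sum (T : topologicalType) (I : finType) (F : I -> T -> R) :
  (forall i, continuous (F i)) -> continuous (fun x => \sum_i F i x).
Proof.
move=> cF; apply: continuous_big; first exact: add_continuous.
by move=> i _; exact: cF.
Qed.

Lemma row_continuous (T : topologicalType) n (h : 'I_n -> T -> R) :
  (forall j, continuous (h j)) -> continuous (fun x => \row_j h j x).
Proof.
move=> ch x A [P hP PA].
have : \forall z \near x, forall j, P 0 j (h j z).
  apply: filter_forall => j; have := hP 0 j; rewrite mxE => hj.
  exact: ch hj.
by apply: filterS => z hz; apply: PA => i j; rewrite ord1 mxE.
Qed.

Lemma relatively_open_preimage (S T : topologicalType) (A : set S) (f : S -> T) (O : set T) :
  {within A, continuous f} -> open O ->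
  exists2 W : set S, open W & forall x, A x -> (W x <-> O (f x)).
Proof.
move=> /subspace_continuousP cf oO; exists (interior [set x | A x -> O (f x)]).
  exact: open_interior.
move=> x Ax; split; first by move=> /interior_subset; apply.
by move=> Ofx; apply: (cf x Ax); apply: open_nbhs_nbhs.
Qed.

Lemma within_continuous_comp (S T Z : topologicalType) (A A' : set S) (B : set T)
    (f : S -> T) (g : T -> Z) :
  {within A, continuous f} -> {within B, continuous g} -> A' `<=` A ->
  (forall x, A' x -> B (f x)) -> {within A', continuous (g \o f)}.
Proof.
move=> /subspace_continuousP cf /subspace_continuousP cg AA fB.
apply/subspace_continuousP => x A'x O nO.
have := cf x (AA _ A'x) _ (cg (f x) (fB _ A'x) _ nO).
rewrite /= !nbhs_simpl /within /=.
apply: filterS => z h A'z; apply: h; [exact: AA|exact: fB].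
Qed.

Variable n : nat.

(** A Euclidean chart at [f x] is pulled back along a homeomorphism between relatively open pieces
    of [A] and [B]; [W] and [W'] shrink both ends to where the composites are defined. *)
Lemma manifold_interior_transfer N P (A : set 'rV[R]_N) (B : set 'rV[R]_P)
    (U : set 'rV[R]_N) (V : set 'rV[R]_P) f g x :
  open U -> open V ->
  (forall x, A x -> U x -> B (f x) /\ V (f x)) ->
  (forall y, B y -> V y -> A (g y) /\ U (g y)) ->
  (forall x, A x -> U x -> g (f x) = x) -> (forall y, B y -> V y -> f (g y) = y) ->
  {within A `&` U, continuous f} -> {within B `&` V, continuous g} ->
  A x -> U x -> manifold_interior n B (f x) -> manifold_interior n A x.
Proof.
move=> oU oV fAB gBA gf fg cf cg Ax Ux [Bfx [U' [V' [oU' U'fx oV']]]].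
move=> [f' [g' [f'S g'S g'f' f'g' [cf' cg']]]].
have [W oW WP] := relatively_open_preimage cf oU'.
have [W' oW' WP'] := relatively_open_preimage cg' oV.
have f'im y : B y -> U' y -> V' (f' y) by move=> By Uy; apply: f'S; exists y.
have g'im z : V' z -> B (g' z) /\ U' (g' z) by move=> Vz; apply: g'S; exists z.
split=> //; exists (U `&` W), (V' `&` W'); split.
- exact: openI.
- by split => //; apply/WP.
- exact: openI.
exists (f' \o f), (g \o g'); split.
- move=> _ [z [Az [Uz Wz]] <-] /=.
  have U'fz : U' (f z) by apply/WP.
  have [Bfz Vfz] := fAB _ Az Uz; have V'z := f'im _ Bfz U'fz; split => //.
  by apply/WP' => //; rewrite g'f'.
- move=> _ [z [V'z W'z] <-] /=; have [Bz U'z] := g'im _ V'z.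
  have Vz : V (g' z) by apply/WP'.
  have [Az Uz] := gBA _ Bz Vz; split => //; split => //.
  by apply/WP => //; rewrite fg.
- move=> z [Az [Uz Wz]] /=; have U'fz : U' (f z) by apply/WP.
  by have [Bfz Vfz] := fAB _ Az Uz; rewrite g'f' ?gf.
- move=> z [V'z W'z] /=; have [Bz U'z] := g'im _ V'z.
  have Vz : V (g' z) by apply/WP'.
  by rewrite fg ?f'g'.
split.
- apply: within_continuous_comp cf cf' _ _; first by move=> z [? []].
  move=> z [Az [Uz Wz]]; have [Bfz _] := fAB _ Az Uz.
  by split => //; apply/WP.
- apply: within_continuous_comp cg' cg _ _; first by move=> z [].
  by move=> z [V'z W'z]; have [Bz _] := g'im _ V'z; split => //; apply/WP'.
Qed.

Lemma manifold_interior_nbhs N (A : set 'rV[R]_N) x : manifold_interior n A x ->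
  exists2 U, open U & U x /\ forall y, A y -> U y -> manifold_interior n A y.
Proof.
move=> [Ax [U [V [oU Ux oV h]]]]; exists U => //; split => // y Ay Uy.
by split => //; exists U, V.
Qed.

(* If one boundary point of a half-space had a Euclidean neighbourhood, so would
   all of them, by translation; this replaces invariance of domain below. *)
Lemma half_space_interior (y0 : 'rV[R]_n) :
  (forall i : 'I_n, i = 0%N :> nat -> y0 0 i = 0) ->
  manifold_interior n (@half_space R n) y0 ->
  forall y, half_space y -> manifold_interior n (@half_space R n) y.
Proof.
move=> y00 int0 y hy.
have cst_add (c : 'rV[R]_n) : continuous (fun z : 'rV[R]_n => z + c).
  have -> : (fun z : 'rV[R]_n => z + c) = (fun z : 'rV[R]_n => \row_j (z 0 j + c 0 j)).
    by apply/funext => z; apply/rowP => j; rewrite !mxE.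
  apply: row_continuous => j z.
  apply: (@cvgD _ _ _ (nbhs z) _ (fun z : 'rV[R]_n => z 0 j) (fun=> c 0 j)).
    exact: coord_continuous.
  exact: cvg_cst.
have [yb|yb] := pselect (forall i : 'I_n, i = 0%N :> nat -> y 0 i = 0).
  apply: (@manifold_interior_transfer _ _ (@half_space R n) (@half_space R n) setT setT
    (fun z => z + (y0 - y)) (fun z => z + (y - y0)) y openT openT) => //.
  - by move=> z hz _; split => // i i0; rewrite !mxE y00// yb// subr0 addr0; exact: hz.
  - by move=> z hz _; split => // i i0; rewrite !mxE y00// yb// subr0 addr0; exact: hz.
  - by move=> z _ _; rewrite -(opprB y0 y) addrK.
  - by move=> z _ _; rewrite -(opprB y0 y) subrK.
  - exact: continuous_subspaceT.
  - exact: continuous_subspaceT.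
  - by rewrite addrC subrK.
split => //; pose O := [set z : 'rV[R]_n | forall i : 'I_n, i = 0%N :> nat -> 0 < z 0 i].
have oO : open O.
  pose A (i : 'I_n) := [set z : 'rV[R]_n | i = 0%N :> nat -> 0 < z 0 i].
  apply: (@open_forall _ _ A) => i; have [i0|i0] := eqVneq (i : nat) 0%N.
    have -> : A i = (fun z : 'rV[R]_n => z 0 i) @^-1` [set r | 0 < r].
      by apply/seteqP; split => z; rewrite /A /=; [exact|move=> ? _].
    by apply: open_comp; [move=> z _; exact: coord_continuous|exact: open_gt].
  have -> : A i = setT by apply/seteqP; split => z //= _ ii; rewrite ii eqxx in i0.
  exact: openT.
exists O, O; split => //.
  move=> i i0; rewrite lt0r hy// andbT; apply/eqP => yi; apply: yb => j j0.
  by rewrite -yi; congr (y 0 _); apply/val_inj; rewrite /= i0 j0.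
have hO : half_space (R := R) (n := n) `&` O = O.
  apply/seteqP; split => z; first by case.
  by move=> Oz; split => // i i0; apply/ltW/Oz.
exists id, id; rewrite hO; split => //; first by move=> _ [z ? <-].
  by move=> _ [z ? <-].
by split; apply: continuous_subspaceT => z.
Qed.

(** Every chart of [X] has its values in the half-space, all of whose points are then interior. *)
Lemma manifold_all_interior N (X : set 'rV[R]_N) (y0 : 'rV[R]_n) :
  is_manifold n X -> (forall i : 'I_n, i = 0%N :> nat -> y0 0 i = 0) ->
  manifold_interior n (@half_space R n) y0 ->
  forall x, X x -> manifold_interior n X x.
Proof.
move=> mX y00 int0 x Xx; have [U [V [oU Ux oV [f [g [fS gS gf fg [cf cg]]]]]]] := mX _ Xx.
have fim z : X z -> U z -> half_space (f z) /\ V (f z).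
  by move=> Xz Uz; have [] : (V `&` half_space (n := n)) (f z) by apply: fS; exists z.
apply: (@manifold_interior_transfer _ _ X (@half_space R n) U V f g) => //.
- by move=> y hy Vy; apply: gS; exists y.
- by move=> z Xz Uz; apply: gf.
- by move=> z Xz Uz; apply: fg.
- by rewrite setIC.
- by apply: half_space_interior y00 int0 _ _; exact: (fim _ Xx Ux).1.
Qed.
End ManifoldInterior.

Section OpenStars.
Local Open Scope fset_scope.
Local Open Scope ring_scope.
Local Open Scope classical_set_scope.
Variables (R : realType) (N : nat).
Local Notation V := 'rV[R]_N.
Implicit Types (s t F tau : {fset V}) (K L : {fset {fset V}}) (a b p x y z v u : V).

Lemma eval_affine_continuous (c : 'cV[R]_(N + 1)) :
  continuous (eval_affine c : V -> R).
Proof.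
have -> : (eval_affine c : V -> R) = fun y : V =>
    \sum_(j < N) y 0 j * usubmx c j 0 + dsubmx c 0 0.
  by apply/funext => y; rewrite eval_affineE mxE.
move=> x; apply: (@cvgD _ _ _ (nbhs x) _ (fun y : V => \sum_(j < N) y 0 j * usubmx c j 0)
  (fun=> dsubmx c 0 0)); last exact: cvg_cst.
apply: (@continuous_sum R V 'I_N (fun j (y : V) => y 0 j * usubmx c j 0)) => j z.
apply: (@cvgM _ _ (nbhs z) _ (fun y : V => y 0 j) (fun=> usubmx c j 0)).
  exact: coord_continuous.
exact: cvg_cst.
Qed.

Lemma closed_low_coordinate s v (c : R) : affinely_independent s -> 0 <= c ->
  closed [set x | exists2 w, barycentric s w x & w v <= c].
Proof.
move=> ai c0; have [C [H [HC HH]]] := affine_coordinates ai.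
have cl h : closed [set x : V | 0 <= eval_affine h x].
  have -> : [set x : V | 0 <= eval_affine h x] =
    (eval_affine h : V -> R) @^-1` [set r | 0 <= r] by [].
  by apply: preimage_closed; [move=> x _; exact: eval_affine_continuous|exact: closed_ge].
have hull_closed : closed (hull s).
  have -> : hull s = \bigcap_(h in [set h | h \in H]) [set x : V | 0 <= eval_affine h x].
    by apply/seteqP; split => x; [move=> /HH hx h /=; exact: hx|move=> hx; apply/HH => h; exact: hx].
  by apply: closed_bigI => h _; exact: cl.
have [vs|vs] := boolP (v \in s); last first.
  suff -> : [set x | exists2 w, barycentric s w x & w v <= c] = hull s by [].
  apply/seteqP; split => x; first by move=> [w bw _]; exact: barycentric_hull bw.
  by move=> /hullP[w bw]; exists w => //; case: bw => _ ->.
have -> : [set x | exists2 w, barycentric s w x & w v <= c] =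
    hull s `&` ((eval_affine (C v) : V -> R) @^-1` [set r | r <= c]).
  have E w x : barycentric s w x -> eval_affine (C v) x = w v.
    by move=> [w0 ws w1 ->]; exact: HC.
  apply/seteqP; split => x.
    by move=> [w bw wc]; split; [exact: barycentric_hull bw|rewrite /= (E _ _ bw)].
  by move=> [/hullP[w bw]] /=; rewrite (E _ _ bw) => wc; exists w.
apply: closedI => //.
by apply: preimage_closed; [move=> x _; exact: eval_affine_continuous|exact: closed_le].
Qed.

(** The complement of a finite union of closed sets, hence open in the ambient space. For c = 0 its
    trace on the polyhedron is the open star of [tau]; points off the polyhedron satisfy the
    condition vacuously. *)
Lemma open_high_coordinates K tau (c : R) : is_complex K -> 0 <= c ->
  exists2 U : set V, open U & forall x, U x <->
    forall s w v, s \in K -> barycentric s w x -> v \in tau -> c < w v.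
Proof.
move=> cK c0; pose C s v := [set x | exists2 w, barycentric s w x & w v <= c].
exists (~` (\bigcup_(s in [set` K]) \bigcup_(v in [set` tau]) C s v)).
  apply: closed_openC; apply: closed_bigcup; first exact: finite_fset.
  move=> s sK; apply: closed_bigcup; first exact: finite_fset.
  by move=> v _; apply: closed_low_coordinate => //; case: cK => _ _ + _; apply.
move=> x; split.
  move=> Ux s w v sK bw vt; rewrite ltNge; apply/negP => wc; apply: Ux.
  by exists s => //; exists v => //; exists w.
by move=> h [s /= sK [v /= vt [w bw]]]; rewrite leNgt (h _ _ _ sK bw vt).
Qed.

(* Contracting the open star of v towards v moves any of its points into a
   given neighbourhood of v. *)
Lemma manifold_interior_of_vertices K n : is_complex K ->
  (forall v, ([fset v])%fset \in K -> manifold_interior n (polyhedron K) v) ->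
  forall x, polyhedron K x -> manifold_interior n (polyhedron K) x.
Proof.
move=> cK intv x Kx.
have [r rK [w bw wpos]] := exists_support cK Kx.
have [v vr] := fset0Pn _ (complex_neq0 cK rK).
have vK := complex_vertex cK rK vr.
have [W oW [Wv WX]] := manifold_interior_nbhs (intv _ vK).
pose ct (l : R) x := (1 - l) *: v + l *: x.
have ct_cont (a b : R) (u : V) : continuous (fun y : V => a *: u + b *: y).
  have -> : (fun y : V => a *: u + b *: y) = (fun y : V => \row_j (a * u 0 j + b * y 0 j)).
    by apply/funext => y; apply/rowP => j; rewrite !mxE.
  apply: row_continuous => j y.
  apply: (@cvgD _ _ _ (nbhs y) _ (fun=> a * u 0 j) (fun y : V => b * y 0 j)).
    exact: cvg_cst.
  apply: (@cvgM _ _ (nbhs y) _ (fun=> b) (fun y : V => y 0 j)); first exact: cvg_cst.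
  exact: coord_continuous.
have [l /andP[l0 l1] Wct] : exists2 l, 0 < l < 1 & W (ct l x).
  have cl : continuous (fun l : R => ct l x).
    have -> : (fun l : R => ct l x) = (fun l : R => \row_j ((1 - l) * v 0 j + l * x 0 j)).
      by apply/funext => y; apply/rowP => j; rewrite !mxE.
    apply: row_continuous => j y.
    apply: (@cvgD _ _ _ (nbhs y) _ (fun l => (1 - l) * v 0 j) (fun l => l * x 0 j)).
      apply: (@cvgM _ _ (nbhs y) _ (fun l => 1 - l) (fun=> v 0 j)); last exact: cvg_cst.
      by apply: cvgB; [exact: cvg_cst|exact: cvg_id].
    apply: (@cvgM _ _ (nbhs y) _ id (fun=> x 0 j)); [exact: cvg_id|exact: cvg_cst].
  have : nbhs (0 : R) [set l | W (ct l x)].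
    apply: cl; apply: open_nbhs_nbhs; split => //.
    by rewrite /ct subr0 scale1r scale0r addr0.
  move=> /nbhs_ballP[e /= e0 he].
  pose l := Num.min (e / 2) (1 / 2).
  have l0 : 0 < l by rewrite lt_min !divr_gt0.
  exists l; first by rewrite l0 gt_min; apply/orP; right; lra.
  apply: he; rewrite /ball /= sub0r normrN gtr0_norm// gt_min.
  by apply/orP; left; rewrite ltr_pdivrMr// mulr_natr mulr2n ltrDl.
(* [U1] cuts out the open star of [v]. Contraction by the factor [l] turns a weight r at [v] into 1
   - l + l * r, so the image is cut out by [U2], the weights above 1 - l. *)
have [U1 oU1 U1P] := open_high_coordinates [fset v] cK (lexx 0).
have l1' : 0 <= 1 - l by rewrite subr_ge0 ltW.
have [U2 oU2 U2P] := open_high_coordinates [fset v] cK l1'.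
have vin : v \in [fset v]%fset by rewrite inE.
pose ict (y : V) := (1 - l^-1) *: v + l^-1 *: y.
have ctK : cancel (ct l) ict.
  move=> y; rewrite /ict /ct scalerDr !scalerA mulVf ?gt_eqF// scale1r addrA -scalerDl.
  rewrite (_ : 1 - l^-1 + _ = 0) ?scale0r ?add0r//.
  by field; rewrite gt_eqF.
have ictK : cancel ict (ct l).
  move=> y; rewrite /ict /ct scalerDr !scalerA mulfV ?gt_eqF// scale1r addrA -scalerDl.
  rewrite (_ : 1 - l + _ = 0) ?scale0r ?add0r//.
  by field; rewrite gt_eqF.
have line s (u : V -> R) (y : V) (a : R) : barycentric s u y -> v \in s ->
    (forall z, 0 <= (1 - a) * (z == v)%:R + a * u z) ->
    barycentric s (fun z => (1 - a) * (z == v)%:R + a * u z) ((1 - a) *: v + a *: y).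
  move=> [u0 us u1 yE] vs nn.
  have D (Z : lmodType R) (h : V -> Z) : \sum_(z <- s) (z == v)%:R *: h z = h v.
    rewrite (big_fsetD1 v vs) /= eqxx scale1r big1_seq ?addr0// => z /=.
    by rewrite !inE => /andP[/negbTE -> _]; rewrite scale0r.
  split => //.
  - move=> z zs; rewrite us// (_ : (z == v) = false) ?mulr0 ?addr0//.
    by apply/eqP => zv; rewrite zv vs in zs.
  - rewrite big_split /= -!mulr_sumr u1.
    by have := D R^o (fun=> 1); rewrite /GRing.scale /=; under eq_bigr do rewrite mulr1; move=> ->; ring.
  - under eq_bigr do rewrite scalerDl -!scalerA.
    by rewrite big_split /= -!scaler_sumr -yE (D _ id).
have U1s y s (u : V -> R) : U1 y -> s \in K -> barycentric s u y -> v \in s /\ 0 < u v.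
  move=> /U1P h sK bu; have uv := h _ _ _ sK bu vin; split => //.
  by apply: contraTT uv => vs; case: bu => _ -> //; rewrite ltxx.
have U2s y s (u : V -> R) : U2 y -> s \in K -> barycentric s u y -> v \in s /\ 1 - l < u v.
  move=> /U2P h sK bu; have uv := h _ _ _ sK bu vin; split => //.
  by apply: contraTT uv => vs; case: bu => _ -> //; rewrite -leNgt.
apply: (@manifold_interior_transfer R n N N (polyhedron K) (polyhedron K) U1 U2 (ct l) ict x oU1 oU2).
- move=> y [s sK /hullP[u bu]] Uy; have [vs uv] := U1s _ _ _ Uy sK bu.
  have bc : barycentric s (fun z => (1 - l) * (z == v)%:R + l * u z) (ct l y).
    apply: line => // z; apply: addr_ge0; apply: mulr_ge0; rewrite ?ler0n//; first exact: ltW.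
    by case: bu.
  split; first by exists s => //; exact: barycentric_hull bc.
  apply/U2P => s' w' v' s'K bw'; rewrite inE => /eqP ->.
  rewrite -(complex_uniq cK sK s'K bc bw' v) eqxx mulr1 ltrDl.
  exact: mulr_gt0.
- move=> y [s sK /hullP[u bu]] Uy; have [vs uv] := U2s _ _ _ Uy sK bu.
  have li : 0 < l^-1 by rewrite invr_gt0.
  have lpos : 0 < (1 - l^-1) + l^-1 * u v.
    rewrite (_ : _ + _ = l^-1 * (u v - (1 - l))); last by field; rewrite gt_eqF.
    by rewrite mulr_gt0// subr_gt0.
  have bc : barycentric s (fun z => (1 - l^-1) * (z == v)%:R + l^-1 * u z) (ict y).
    apply: line => // z; have [->|zv] := eqVneq z v; first by rewrite mulr1 ltW.
    rewrite mulr0 add0r; apply: mulr_ge0; first exact: ltW.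
    by case: bu.
  split; first by exists s => //; exact: barycentric_hull bc.
  apply/U1P => s' w' v' s'K bw'; rewrite inE => /eqP ->.
  by rewrite -(complex_uniq cK sK s'K bc bw' v) eqxx mulr1.
- by move=> y _ _; exact: ctK.
- by move=> y _ _; exact: ictK.
- by apply: continuous_subspaceT; exact: ct_cont.
- by apply: continuous_subspaceT; exact: ct_cont.
- by [].
- apply/U1P => s w' v' sK bw'; rewrite inE => /eqP ->.
  by rewrite -(complex_uniq cK rK sK bw bw' v) wpos.
- apply: WX => //; exists r => //; apply: (@barycentric_hull _ _ _
    (fun z => (1 - l) * (z == v)%:R + l * w z)).
  apply: line => // z; apply: addr_ge0; apply: mulr_ge0; rewrite ?ler0n//; first exact: ltW.
  by case: bw.
Qed.
End OpenStars.

(** * Affine charts around a simplex *)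

Section SimplexChart.
Local Open Scope fset_scope.
Local Open Scope ring_scope.
Local Open Scope classical_set_scope.
Variables (R : realType) (N n : nat).
Local Notation V := 'rV[R]_N.
Variables (K : {fset {fset V}}) (sigma tau : {fset V}) (u : V) (e : 'I_n -> V).
Hypotheses (cK : is_complex K) (sigmaK : sigma \in K).
Hypotheses (e_inj : injective e) (e_u : forall i, e i != u).
Hypothesis sigmaE : sigma = (u |` [fset e i | i in 'I_n])%fset.
Hypotheses (u_tau : u \in tau) (tau_sigma : (tau `<=` sigma)%fset).
Hypothesis cofaces : forall s, s \in K -> (tau `<=` s)%fset -> (s `<=` sigma)%fset.

(** The coordinates are the weights at the vertices other than [u]. As [u] lies in [tau], its own
    weight must be positive, which is the condition that the sum be less than 1. *)
Definition chart_domain : set 'rV[R]_n :=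
  [set y | [/\ forall i, 0 <= y 0 i, forall i, e i \in tau -> 0 < y 0 i &
               \sum_i y 0 i < 1]].

Definition chart_map (y : 'rV[R]_n) : V :=
  (1 - \sum_i y 0 i) *: u + \sum_i y 0 i *: e i.

Lemma sum_simplex (W : nmodType) (f : V -> W) :
  \sum_(v <- sigma) f v = f u + \sum_i f (e i).
Proof.
rewrite sigmaE big_fsetU1 /=; last first.
  by apply/negP => /imfsetP[i _ ui]; move: (e_u i); rewrite ui eqxx.
rewrite big_imfset /=; first by rewrite big_enum.
by move=> i j _ _; exact: e_inj.
Qed.

Lemma barycentric_chart_map (y : 'rV[R]_n) :
  (forall i, 0 <= y 0 i) -> \sum_i y 0 i <= 1 ->
  exists w, [/\ barycentric sigma w (chart_map y), w u = 1 - \sum_i y 0 i &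
    forall i, w (e i) = y 0 i].
Proof.
move=> y0 y1.
pose w v := if v == u then 1 - \sum_i y 0 i else \sum_i (v == e i)%:R * y 0 i.
have wu : w u = 1 - \sum_i y 0 i by rewrite /w eqxx.
have we i : w (e i) = y 0 i.
  rewrite /w (negbTE (e_u i)) (bigD1 i)//= eqxx mul1r big1 ?addr0// => j ji.
  by rewrite (inj_eq e_inj) eq_sym (negbTE ji) mul0r.
exists w; split => //; split.
- move=> v; rewrite /w; case: ifP => _; first by rewrite subr_ge0.
  by apply: sumr_ge0 => i _; rewrite mulr_ge0.
- move=> v; rewrite sigmaE in_fset1U negb_or /w => /andP[/negbTE -> vi].
  rewrite big1// => i _; rewrite (_ : (v == e i) = false) ?mul0r//.
  by apply: contraNF vi => /eqP ->; exact: in_imfset.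
- by rewrite sum_simplex wu (eq_bigr _ (fun i _ => we i)) subrK.
- rewrite sum_simplex wu; congr (_ + _).
  by apply: eq_bigr => i _; rewrite we.
Qed.

Lemma chart_map_continuous : continuous chart_map.
Proof.
have -> : chart_map = fun y => \row_j ((1 - \sum_i y 0 i) * u 0 j + \sum_i y 0 i * e i 0 j).
  apply/funext => y; apply/rowP => j; rewrite !mxE summxE; congr (_ + _).
  by apply: eq_bigr => i _; rewrite mxE.
apply: row_continuous => j y.
have csum : continuous (fun z : 'rV[R]_n => \sum_i z 0 i).
  by apply: continuous_sum => i z; exact: coord_continuous.
apply: (@cvgD _ _ _ (nbhs y) _ (fun z : 'rV[R]_n => (1 - \sum_i z 0 i) * u 0 j)
  (fun z : 'rV[R]_n => \sum_i z 0 i * e i 0 j)).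
  apply: (@cvgM _ _ (nbhs y) _ (fun z : 'rV[R]_n => 1 - \sum_i z 0 i) (fun=> u 0 j)); last exact: cvg_cst.
  by apply: cvgB; [exact: cvg_cst|exact: csum].
apply: (@continuous_sum R _ 'I_n (fun i (z : 'rV[R]_n) => z 0 i * e i 0 j)) => i z.
apply: (@cvgM _ _ (nbhs z) _ (fun z : 'rV[R]_n => z 0 i) (fun=> e i 0 j)); last exact: cvg_cst.
exact: coord_continuous.
Qed.

Lemma simplex_chart : exists (U : set V) (q : V -> 'rV[R]_n),
  [/\ open U, continuous q,
    forall y, chart_domain y -> [/\ polyhedron K (chart_map y), U (chart_map y) &
                                   q (chart_map y) = y],
    forall x, polyhedron K x -> U x -> chart_domain (q x) /\ chart_map (q x) = x &
    forall x, open_simplex tau x ->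
      U x /\ forall i, e i \notin tau -> q x 0 i = 0].
Proof.
have ai : affinely_independent sigma by case: cK => _ _ + _; apply.
have [U oU UP] := open_high_coordinates tau cK (lexx (0 : R)).
have [C [_ [CP _]]] := affine_coordinates ai.
have e_sigma i : e i \in sigma by rewrite sigmaE in_fset1U orbC in_imfset.
pose q (x : V) : 'rV[R]_n := \row_i eval_affine (C (e i)) x.
have qE w x : barycentric sigma w x -> forall i, q x 0 i = w (e i).
  by move=> [_ _ w1 ->] i; rewrite mxE CP.
have sub_sigma s x : s \in K -> U x -> hull s x -> (s `<=` sigma)%fset.
  move=> sK /UP Ux /hullP[w bw]; apply: cofaces => //; apply/fsubsetP => v vt.
  have := Ux _ _ _ sK bw vt; apply: contraTT => vs.
  by case: bw => _ -> //; rewrite ltxx.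
exists U, q; split => //.
- by apply: row_continuous => j; exact: eval_affine_continuous.
- move=> y [y0 yt y1]; have [w [bw wu we]] := barycentric_chart_map y0 (ltW y1).
  split; first by exists sigma => //; exact: barycentric_hull bw.
    apply/UP => s w' v sK bw' vt; rewrite -(complex_uniq cK sigmaK sK bw bw' v).
    have := fsubsetP tau_sigma _ vt; rewrite sigmaE in_fset1U => /predU1P[->|].
      by rewrite wu subr_gt0.
    by move=> /imfsetP[i /= _ vi]; rewrite vi we; apply: yt; rewrite -vi.
  by apply/rowP => i; rewrite (qE _ _ bw) we.
- move=> x [s sK sx] Ux; have ss := sub_sigma _ _ sK Ux sx.
  have /hullP[w bw] := hullS ss sx; have [w0 ws w1 xE] := bw.
  have pos v : v \in tau -> 0 < w v by move/UP: Ux; apply; first exact: sigmaK.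
  have sumE : 1 - \sum_i w (e i) = w u.
    by rewrite -w1 sum_simplex addrK.
  split.
    split.
    - by move=> i; rewrite (qE _ _ bw).
    - by move=> i it; rewrite (qE _ _ bw) pos.
    - under eq_bigr do rewrite (qE _ _ bw).
      by rewrite -subr_gt0 sumE pos.
  rewrite /chart_map; under eq_bigr do rewrite (qE _ _ bw).
  under [X in _ + X]eq_bigr do rewrite (qE _ _ bw).
  by rewrite sumE xE sum_simplex.
- move=> x [c bc cpos]; have bs := barycentricS tau_sigma bc.
  split; last by move=> i it; rewrite (qE _ _ bs); case: bc => _ -> //.
  apply/UP => s w v sK bw vt.
  by rewrite -(complex_uniq cK sigmaK sK bs bw v) cpos.
Qed.
End SimplexChart.

Lemma open_chart_domain (R : realType) n (J : pred 'I_n) :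
  open [set y : 'rV[R]_n | (forall i, J i -> 0 < y 0 i) /\ \sum_i y 0 i < 1].
Proof.
pose A i := [set y : 'rV[R]_n | J i -> 0 < y 0 i].
pose B := (fun y : 'rV[R]_n => \sum_i y 0 i) @^-1` [set r | r < 1].
have -> : [set y : 'rV[R]_n | (forall i, J i -> 0 < y 0 i) /\ \sum_i y 0 i < 1] =
  [set y | forall i, A i y] `&` B by [].
apply: openI.
  apply: open_forall => i; have [Ji|Ji] := boolP (J i); last first.
    have -> : A i = setT by apply/seteqP; split => // y _; rewrite /A /= (negbTE Ji).
    exact: openT.
  have -> : A i = (fun y : 'rV[R]_n => y 0 i) @^-1` [set r | 0 < r].
    by apply/seteqP; split => y; rewrite /A /= Ji; [apply|].
  by apply: open_comp; [move=> z _; exact: coord_continuous|exact: open_gt].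
apply: open_comp; last exact: open_lt.
by move=> z _; apply: continuous_sum => i y; exact: coord_continuous.
Qed.

Section Status.
Local Open Scope fset_scope.
Local Open Scope ring_scope.
Variables (R : realType) (N : nat).
Local Notation V := 'rV[R]_N.
Implicit Types (K : {fset {fset V}}) (sigma tau : {fset V}).

Lemma seq_enumeration n (l : seq V) : uniq l -> size l = n ->
  exists e : 'I_n -> V, [/\ injective e, forall i, e i = nth 0 l i &
    forall x, (x \in l) = (x \in [fset e i | i in 'I_n])].
Proof.
move=> ul ln; exists (fun i => nth 0 l i); split => //.
  move=> i j /eqP; rewrite nth_uniq ?ln ?ltn_ord// => /eqP ij; exact: val_inj.
move=> x; apply/idP/imfsetP => [xl|[i _ ->]]; last by rewrite mem_nth// ln.
have xi : (index x l < n)%N by rewrite -ln index_mem.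
by exists (Ordinal xi); rewrite //= nth_index.
Qed.

Lemma top_simplex_interior n K sigma : is_complex K -> sigma \in K ->
  #|` sigma| = n.+1 -> (forall s, s \in K -> sigma `<=` s -> s `<=` sigma) ->
  forall x, open_simplex sigma x -> manifold_interior n (polyhedron K) x.
Proof.
move=> cK sK sn free x ox.
have [u us] := fset0Pn _ (complex_neq0 cK sK).
have [||e [e_inj _ el]] := @seq_enumeration n (sigma `\ u).
- exact: fset_uniq.
- by have := cardfsD1 u sigma; rewrite us sn add1n => -[].
have sE : sigma = u |` [fset e i | i in 'I_n].
  apply/fsetP => v; rewrite in_fset1U -el in_fsetD1.
  by have [->|] := eqVneq v u; rewrite ?us.
have eu i : e i != u.
  have : e i \in [fset e i | i in 'I_n] by exact: in_imfset.
  by rewrite -el in_fsetD1 => /andP[].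
have [U [q [oU cq qp pq qo]]] := simplex_chart cK sK e_inj eu sE us (fsubset_refl _) free.
have Kx : polyhedron K x by exists sigma => //; exact: open_simplex_hull ox.
have [Ux _] := qo _ ox.
have esig i : e i \in sigma by rewrite sE in_fset1U orbC in_imfset.
pose D := @chart_domain R N n sigma e.
have oD : open D.
  have -> : D = [set y | (forall i, predT i -> 0 < y 0 i) /\ \sum_i y 0 i < 1].
    apply/seteqP; split => y.
      by move=> [_ y0 y1]; split => // i _; exact: y0.
    by move=> [y0 y1]; split => // i *; [exact/ltW/y0|exact: y0].
  exact: open_chart_domain.
split => //; exists U, D; split => //.
exists q, (chart_map u e); split.
- by move=> _ [z [Kz Uz] <-]; case: (pq _ Kz Uz).
- by move=> _ [z Dz <-]; case: (qp _ Dz).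
- by move=> z [Kz Uz]; case: (pq _ Kz Uz).
- by move=> z Dz; case: (qp _ Dz).
- by split; apply: continuous_subspaceT => //; exact: chart_map_continuous.
Qed.

(** The chart identifies a neighbourhood of [x] with an open piece of the half-space and sends [x]
    to its boundary hyperplane. Were [x] interior, [manifold_all_interior] would make the given
    boundary point [b] interior. *)
Lemma free_face_boundary n K sigma v : is_complex K -> is_manifold n (polyhedron K) ->
  (exists x, manifold_boundary n (polyhedron K) x) ->
  sigma \in K -> #|` sigma| = n.+1 -> v \in sigma -> sigma `\ v != fset0 ->
  (forall s, s \in K -> sigma `\ v `<=` s -> s `<=` sigma) ->
  forall x, open_simplex (sigma `\ v) x -> manifold_boundary n (polyhedron K) x.
Proof.
move=> cK mK [b [Kb nb]] sK sn vs t0 free x ox.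
have [u ut] := fset0Pn _ t0; have /fsetD1P[uv us] := ut.
(* [v] is listed first so that its weight becomes coordinate 0, the one that [half_space]
   constrains. *)
pose l := v :: enum_fset (sigma `\ v `\ u).
have memE y : (y \in l) = (y \in sigma `\ u).
  rewrite inE !in_fsetD1; have [->|] /= := eqVneq y v; last by [].
  by rewrite eq_sym uv vs.
have ul : uniq l by rewrite /l /= fset_uniq !inE eqxx andbF.
have lsz : size l = n.
  rewrite /l /=; have := cardfsD1 v sigma; rewrite vs sn => -[->].
  by rewrite (cardfsD1 u (sigma `\ v)) ut.
have [e [e_inj enth el]] := seq_enumeration ul lsz.
have sE : sigma = u |` [fset e i | i in 'I_n].
  apply/fsetP => y; rewrite in_fset1U -el memE in_fsetD1.
  by have [->|] := eqVneq y u; rewrite ?us.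
have eu i : e i != u.
  have : e i \in [fset e i | i in 'I_n] by exact: in_imfset.
  by rewrite -el memE in_fsetD1 => /andP[].
have [U [q [oU cq qp pq qo]]] := simplex_chart cK sK e_inj eu sE ut (fsubsetDl _ _) free.
have Kx : polyhedron K x.
  by exists sigma => //; apply: hullS (open_simplex_hull ox); exact: fsubsetDl.
have [Ux qx] := qo _ ox.
split => // intx; apply: nb.
have e0 (i : 'I_n) : (e i \notin sigma `\ v) = (i == 0%N :> nat).
  have eis : e i \in sigma by rewrite sE in_fset1U orbC in_imfset.
  rewrite in_fsetD1 eis andbT negbK enth.
  have -> : v = nth 0 l 0 by [].
  by rewrite nth_uniq ?lsz// (leq_ltn_trans _ (ltn_ord i)).
have qx0 (i : 'I_n) : i = 0%N :> nat -> q x 0 i = 0.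
  by move=> i0; apply: qx; rewrite e0 i0.
apply: (manifold_all_interior mK qx0 _ Kb).
pose W := [set y : 'rV[R]_n | (forall i, e i \in sigma `\ v -> 0 < y 0 i)
  /\ \sum_i y 0 i < 1].
have oW : open W by exact: (@open_chart_domain R n (fun i => e i \in sigma `\ v)).
have WD y : half_space y -> W y -> chart_domain (sigma `\ v) e y.
  move=> hy [Wy y1]; split => // i.
  have [/Wy /ltW //|] := boolP (e i \in sigma `\ v).
  by rewrite e0 => /eqP; exact: hy.
have DW y : chart_domain (sigma `\ v) e y -> half_space y /\ W y.
  by move=> [y0 yt y1]; split => // i _; exact: y0.
have [Dqx pqx] := pq _ Kx Ux.
apply: (@manifold_interior_transfer R n n N (@half_space R n) (polyhedron K) W U
   (chart_map u e) q (q x) oW oU).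
- by move=> y hy Wy; case: (qp _ (WD _ hy Wy)).
- by move=> y Ky Uy; case: (pq _ Ky Uy) => /DW.
- by move=> y hy Wy; case: (qp _ (WD _ hy Wy)).
- by move=> y Ky Uy; case: (pq _ Ky Uy).
- by apply: continuous_subspaceT; exact: chart_map_continuous.
- exact: continuous_subspaceT.
- by case: (DW _ Dqx).
- by case: (DW _ Dqx).
- by rewrite pqx.
Qed.
End Status.

(** * Stellar moves on combinatorial manifolds *)

Section ApexLinks.
Local Open Scope fset_scope.
Local Open Scope ring_scope.
Variables (R : realType) (N : nat).
Local Notation V := 'rV[R]_N.
Implicit Types (s t F sigma tau rho : {fset V}) (K L : {fset {fset V}}) (a c v x : V).

(* The join of the boundary of tau with the simplex on the other vertices of
   sigma: a sphere if tau = sigma, a ball if tau is a facet of sigma. *)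
Definition apex_link sigma tau : {fset {fset V}} :=
  [fset t in full_simplex sigma | ~~ (tau `<=` t)].

Lemma in_apex_link sigma tau t :
  (t \in apex_link sigma tau) = [&& t != fset0, t `<=` sigma & ~~ (tau `<=` t)].
Proof. by rewrite 2!inE /= in_full_simplex andbA. Qed.

Lemma apex_link_complex sigma tau :
  affinely_independent sigma -> is_complex (apex_link sigma tau).
Proof.
move=> ai; apply: complex_sub (full_simplex_complex ai) _ _.
  by apply/fsubsetP => t; rewrite 2!inE => /andP[].
move=> s t; rewrite !in_apex_link => /and3P[_ ss ts] -> t_s /=.
by rewrite (fsubset_trans t_s ss)/=; apply: contra ts => /fsubset_trans; exact.
Qed.

Lemma fsubset_imfset_bij (T T' : choiceType) (s : {fset T}) (B : {fset T'})
    (f : T -> T') (t : {fset T}) : (forall y : T, y \in s -> f y \in B) -> t `<=` s ->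
  [fset f v | v in t] `<=` B.
Proof.
by move=> fB /fsubsetP ts; apply/fsubsetP => _ /imfsetP[v /= /ts vs ->]; exact: fB.
Qed.

Lemma simplex_bijection s : exists (phi : V -> 'rV[R]_#|` s|) psi,
  (forall v, v \in s -> phi v \in basis_vertices R #|` s| /\ psi (phi v) = v) /\
  (forall u, u \in basis_vertices R #|` s| -> psi u \in s /\ phi (psi u) = u).
Proof.
set m := #|` s|.
pose phi (v : V) : 'rV[R]_m := if insub (index v s) is Some i then delta_mx 0 i else 0.
pose psi (u : 'rV[R]_m) : V := if [pick i | u == delta_mx 0 i] is Some i then nth 0 s i else 0.
have psiE i : psi (delta_mx 0 i) = nth 0 s i.
  rewrite /psi; case: pickP => [j /eqP /delta_mx0_inj -> //|/(_ i)].
  by rewrite eqxx.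
have phiE (i : 'I_m) : phi (nth 0 s i) = delta_mx 0 i.
  rewrite /phi index_uniq ?fset_uniq//; case: insubP => [j _ ji|]; last by rewrite ltn_ord.
  by rewrite (val_inj ji).
exists phi, psi; split.
  move=> v vs; have vi : (index v s < m)%N by rewrite index_mem.
  have -> : v = nth 0 s (Ordinal vi) by rewrite nth_index.
  by rewrite phiE psiE; split => //; apply/in_basis_vertices; eexists.
move=> u /in_basis_vertices[i ->]; rewrite psiE phiE; split => //.
exact: mem_nth.
Qed.

Lemma imfset_neq0 (T T' : choiceType) (f : T -> T') (t : {fset T}) :
  t != fset0 -> [fset f v | v in t] != fset0.
Proof. by move=> /fset0Pn[v vt]; apply/fset0Pn; exists (f v); exact: in_imfset. Qed.

Lemma full_simplex_pl_ball s n : affinely_independent s -> #|` s| = n ->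
  pl_ball_pred n (full_simplex s).
Proof.
move=> ai <-; have [phi [psi [h1 h2]]] := simplex_bijection s.
apply: (@simplicial_iso_pl_homeomorphic _ _ _ _ _ phi psi).
- exact: full_simplex_complex.
- exact: std_simplex_complex.
- move=> t; rewrite std_simplexE !in_full_simplex => /andP[t0 ts].
  by rewrite imfset_neq0//=; apply: fsubset_imfset_bij ts => v /h1[].
- move=> t; rewrite std_simplexE !in_full_simplex => /andP[t0 ts].
  by rewrite imfset_neq0//=; apply: fsubset_imfset_bij ts => v /h2[].
- by move=> t v; rewrite in_full_simplex => /andP[_ /fsubsetP ts] /ts /h1[].
- by move=> t v; rewrite in_full_simplex => /andP[_ /fsubsetP ts] /ts /h2[].
Qed.

Lemma in_std_simplex_boundary m (t : {fset 'rV[R]_m}) : (t \in std_simplex_boundary R m) =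
  [&& t != fset0, t `<=` basis_vertices R m & ~~ (basis_vertices R m `<=` t)].
Proof.
rewrite in_fsetD1 std_simplexE in_full_simplex andbC -andbA; congr (_ && _).
by have [h|//] := boolP (t `<=` _); rewrite eqEfsubset h.
Qed.

Lemma std_simplex_boundary_complex m : is_complex (std_simplex_boundary R m).
Proof.
apply: complex_sub (@std_simplex_complex R m) _ _; first exact: fsubsetDl.
move=> s t; rewrite !in_std_simplex_boundary => /and3P[_ ss ts] -> t_s /=.
by rewrite (fsubset_trans t_s ss)/=; apply: contra ts => /fsubset_trans; exact.
Qed.

Lemma apex_link_pl_sphere s n : affinely_independent s -> #|` s| = n.+1 ->
  pl_sphere_pred n (apex_link s s).
Proof.
move=> ai sn; rewrite /pl_sphere_pred -sn.
have [phi [psi [h1 h2]]] := simplex_bijection s.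
apply: (@simplicial_iso_pl_homeomorphic _ _ _ _ _ phi psi).
- exact: apex_link_complex.
- exact: std_simplex_boundary_complex.
- move=> t; rewrite in_std_simplex_boundary in_apex_link => /and3P[t0 ts st].
  rewrite imfset_neq0//=; apply/andP; split.
    by apply: fsubset_imfset_bij ts => v /h1[].
  apply: contra st => /fsubsetP st; apply/fsubsetP => v vs.
  have [/st/imfsetP[u /= ut e] pv] := h1 _ vs.
  by rewrite -pv e; have [_ ->] := h1 _ (fsubsetP ts _ ut).
- move=> t; rewrite in_std_simplex_boundary in_apex_link => /and3P[t0 ts st].
  rewrite imfset_neq0//=; apply/andP; split.
    by apply: fsubset_imfset_bij ts => v /h2[].
  apply: contra st => /fsubsetP st; apply/fsubsetP => v vs.
  have [/st/imfsetP[u /= ut e] pv] := h2 _ vs.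
  by rewrite -pv e; have [_ ->] := h2 _ (fsubsetP ts _ ut).
- by move=> t v; rewrite in_apex_link => /and3P[_ /fsubsetP ts _] /ts /h1[].
- by move=> t v; rewrite in_std_simplex_boundary => /and3P[_ /fsubsetP ts _] /ts /h2[].
Qed.

(* The cone over the boundary of a simplex is that simplex starred at itself. *)
Lemma apex_link_pl_ball s v n : affinely_independent s -> v \in s ->
  #|` s| = n.+1 -> s `\ v != fset0 -> pl_ball_pred n (apex_link s (s `\ v)).
Proof.
move=> ai vs sn t0; set t := s `\ v.
have ait : affinely_independent t by apply: affinely_independentS (fsubsetDl _ _) ai.
have tn : #|` t| = n by have := cardfsD1 v s; rewrite vs sn => -[->].
have vt : v \notin t by rewrite in_fsetD1 eqxx.
have E : apex_link s t = star (full_simplex t) t v.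
  apply/fsetP => q; rewrite in_apex_link in_star//.
  have [//|q0] /= := eqVneq q fset0.
  rewrite andbC.
  have -> : (t `<=` q) = (t `<=` q `\ v) by rewrite fsubsetD1 vt andbT.
  case: (boolP (t `<=` q `\ v)) => //= tq.
  have qs : (q `<=` s) = (q `\ v `<=` t).
    apply/fsubsetP/fsubsetP => h u; first by rewrite !in_fsetD1 => /andP[-> /h].
    move=> uq; have [->//|uv] := eqVneq u v.
    by have := h u; rewrite !in_fsetD1 uv uq => /(_ isT).
  rewrite qs in_full_simplex; case: ifPn => vq; last by rewrite q0 (mem_fsetD1 vq).
  rewrite fsubUset fsubset_refl andbT.
  suff -> : q `\ v `|` t != fset0 by [].
  by apply: contraNneq t0 => e; rewrite -fsubset0 -e fsubsetUr.
apply: pl_homeomorphic_trans (full_simplex_pl_ball ait tn); rewrite E.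
apply: star_pl_homeomorphic.
- exact: full_simplex_complex.
- by rewrite in_full_simplex t0 fsubset_refl.
- by move=> q; rewrite in_full_simplex => /andP[_ /fsubsetP h]; apply: contra vt; exact: h.
- by rewrite -E; exact: apex_link_complex.
Qed.

Lemma open_simplex_fresh K F a : is_complex K -> F \in K -> (1 < #|` F|)%N ->
  open_simplex F a -> forall s, s \in K -> a \notin s.
Proof.
move=> cK FK F1 oF s sK; apply/negP => /(open_simplex_apex cK FK oF sK) e.
by rewrite e cardfs1 in F1.
Qed.

(** Only the new vertex needs checking. The polyhedron is unchanged, so old vertices stay interior
    or boundary, and their links are either unchanged or starred. *)
Lemma comb_manifold_star n K F a : is_comb_manifold n K -> F \in K ->
  (1 < #|` F|)%N -> open_simplex F a ->
  (manifold_interior n (polyhedron K) a -> pl_sphere_pred n (link (star K F a) a)) ->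
  (manifold_boundary n (polyhedron K) a -> pl_ball_pred n (link (star K F a) a)) ->
  is_comb_manifold n (star K F a).
Proof.
move=> [cK mK lK] FK F1 oF sph ball.
have [cS pS _] := star_subdivision cK FK oF.
have fresh := open_simplex_fresh cK FK F1 oF.
split => //; rewrite pS// => v vS.
have [->|va] := eqVneq v a; first by split.
have F0 := complex_neq0 cK FK.
have vK : [fset v] \in K.
  have av : a \notin [fset v] by rewrite in_fset1 eq_sym.
  move: vS; rewrite in_star// (negbTE av).
  by case/and3P.
have Fv0 : F `\ v != fset0.
  by rewrite -cardfs_gt0; move: F1; rewrite (cardfsD1 v F); case: (v \in F); case: #|` _|.
suff h : pl_homeomorphic (link (star K F a) v) (link K v).
  have [ls lb] := lK _ vK.
  by split => [/ls|/lb]; exact: pl_homeomorphic_trans.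
have E := link_star cK cS Fv0 va fresh.
have aL s : s \in link K v -> a \notin s.
  by rewrite 2!inE => /andP[/fresh].
have cL := @link_complex _ _ K v cK.
have cSL : is_complex (star (link K v) (F `\ v) a) by rewrite -E; exact: link_complex.
rewrite E; have [FL|FL] := boolP (F `\ v \in link K v).
  exact: star_pl_homeomorphic.
by rewrite star_notin//; apply: subdivision_pl_homeomorphic; exact: subdivision_refl.
Qed.

Lemma in_link_apex K F a t : is_complex K -> F \in K -> (1 < #|` F|)%N ->
  open_simplex F a ->
  (t \in link (star K F a) a) = [&& t != fset0, ~~ (F `<=` t) & t `|` F \in K].
Proof.
move=> cK FK F1 oF; have F0 := complex_neq0 cK FK.
have fresh := open_simplex_fresh cK FK F1 oF.
rewrite in_link; last exact: star_complex.
rewrite in_star// fset1U1 [a |` t != _](_ : _ = true); last first.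
  by apply/fset0Pn; exists a; rewrite fset1U1.
have [t0|t0] //= := eqVneq t fset0.
have [at_|at_] /= := boolP (a \in t).
  symmetry; apply/negbTE; rewrite negb_and; apply/orP; right; apply/negP => /fresh.
  by rewrite in_fsetU at_.
by rewrite fsetU1K.
Qed.

(* Every simplex containing tau lies in sigma.  First tau is starred at a, then
   the new face a |` rho is starred at c. *)
Section StellarMoves.
Variables (n : nat) (K : {fset {fset V}}) (sigma tau : {fset V}) (a : V).
Hypotheses (cK : is_complex K) (sigmaK : sigma \in K) (tau_sigma : tau `<=` sigma).
Hypothesis cofaces : forall s, s \in K -> tau `<=` s -> s `<=` sigma.
Hypotheses (tau1 : (1 < #|` tau|)%N) (tau_a : open_simplex tau a).

Lemma lower_face_neq0 : tau != fset0.
Proof. by rewrite -cardfs_gt0 ltnW. Qed.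

Lemma lower_face_mem : tau \in K.
Proof. exact: complex_face cK sigmaK lower_face_neq0 tau_sigma. Qed.

Lemma lower_apex_fresh s : s \in K -> a \notin s.
Proof. exact: open_simplex_fresh cK lower_face_mem tau1 tau_a s. Qed.

Lemma union_lower_face t : (t `|` tau \in K) = (t `<=` sigma).
Proof.
apply/idP/idP => [h|ts].
  by apply: fsubset_trans (fsubsetUl _ _) (cofaces h (fsubsetUr _ _)).
apply: complex_face cK sigmaK _ _; last by rewrite fsubUset ts.
by apply: contraNneq lower_face_neq0 => e; rewrite -fsubset0 -e fsubsetUr.
Qed.

Lemma link_first_apex : link (star K tau a) a = apex_link sigma tau.
Proof.
apply/fsetP => t; rewrite in_link_apex ?lower_face_mem// in_apex_link union_lower_face.
by rewrite [X in _ && X]andbC.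
Qed.

Variables (rho : {fset V}) (c : V).
Hypotheses (rho_tau : rho `<` tau) (rho0 : rho != fset0).
Local Notation F := (a |` rho).
Hypothesis (F_c : open_simplex F c).

Lemma apex_notin_rho : a \notin rho.
Proof.
apply: contra (lower_apex_fresh lower_face_mem); apply: (fsubsetP (fproper_sub rho_tau)).
Qed.

Lemma second_face_mem : F \in star K tau a.
Proof.
rewrite in_star ?lower_face_neq0// fset1U1 fsetU1K ?apex_notin_rho//; apply/and3P; split.
- by apply/fset0Pn; exists a; exact: fset1U1.
- by move: rho_tau; rewrite fproperE => /andP[].
- by rewrite union_lower_face; apply: fsubset_trans (fproper_sub rho_tau) tau_sigma.
Qed.

Lemma second_face_card : (1 < #|` F|)%N.
Proof. by rewrite cardfsU1 apex_notin_rho ltnS cardfs_gt0. Qed.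

Lemma second_union t : (t `|` F \in star K tau a) =
  ~~ (tau `\` rho `<=` t `\ a) && (t `\ a `<=` sigma).
Proof.
have arho := apex_notin_rho.
rewrite in_star ?lower_face_neq0//.
have aF : a \in t `|` F by rewrite in_fsetU fset1U1 orbT.
rewrite aF.
have -> /= : t `|` F != fset0 by apply/fset0Pn; exists a.
have -> : (t `|` F) `\ a = t `\ a `|` rho.
  apply/fsetP => v; rewrite !in_fsetE; have [->|_] //= := eqVneq v a.
  by rewrite (negbTE arho).
rewrite -fsetUA (fsetUidPr _ _ (fproper_sub rho_tau)) union_lower_face; congr (~~ _ && _).
by rewrite fsubDset fsetUC.
Qed.

(** The link of the second apex is that of the first one, starred at the rest of [tau] with label
    [a]. Its PL type is thus the known one of [apex_link]. *)
Lemma link_second_apex : link (star (star K tau a) F c) c =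
  star (apex_link sigma tau) (tau `\` rho) a.
Proof.
have cS : is_complex (star K tau a) by apply: star_complex => //; exact: lower_face_mem.
have tr0 : tau `\` rho != fset0.
  by rewrite fsetD_eq0; move: rho_tau; rewrite fproperE => /andP[].
have arho := apex_notin_rho.
apply/fsetP => t; rewrite in_link_apex ?second_face_mem ?second_face_card//.
rewrite second_union in_star//; have [//|t0] /= := eqVneq t fset0.
rewrite andbCA; case: (boolP (tau `\` rho `<=` t `\ a)) => //= trt.
have [at_|at_] := boolP (a \in t).
  rewrite in_apex_link.
  have -> /= : t `\ a `|` tau `\` rho != fset0.
    by apply: contraNneq tr0 => e; rewrite -fsubset0 -e fsubsetUr.
  rewrite [in RHS]fsubUset (fsubset_trans (fsubsetDl _ _) tau_sigma) andbT andbC; congr (_ && ~~ _).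
  apply/fsubsetP/fsubsetP => h v.
    move=> vt; rewrite !in_fsetE vt andbT; have [vr|//] := boolP (v \in rho); last by rewrite orbT.
    rewrite h ?in_fsetE ?vr ?orbT// andbT orbF.
    by apply: contraNneq arho => <-.
  rewrite in_fset1U => /predU1P[->//|vr].
  have := h v (fsubsetP (fproper_sub rho_tau) _ vr).
  by rewrite !in_fsetE vr /= orbF => /andP[].
rewrite (mem_fsetD1 at_) in_apex_link t0 /= andbC; congr (_ && ~~ _).
rewrite (mem_fsetD1 at_) in trt.
have -> : (tau `<=` t) = false.
  by apply: contraNF trt => /(fsubset_trans (fsubsetDl _ _)).
by apply/negbTE; apply: contra at_ => /fsubsetP; apply; exact: fset1U1.
Qed.

Lemma link_second_apex_pl : pl_homeomorphic (link (star (star K tau a) F c) c)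
  (apex_link sigma tau).
Proof.
have cS : is_complex (star K tau a) by apply: star_complex => //; exact: lower_face_mem.
have ai : affinely_independent sigma by case: cK => _ _ + _; apply.
rewrite link_second_apex; apply: star_pl_homeomorphic.
- exact: apex_link_complex.
- rewrite in_apex_link fsetD_eq0; apply/and3P; split.
  + by move: rho_tau; rewrite fproperE => /andP[].
  + exact: fsubset_trans (fsubsetDl _ _) tau_sigma.
  + have [v vr] := fset0Pn _ rho0; apply/fsubsetPn; exists v.
      exact: (fsubsetP (fproper_sub rho_tau)).
    by rewrite in_fsetD vr.
- move=> s; rewrite in_apex_link => /and3P[_ /fsubsetP h _].
  by apply: contra (lower_apex_fresh sigmaK); exact: h.
- rewrite -link_second_apex; apply: link_complex; apply: star_complex => //.
  exact: second_face_mem.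
Qed.

(** Both apexes lie in the open simplex [tau], so one condition on its points serves for both
    moves. *)
Lemma open_simplex_second : open_simplex tau c.
Proof.
have [d bd dpos] := tau_a; have [w bw wpos] := F_c.
exists (apex_lift d a w).
  have := barycentric_star_carrier bd bw; rewrite /star_carrier fset1U1.
  rewrite fsetU1K ?apex_notin_rho//.
  by rewrite (fsetUidPr _ _ (fproper_sub rho_tau)).
move=> v vt; rewrite /apex_lift; apply: ltr_wpDl; last by rewrite mulr_gt0 ?wpos ?fset1U1 ?dpos.
by case: ifP => // _; case: bw.
Qed.
End StellarMoves.
End ApexLinks.

(** * Face polynomials *)

Section FacePolynomial.
Local Open Scope fset_scope.
Local Open Scope ring_scope.

(** The exponent counts vertices rather than dimension, so that joins become products and an empty
    face contributes 1. *)
Definition face_poly (T : choiceType) (A : {fset {fset T}}) : {poly int} :=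
  \sum_(s <- A) 'X^#|` s|.

Lemma face_poly1 (T : choiceType) (s : {fset T}) : face_poly [fset s] = 'X^#|` s|.
Proof. by rewrite /face_poly big_seq_fset1. Qed.

Lemma face_poly_split (T : choiceType) (P : pred {fset T}) (A : {fset {fset T}}) :
  face_poly A = face_poly [fset s in A | P s] + face_poly [fset s in A | ~~ P s].
Proof. by rewrite /face_poly (big_fsetID _ P). Qed.

(** A face is determined by its parts inside and outside [F], and their cardinalities add. *)
Lemma face_poly_join (T : choiceType) (F : {fset T}) (P Q J : {fset {fset T}}) :
  (forall p, p \in P -> p `<=` F) -> (forall q, q \in Q -> q `&` F = fset0) ->
  (forall s, (s \in J) = (s `&` F \in P) && (s `\` F \in Q)) ->
  face_poly J = face_poly P * face_poly Q.
Proof.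
move=> PF QF JE; pose h s := (s `&` F, s `\` F).
transitivity (\sum_(u <- [seq h s | s <- J]) 'X^(#|` u.1| + #|` u.2|) : {poly int}).
  by rewrite big_map; apply: eq_bigr => s _; rewrite /= cardfsID.
transitivity (\sum_(u <- [seq (p, q) | p <- P, q <- Q]) 'X^(#|` u.1| + #|` u.2|) : {poly int}).
  apply: perm_big; apply: uniq_perm.
  - rewrite map_inj_uniq ?fset_uniq// => s t [e1 e2].
    by rewrite -(fsetID F s) -(fsetID F t) e1 e2.
  - by apply: allpairs_uniq; rewrite ?fset_uniq// => -[? ?] [? ?].
  - move=> [p q]; apply/mapP/allpairsP => [[s sJ [-> ->]]|[[p' q'] [/= pP qQ [-> ->]]]].
      by exists (s `&` F, s `\` F); move: sJ; rewrite JE => /andP[].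
    have e1 : (p' `|` q') `&` F = p'.
      by rewrite fsetIUl (QF _ qQ) fsetU0; apply/fsetIidPl; exact: PF.
    have e2 : (p' `|` q') `\` F = q'.
      rewrite fsetDUl; have -> : p' `\` F = fset0 by apply/eqP; rewrite fsetD_eq0 PF.
      by rewrite fset0U; apply/fsetDidPl; rewrite -fsetI_eq0 QF.
    exists (p' `|` q'); first by rewrite JE e1 e2 pP qQ.
    by rewrite /h e1 e2.
rewrite big_allpairs mulr_suml; apply: eq_bigr => p _.
by rewrite mulr_sumr; apply: eq_bigr => q _; rewrite exprD.
Qed.

Lemma face_poly_powerset (T : choiceType) (A : {fset T}) :
  face_poly (fpowerset A) = (1 + 'X) ^+ #|` A|.
Proof.
have [n] := ubnP #|` A|; elim: n A => // n IH A.
have [->|/fset0Pn[v vA]] := eqVneq A fset0.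
  by rewrite fpowerset0 face_poly1 cardfs0 !expr0.
rewrite (cardfsD1 v A) vA add1n ltnS => ltn.
rewrite (@face_poly_join _ [fset v] (fpowerset [fset v]) (fpowerset (A `\ v))).
- rewrite (IH (A `\ v))// exprS fpowerset1; congr (_ * _).
  rewrite /face_poly big_fsetU1 /=; last first.
    by rewrite in_fset1; apply/eqP => /fsetP/(_ v); rewrite !in_fsetE eqxx.
  by rewrite big_seq_fset1 ?cardfs0 cardfs1 ?expr0 expr1.
- by move=> p; rewrite fpowersetE.
- move=> q; rewrite fpowersetE => /fsubsetP h; apply/eqP; rewrite fsetI_eq0.
  apply/fdisjointP => u /h; rewrite !in_fsetE => /andP[uv _].
  by rewrite uv.
- move=> s; rewrite !fpowersetE fsubsetIr /=; apply/fsubsetP/fsubsetP => h u.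
    by rewrite !in_fsetE => /andP[-> /h].
  move=> us; have [->//|uv] := eqVneq u v.
  by have := h u; rewrite !in_fsetE us uv => /(_ isT).
Qed.

Lemma face_poly_proper_faces (T : choiceType) (A : {fset T}) :
  face_poly (fpowerset A `\ A) = (1 + 'X) ^+ #|` A| - 'X^#|` A|.
Proof.
rewrite -face_poly_powerset /face_poly [in RHS](big_fsetD1 A) ?fpowersetE//=.
by rewrite addrAC subrr add0r.
Qed.

Variables (R : realType) (N : nat).
Local Notation V := 'rV[R]_N.
Implicit Types (s t q F sigma tau rho : {fset V}) (K : {fset {fset V}}) (a c : V).

(** Link of a face of any dimension. Unlike in [link], the empty set is a member when [F] is in [K];
    it accounts for [F] itself. *)
Definition full_link K F : {fset {fset V}} :=
  [fset q in fpowerset (vertices K) | (q `&` F == fset0) && (q `|` F \in K)].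

Lemma sub_vertices K s t : s `|` t \in K -> s `<=` vertices K.
Proof.
move=> h; apply/fsubsetP => v vs; apply/verticesP; exists (s `|` t) => //.
by rewrite in_fsetU vs.
Qed.

Lemma in_full_link K F q : (q \in full_link K F) = (q `&` F == fset0) && (q `|` F \in K).
Proof.
rewrite 2!inE /= fpowersetE; apply: andb_idl => /andP[_]; exact: sub_vertices.
Qed.

(** The faces containing [F], that is [F] joined with its link, are replaced by the joins of the
    apex, a proper face of [F] (possibly empty) and a face of the link. *)
Lemma face_poly_star K F a : is_complex K -> F \in K -> (forall s, s \in K -> a \notin s) ->
  face_poly (star K F a) = face_poly K + face_poly (full_link K F) *
    ('X * ((1 + 'X) ^+ #|` F| - 'X^#|` F|) - 'X^#|` F|).
Proof.
move=> cK FK fresh; have F0 := complex_neq0 cK FK.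
pose S := [fset t in fpowerset (vertices K) | ~~ (F `<=` t) && (t `|` F \in K)].
have inS t : (t \in S) = ~~ (F `<=` t) && (t `|` F \in K).
  by rewrite 2!inE /= fpowersetE; apply: andb_idl => /andP[_]; exact: sub_vertices.
have DF s : (s `\` F) `&` F = fset0.
  by apply/eqP; rewrite fsetI_eq0; apply/fdisjointP => v; rewrite in_fsetD => /andP[].
have UF s : s `\` F `|` F = s `|` F.
  by apply/fsetP => v; rewrite !in_fsetE; case: (v \in F); rewrite ?orbT// !orbF.
have linkF q : q \in full_link K F -> q `&` F = fset0.
  by rewrite in_full_link => /andP[/eqP].
have S_poly : face_poly S = face_poly (fpowerset F `\ F) * face_poly (full_link K F).
  apply: face_poly_join linkF _.
    by move=> p; rewrite in_fsetD1 fpowersetE => /andP[].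
  move=> s; rewrite inS in_fsetD1 fpowersetE fsubsetIr andbT in_full_link DF eqxx UF /=.
  congr (~~ _ && _); apply/idP/eqP => [h|<-]; last exact: fsubsetIl.
  exact/fsetIidPr.
have new_poly : face_poly [fset s in star K F a | a \in s] = 'X * face_poly S.
  rewrite (@face_poly_join _ [fset a] [fset [fset a]] S).
  - by rewrite face_poly1 cardfs1 expr1.
  - by move=> p; rewrite in_fset1 => /eqP ->; exact: fsubset_refl.
  - move=> q; rewrite inS => /andP[_ /fresh]; rewrite in_fsetU negb_or => /andP[aq _].
    by apply/eqP; rewrite fsetI_eq0 fdisjointX1.
  - move=> s; rewrite 2!inE /= in_star// inS in_fset1 fsetI1.
    have [as_|as_] := boolP (a \in s); last first.
      rewrite andbF; symmetry; apply/negbTE; rewrite negb_and; apply/orP; left.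
      by apply/eqP => /fsetP/(_ a); rewrite in_fset1 eqxx in_fset0.
    rewrite eqxx andbT (_ : s != fset0)//.
    by apply/fset0Pn; exists a.
have old_poly : face_poly [fset s in star K F a | a \notin s] =
    face_poly [fset s in K | ~~ (F `<=` s)].
  congr face_poly; apply/fsetP => s.
  rewrite [LHS](_ : _ = (s \in star K F a) && (a \notin s)); last by rewrite 2!inE.
  rewrite [RHS](_ : _ = (s \in K) && ~~ (F `<=` s)); last by rewrite 2!inE.
  rewrite in_star//.
  have [as_|as_] /= := boolP (a \in s).
    rewrite andbF; symmetry; apply/negbTE; rewrite negb_and; apply/orP; left.
    by apply/negP => /fresh; rewrite as_.
  rewrite andbT (mem_fsetD1 as_); case: (boolP (s \in K)) => [sK|_]; last by rewrite !andbF.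
  by rewrite andbT (complex_neq0 cK sK).
have removed_poly : face_poly [fset s in K | F `<=` s] =
    'X^#|` F| * face_poly (full_link K F).
  rewrite (@face_poly_join _ F [fset F] (full_link K F)).
  - by rewrite face_poly1.
  - by move=> p; rewrite in_fset1 => /eqP ->; exact: fsubset_refl.
  - exact: linkF.
  - move=> s; rewrite 2!inE /= in_fset1 in_full_link DF eqxx UF /=.
    have [h|h] := boolP (F `<=` s).
      by rewrite (fsetUidPl _ _ h) (fsetIidPr h) eqxx andbT.
    rewrite andbF; symmetry; apply/negbTE; rewrite negb_and; apply/orP; left.
    by apply: contra h => /eqP <-; exact: fsubsetIl.
rewrite (face_poly_split (fun s => a \in s) (star K F a)).
rewrite (face_poly_split (fun s => F `<=` s) K).
rewrite new_poly old_poly S_poly removed_poly face_poly_proper_faces.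
ring.
Qed.

Section PairPolynomials.
Variables (K : {fset {fset V}}) (sigma tau : {fset V}) (a : V).
Hypotheses (cK : is_complex K) (sigmaK : sigma \in K) (tau_sigma : tau `<=` sigma).
Hypothesis cofaces : forall s, s \in K -> tau `<=` s -> s `<=` sigma.
Hypotheses (tau1 : (1 < #|` tau|)%N) (tau_a : open_simplex tau a).

Lemma full_link_first : full_link K tau = fpowerset (sigma `\` tau).
Proof.
apply/fsetP => q; rewrite in_full_link fpowersetE (union_lower_face cK sigmaK)//.
by rewrite fsubsetD fsetI_eq0 andbC.
Qed.

Lemma face_poly_first : face_poly (star K tau a) = face_poly K +
  (1 + 'X) ^+ #|` sigma `\` tau| *
    ('X * ((1 + 'X) ^+ #|` tau| - 'X^#|` tau|) - 'X^#|` tau|).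
Proof.
rewrite face_poly_star ?full_link_first ?face_poly_powerset//.
- exact: lower_face_mem tau_sigma tau1.
- by move=> s; apply: lower_apex_fresh tau_sigma tau1 tau_a s.
Qed.

Variables (rho : {fset V}) (c : V).
Hypotheses (rho_tau : rho `<` tau) (rho0 : rho != fset0).
Local Notation F := (a |` rho).
Hypothesis (F_c : open_simplex F c).

(** Around the second face one may add any part of [sigma] outside [tau], but not all of the rest of
    [tau], since a face of the first star with apex [a] never contains [tau]. *)
Lemma face_poly_full_link_second : face_poly (full_link (star K tau a) F) =
  ((1 + 'X) ^+ #|` tau `\` rho| - 'X^#|` tau `\` rho|) *
  (1 + 'X) ^+ #|` sigma `\` tau|.
Proof.
have rt := fproper_sub rho_tau.
rewrite (@face_poly_join _ (tau `\` rho) (fpowerset (tau `\` rho) `\ (tau `\` rho))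
  (fpowerset (sigma `\` tau))).
- by rewrite face_poly_proper_faces face_poly_powerset.
- by move=> p; rewrite in_fsetD1 fpowersetE => /andP[].
- move=> q; rewrite fpowersetE => /fsubsetP h; apply/eqP; rewrite fsetI_eq0.
  apply/fdisjointP => v /h; rewrite !in_fsetD => /andP[/negbTE -> _].
  by rewrite andbF.
move=> q; rewrite in_full_link (second_union cK sigmaK tau_sigma cofaces tau1 tau_a rho_tau).
rewrite in_fsetD1 !fpowersetE fsubsetIr andbT.
have asig : a \notin sigma by apply: (lower_apex_fresh cK sigmaK tau_sigma tau1 tau_a).
apply/idP/idP => [/and3P[/eqP qF tq qs]|/andP[tq qs]].
  have disj v : v \in q -> v \notin F.
    by move=> vq; apply/negP => vF; move/fsetP/(_ v): qF; rewrite in_fsetI vq vF in_fset0.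
  have aq : a \notin q by apply/negP => /disj; rewrite fset1U1.
  rewrite (mem_fsetD1 aq) in tq qs; apply/andP; split.
    by apply: contra tq => /eqP <-; exact: fsubsetIl.
  apply/fsubsetP => v; rewrite !in_fsetD negb_and negbK => /andP[vr vq].
  rewrite (fsubsetP qs _ vq) andbT; case/orP: vr => // vr.
  by have := disj _ vq; rewrite in_fset1U vr orbT.
have qv v : v \in q -> (v \in sigma) && (v \notin rho).
  move=> vq; have [vt|vt] := boolP (v \in tau `\` rho).
    by move: vt; rewrite in_fsetD => /andP[-> /(fsubsetP tau_sigma) ->].
  have := fsubsetP qs v; rewrite in_fsetD vt vq => /(_ isT).
  rewrite in_fsetD => /andP[vt' ->] /=; apply: contra vt'; exact: (fsubsetP rt).
have aq : a \notin q by apply: contra asig => /qv/andP[].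
rewrite (mem_fsetD1 aq); apply/and3P; split.
- rewrite fsetI_eq0; apply/fdisjointP => v vq; rewrite in_fset1U negb_or.
  by have /andP[_ ->] := qv _ vq; rewrite andbT; apply: contraNneq aq => <-.
- by apply: contra tq => h; apply/eqP/fsetIidPr.
- by apply/fsubsetP => v /qv/andP[].
Qed.

Lemma face_poly_second : face_poly (star (star K tau a) F c) =
  face_poly (star K tau a) +
  ((1 + 'X) ^+ #|` tau `\` rho| - 'X^#|` tau `\` rho|) *
  (1 + 'X) ^+ #|` sigma `\` tau| *
    ('X * ((1 + 'X) ^+ #|` rho|.+1 - 'X^(#|` rho|.+1)) - 'X^(#|` rho|.+1)).
Proof.
have tK := lower_face_mem cK sigmaK tau_sigma tau1.
have arho := apex_notin_rho cK sigmaK tau_sigma tau1 tau_a rho_tau.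
have FK := second_face_mem cK sigmaK tau_sigma cofaces tau1 tau_a rho_tau.
have F1 := second_face_card cK sigmaK tau_sigma tau1 tau_a rho_tau rho0.
have cS := star_complex cK tK tau_a.
rewrite face_poly_star// ?face_poly_full_link_second; last exact: open_simplex_fresh F1 F_c.
by rewrite cardfsU1 arho.
Qed.
End PairPolynomials.
End FacePolynomial.

(** * The group generated by the polynomials of the moves *)

Section Lattice.
Local Notation A := (1 + 'X : {poly int}).
Local Notation X := ('X : {poly int}).

(** The polynomial [k]: it counts the proper faces of a simplex with k vertices, the empty one
    included. *)
Definition pow_diff (k : nat) : {poly int} := A ^+ k - X ^+ k.

(** Exhibits the factor X (1 + X) of every stellar change, whose root -1 reflects the invariance of
    the Euler characteristic. *)
Lemma stellar_factor k :
  'X * (A ^+ k.+1 - 'X^(k.+1)) - 'X^(k.+1) = X * A * pow_diff k.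
Proof. by rewrite /pow_diff !exprS; ring. Qed.

Variables (H : {poly int} -> Prop) (n : nat).
Hypotheses (H0 : H 0) (HB : forall p q, H p -> H q -> H (p - q)).
Hypothesis Hg : forall k l, (0 < k)%N -> (0 < l)%N -> (k + l = n.+1)%N ->
  H (pow_diff k * pow_diff l).
Hypothesis Hh : forall k l, (0 < k)%N -> (0 < l)%N -> (k + l = n)%N ->
  H (A * (pow_diff k * pow_diff l)).

Let E i j : {poly int} := A ^+ i * X ^+ j.

Lemma pow_diff0 : pow_diff 0 = 0.
Proof. by rewrite /pow_diff !expr0 subrr. Qed.

(* Products of equal degree telescope; below, A - X = 1 lets differences of the
   resulting antisymmetric terms descend to single monomials A^i X^j. *)
Lemma pow_diff_exchange i j :
  pow_diff j.+1 * pow_diff i - pow_diff j * pow_diff i.+1 = E i j - E j i.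
Proof. by rewrite /pow_diff /E !exprS; ring. Qed.

Let HD p q : H p -> H q -> H (p + q).
Proof. by move=> hp hq; rewrite -[q]opprK; apply: HB => //; rewrite -sub0r; exact: HB. Qed.

(** Admits the end values k = 0 and l = 0, where the product vanishes, so that the exchange identity
    can be used for all exponents. *)
Let Hg' k l : (k + l = n.+1)%N -> H (pow_diff k * pow_diff l).
Proof.
case: k => [|k]; first by rewrite pow_diff0 mul0r.
case: l => [|l]; first by rewrite pow_diff0 mulr0.
exact: Hg.
Qed.

Let Hh' k l : (k + l = n)%N -> H (A * (pow_diff k * pow_diff l)).
Proof.
case: k => [|k]; first by rewrite pow_diff0 mul0r mulr0.
case: l => [|l]; first by rewrite pow_diff0 !mulr0.
exact: Hh.
Qed.

Let HP i j : (i + j = n)%N -> H (E i j - E j i).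
Proof.
by move=> ij; rewrite -pow_diff_exchange; apply: HB; apply: Hg'; rewrite -ij; lia.
Qed.

(** The additional factor A raises only one exponent of each monomial; this breaks the antisymmetry
    of [HP] and makes single monomials reachable. *)
Let HQ i j : (i + j).+1 = n -> H (E i.+1 j - E j.+1 i).
Proof.
move=> ij.
have -> : E i.+1 j - E j.+1 i = A * (pow_diff j.+1 * pow_diff i) - A * (pow_diff j * pow_diff i.+1).
  by rewrite -mulrBr pow_diff_exchange /E !exprS; ring.
by apply: HB; apply: Hh'; rewrite -ij; lia.
Qed.

Let Htop i j : (i + j).+1 = n -> H (E i j).
Proof.
move=> ij.
have -> : E i j = (E j.+1 i - E i j.+1) - (E j.+1 i - E i.+1 j).
  by rewrite /E !exprS; ring.
by apply: HB; [apply: HP|apply: HQ]; rewrite -ij; lia.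
Qed.

Let Hall d i j : (i + j + d).+1 = n -> H (E i j).
Proof.
elim: d i j => [|d IH] i j ij; first by apply: Htop; rewrite -ij addn0.
have -> : E i j = E i.+1 j - E i j.+1 by rewrite /E !exprS; ring.
by apply: HB; apply: IH; rewrite -ij; lia.
Qed.

Let HZ (c : int) p : H p -> H (c *: p).
Proof.
move=> hp; have Hn (m : nat) : H (m%:Z *: p).
  elim: m => [|m IH]; first by rewrite scale0r.
  by rewrite -addn1 PoszD scalerDl scale1r; exact: HD.
case: c => m; first exact: Hn.
by rewrite NegzE scaleNr -sub0r; apply: HB.
Qed.

Lemma lattice_small_poly (p : {poly int}) : (size p <= n)%N -> H p.
Proof.
move=> pn; rewrite -[p]coefK poly_def.
apply: (big_ind H) => // i _; apply: HZ.
have -> : 'X^i = E 0 i by rewrite /E expr0 mul1r.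
by apply: (@Hall (n - i.+1)); have := leq_trans (ltn_ord i) pn; lia.
Qed.
End Lattice.

(** * Moves available in every manifold with boundary *)

Section CombManifolds.
Local Open Scope fset_scope.
Local Open Scope ring_scope.
Variables (R : realType) (N n : nat).
Local Notation V := 'rV[R]_N.
Implicit Types (s t sigma tau rho : {fset V}) (K : {fset {fset V}}) (a c v x : V).

Lemma std_simplex_boundary_card m (t : {fset 'rV[R]_m.+1}) :
  t \in std_simplex_boundary R m.+1 -> (#|` t| <= m)%N.
Proof.
rewrite in_std_simplex_boundary => /and3P[_ h1 h2].
rewrite -ltnS -[X in (_ < X)%N](card_basis_vertices R m.+1).
by apply: fproper_ltn_card; rewrite fproperE h1.
Qed.

Lemma link_card K v : is_comb_manifold n K -> [fset v] \in K ->
  forall t, t \in link K v -> (#|` t| <= n)%N.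
Proof.
move=> [cK mK lK] vK; have [ls lb] := lK _ vK.
have cL := @link_complex _ _ K v cK.
have Kv : polyhedron K v by exists [fset v] => //; apply: mem_hull; rewrite in_fset1.
have [iv|iv] := pselect (manifold_interior n (polyhedron K) v).
  exact: pl_homeomorphic_card cL (ls iv) (@std_simplex_boundary_card n).
by apply: pl_homeomorphic_card cL (lb _) (@std_simplex_card R n).
Qed.

Lemma comb_manifold_card K s : is_comb_manifold n K -> s \in K -> (#|` s| <= n.+1)%N.
Proof.
move=> mK sK; have cK : is_complex K by case: mK.
have [v vs] := fset0Pn _ (complex_neq0 cK sK).
rewrite (cardfsD1 v s) vs add1n ltnS.
have [->|s0] := eqVneq (s `\ v) fset0; first by rewrite cardfs0.
apply: (link_card mK (complex_vertex cK sK vs)).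
by rewrite in_link// s0 fsetD1K// sK in_fsetD1 eqxx.
Qed.

Lemma exists_boundary_vertex K : is_comb_manifold n K ->
  (exists x, manifold_boundary n (polyhedron K) x) ->
  exists2 v, [fset v] \in K & manifold_boundary n (polyhedron K) v.
Proof.
move=> [cK mK lK] [x [Kx nx]]; apply: contrapT => h; apply: nx.
apply: manifold_interior_of_vertices => // v vK; apply: contrapT => nv.
by apply: h; exists v => //; split => //; exists [fset v] => //; apply: mem_hull; rewrite in_fset1.
Qed.

(** The link of a boundary vertex is PL homeomorphic to a simplex with n vertices, so by invariance
    of dimension it has a simplex with n vertices. Its cone from the vertex has the maximal number n
    + 1. *)
Lemma exists_top_simplex K : is_comb_manifold n K -> (0 < n)%N ->
  (exists x, manifold_boundary n (polyhedron K) x) ->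
  exists sigma, [/\ sigma \in K, #|` sigma| = n.+1 &
    forall s, s \in K -> sigma `<=` s -> s `<=` sigma].
Proof.
move=> mK n0 bd; have [cK _ lK] := mK.
have [v vK bv] := exists_boundary_vertex mK bd.
have Lb := (lK _ vK).2 bv; have cL := @link_complex _ _ K v cK.
have [t tL tn] : exists2 t, t \in link K v & (n <= #|` t|)%N.
  apply: contrapT => h.
  have small t : t \in link K v -> (#|` t| <= n.-1)%N.
    by move=> tL; rewrite -ltnS prednK// ltnNge; apply/negP => ?; apply: h; exists t.
  have := pl_homeomorphic_card (@std_simplex_complex R n) (pl_homeomorphic_sym Lb) small
    (s := basis_vertices R n).
  rewrite card_basis_vertices std_simplexE in_full_simplex fsubset_refl andbT.
  rewrite -cardfs_gt0 card_basis_vertices n0 => /(_ isT).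
  by rewrite leqNgt prednK// leqnn.
have tn' : #|` t| = n by apply/eqP; rewrite eqn_leq tn (link_card mK vK).
move: tL; rewrite in_link// => /and3P[_ vt vtK].
have sn : #|` v |` t| = n.+1 by rewrite cardfsU1 vt tn'.
exists (v |` t); split => // s sK st.
suff -> : s = v |` t by exact: fsubset_refl.
by apply/eqP; rewrite eq_sym eqEfcard st sn (comb_manifold_card mK sK).
Qed.

(** A free face of the link, coned from the boundary vertex [v], is a free face of [K]; [z] is the
    vertex of the larger link simplex that the free face omits. *)
Lemma exists_free_face K m : is_comb_manifold n K -> n = m.+2 ->
  (exists x, manifold_boundary n (polyhedron K) x) ->
  exists sigma z, [/\ sigma \in K, #|` sigma| = n.+1, z \in sigma &
    forall s, s \in K -> sigma `\ z `<=` s -> s `<=` sigma].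
Proof.
move=> mK nm bd; have [cK _ lK] := mK.
have [v vK bv] := exists_boundary_vertex mK bd.
have Lb := (lK _ vK).2 bv; have cL := @link_complex _ _ K v cK.
rewrite nm in Lb.
have [t [t' [tL t'L tm t'm [tt' free]]]] := pl_ball_free_face cL Lb.
have [z zt' zt] : exists2 z, z \in t' & z \notin t.
  apply/fsubsetPn; apply/negP => /fsubset_leq_card.
  by rewrite tm t'm ltnn.
move: t'L tL; rewrite !in_link// => /and3P[t'0 vt' vt'K] /and3P[t0 vt vtK].
have vz : v != z by apply: contraNneq vt' => ->.
exists (v |` t'), z; split => //.
- by rewrite cardfsU1 vt' t'm nm.
- by rewrite in_fset1U zt' orbT.
move=> s sK zs.
have vs : v \in s by apply: (fsubsetP zs); rewrite in_fsetD1 vz fset1U1.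
have ts : t `<=` s `\ v.
  apply/fsubsetP => x xt; rewrite in_fsetD1.
  have -> /= : x != v by apply: contraNneq vt => <-.
  apply: (fsubsetP zs); rewrite in_fsetD1 in_fset1U (fsubsetP tt' _ xt) orbT andbT.
  by apply: contraNneq zt => <-.
have sL : s `\ v \in link K v.
  rewrite in_link// fsetD1K// sK in_fsetD1 eqxx !andbT.
  exact: fsubset_neq0 ts t0.
rewrite -(fsetD1K vs); apply: fsetUS.
by have [->|->] := free _ sL ts; rewrite ?fsubset_refl.
Qed.

(** Asked at every point of the open simplex, since the first and the second apex are different
    points of it. *)
Definition apex_type K sigma tau : Prop := forall x, open_simplex tau x ->
  (manifold_interior n (polyhedron K) x -> pl_sphere_pred n (apex_link sigma tau)) /\
  (manifold_boundary n (polyhedron K) x -> pl_ball_pred n (apex_link sigma tau)).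

Lemma exists_subset_card (T : choiceType) (s : {fset T}) k : (k <= #|` s|)%N ->
  exists2 t, t `<=` s & #|` t| = k.
Proof.
move=> ks; have [d] : exists d, (k + d = #|` s|)%N by exists (#|` s| - k)%N; rewrite subnKC.
elim: d k {ks} => [|d IH] k kd; first by exists s; rewrite ?fsubset_refl// -kd addn0.
have [t ts tk] := IH k.+1 (etrans (addSnnS _ _) kd).
have [v vt] : exists v : T, v \in t by apply/fset0Pn; rewrite -cardfs_gt0 tk.
exists (t `\ v); first exact: fsubset_trans (fsubsetDl _ _) ts.
by have := cardfsD1 v t; rewrite vt tk => -[].
Qed.

(** The intermediate [K1] is the same for all [k], so its contribution can later be subtracted,
    leaving the product of the two [pow_diff]. *)
Lemma stellar_moves K sigma tau : is_comb_manifold n K -> sigma \in K ->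
  tau `<=` sigma -> (forall s, s \in K -> tau `<=` s -> s `<=` sigma) ->
  (1 < #|` tau|)%N -> apex_type K sigma tau ->
  exists K1, [/\ is_comb_manifold n K1, subdivision K1 K,
    face_poly K1 = face_poly K + 'X * (1 + 'X) *
      ((1 + 'X) ^+ #|` sigma `\` tau| * pow_diff #|` tau|.-1) &
    forall k, (0 < k < #|` tau|)%N ->
    exists K2, [/\ is_comb_manifold n K2, subdivision K2 K &
      face_poly K2 = face_poly K1 + 'X * (1 + 'X) *
      ((1 + 'X) ^+ #|` sigma `\` tau| * (pow_diff k * pow_diff (#|` tau| - k)))]].
Proof.
move=> mK sK ts cofaces t1 at_; have [cK _ _] := mK.
have tK := lower_face_mem cK sK ts t1.
have [a oa] := exists_open_simplex (complex_neq0 cK tK).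
have sub1 := star_subdivision cK tK oa.
have mK1 : is_comb_manifold n (star K tau a).
  by apply: comb_manifold_star => //; rewrite (link_first_apex cK sK ts cofaces t1 oa); case: (at_ _ oa).
exists (star K tau a); split => //.
  rewrite (face_poly_first cK sK ts cofaces t1 oa) -(ltn_predK t1) stellar_factor.
  by rewrite mulrCA.
move=> k /andP[k0 kt].
have [rho rt rk] := exists_subset_card (ltnW kt).
have rho_tau : rho `<` tau by rewrite fproperEcard rt rk.
have rho0 : rho != fset0 by rewrite -cardfs_gt0 rk.
have FK := second_face_mem cK sK ts cofaces t1 oa rho_tau.
have F1 := second_face_card cK sK ts t1 oa rho_tau rho0.
have [cK1 pK1 _] := sub1.
have [c oc] := exists_open_simplex (complex_neq0 cK1 FK).
have sub2 := star_subdivision cK1 FK oc.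
have L_pl := link_second_apex_pl cK sK ts cofaces t1 oa rho_tau rho0 oc.
have oct := open_simplex_second cK sK ts t1 oa rho_tau oc.
exists (star (star K tau a) (a |` rho) c); split.
- apply: comb_manifold_star => //; rewrite pK1 => h; apply: pl_homeomorphic_trans L_pl _.
    by case: (at_ _ oct) => + _; apply.
  by case: (at_ _ oct) => _; apply.
- exact: subdivision_trans sub2 sub1.
- rewrite (face_poly_second cK sK ts cofaces t1 oa rho_tau rho0 oc) rk stellar_factor.
  rewrite cardfsDS// rk -/(pow_diff (#|` tau| - k)).
  move: (pow_diff k) (pow_diff (#|` tau| - k)) ((1 + 'X) ^+ _) (face_poly _) => p q r f.
  by ring.
Qed.
End CombManifolds.

(** * Realizable changes of the face polynomial *)

Section Moves.
Variables (R : realType) (n : nat).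
Local Open Scope classical_set_scope.
Local Open Scope ring_scope.

(** The new manifold must again have boundary points, so that further moves apply to it. *)
Definition realizable (g : {poly int}) : Prop := forall M : comb_manifold R n,
  boundary M !=set0 -> exists M' : comb_manifold R n,
  [/\ pl_homeomorphic (triangulation M) (triangulation M'), boundary M' !=set0 &
      face_poly (triangulation M') = face_poly (triangulation M) + 'X * (1 + 'X) * g].

Lemma realizable_subdivision (M : comb_manifold R n) K' g :
  boundary M !=set0 -> is_comb_manifold n K' -> subdivision K' (triangulation M) ->
  face_poly K' = face_poly (triangulation M) + 'X * (1 + 'X) * g ->
  exists M' : comb_manifold R n,
  [/\ pl_homeomorphic (triangulation M) (triangulation M'), boundary M' !=set0 &
      face_poly (triangulation M') = face_poly (triangulation M) + 'X * (1 + 'X) * g].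
Proof.
move=> bd mK' sub fp; exists (CombManifold mK'); split => //.
  exact/pl_homeomorphic_sym/subdivision_pl_homeomorphic.
by case: sub => _ pK _; rewrite /boundary /manifold_space /= pK.
Qed.

Lemma realizable_interior : (0 < n)%N -> realizable (pow_diff n) /\
  forall k, (0 < k < n.+1)%N ->
  realizable (pow_diff n + pow_diff k * pow_diff (n.+1 - k)).
Proof.
move=> n0; suff h (M : comb_manifold R n) : boundary M !=set0 -> exists K1,
    [/\ is_comb_manifold n K1, subdivision K1 (triangulation M),
       face_poly K1 = face_poly (triangulation M) + 'X * (1 + 'X) * pow_diff n &
       forall k, (0 < k < n.+1)%N -> exists K2, [/\ is_comb_manifold n K2,
         subdivision K2 (triangulation M) &
         face_poly K2 = face_poly K1 + 'X * (1 + 'X) * (pow_diff k * pow_diff (n.+1 - k))]].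
  split=> [M bd|k kn M bd]; have [K1 [mK1 sub1 fp1 h2]] := h M bd.
    exact: realizable_subdivision bd mK1 sub1 fp1.
  have [K2 [mK2 sub2 fp2]] := h2 k kn.
  by apply: realizable_subdivision bd mK2 sub2 _; rewrite fp2 fp1 -addrA -mulrDr.
move=> bd; have mK := comb_manifoldP M; have [cK _ _] := mK.
have [sigma [sK sn top]] := exists_top_simplex mK n0 bd.
have ai : affinely_independent sigma by case: cK => _ _ + _; apply.
have [||K1 [mK1 sub1 fp1 h]] := stellar_moves mK sK (fsubset_refl sigma) top.
- by rewrite sn ltnS.
- move=> x ox; split; first by move=> _; exact: apex_link_pl_sphere.
  by move=> [_ []]; exact: top_simplex_interior ox.
move: fp1 h; rewrite sn fsetDv cardfs0 expr0 mul1r /= => fp1 h.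
exists K1; split => // k /h[K2 [mK2 sub2 fp2]]; exists K2; split => //.
by rewrite fp2 mul1r.
Qed.

(** A facet of an n-simplex has n vertices, and starring needs at least two. For n = 1 there is no
    splitting n = k + l with both parts positive anyway. *)
Lemma realizable_boundary : (1 < n)%N -> realizable ((1 + 'X) * pow_diff n.-1) /\
  forall k, (0 < k < n)%N ->
  realizable ((1 + 'X) * pow_diff n.-1 + (1 + 'X) * (pow_diff k * pow_diff (n - k))).
Proof.
move=> n1; suff h (M : comb_manifold R n) : boundary M !=set0 -> exists K1,
    [/\ is_comb_manifold n K1, subdivision K1 (triangulation M),
       face_poly K1 = face_poly (triangulation M) + 'X * (1 + 'X) * ((1 + 'X) * pow_diff n.-1) &
       forall k, (0 < k < n)%N -> exists K2, [/\ is_comb_manifold n K2,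
         subdivision K2 (triangulation M) &
         face_poly K2 = face_poly K1 +
           'X * (1 + 'X) * ((1 + 'X) * (pow_diff k * pow_diff (n - k)))]].
  split=> [M bd|k kn M bd]; have [K1 [mK1 sub1 fp1 h2]] := h M bd.
    exact: realizable_subdivision bd mK1 sub1 fp1.
  have [K2 [mK2 sub2 fp2]] := h2 k kn.
  by apply: realizable_subdivision bd mK2 sub2 _; rewrite fp2 fp1 -addrA -mulrDr.
move=> bd; have mK := comb_manifoldP M; have [cK manK _] := mK.
have [m nm] : exists m, n = m.+2 by exists n.-2; move: n1; lia.
have [sigma [z [sK sn zs free]]] := exists_free_face mK nm bd.
have ai : affinely_independent sigma by case: cK => _ _ + _; apply.
have tn : #|` (sigma `\ z)%fset| = n by have := cardfsD1 z sigma; rewrite zs sn add1n => -[<-].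
have t0 : (sigma `\ z)%fset != fset0 by rewrite -cardfs_gt0 tn; exact: ltnW.
have [||K1 [mK1 sub1 fp1 h]] := stellar_moves mK sK (fsubsetDl _ _) free.
- by rewrite tn.
- move=> x ox; split; last by move=> _; exact: apex_link_pl_ball.
  move=> ix; have [_ []] := free_face_boundary cK manK bd sK sn zs t0 free ox.
  exact: ix.
move: fp1 h; rewrite tn (_ : #|` (sigma `\` (sigma `\ z))%fset| = 1%N); last first.
  by rewrite fsetDK ?cardfs1// fsub1set.
rewrite expr1 => fp1 h.
by exists K1; split => // k /h[K2 [mK2 sub2 fp2]]; exists K2; split.
Qed.

(** In dimension 0 the half-space is all of the space, so every chart is already Euclidean. *)
Lemma boundary_empty_dim0 : n = 0%N -> forall M : comb_manifold R n, ~ (boundary M !=set0).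
Proof.
move=> n0 M [x [Kx nx]]; apply: nx; split => //.
have [_ mK _] := comb_manifoldP M.
have [U [V [oU Ux oV h]]] := mK _ Kx; exists U, V; split => //.
suff e : half_space (R := R) (n := n) = setT by move: h; rewrite e setIT.
by apply/seteqP; split => // y _ i; have := ltn_ord i; rewrite {2}n0.
Qed.
End Moves.

Section Counting.
Variables (R : realType).
Local Open Scope fset_scope.
Local Open Scope ring_scope.

Lemma coef_face_poly (T : choiceType) (K : {fset {fset T}}) i :
  (face_poly K)`_i = #|` [fset s in K | #|` s| == i]|%:R.
Proof.
rewrite coef_sum (big_fsetID _ (fun s : {fset T} => #|` s| == i)) /=.
rewrite [X in _ + X]big1_seq ?addr0; last first.
  by move=> s; rewrite 2!inE /= => /andP[_ /negbTE h]; rewrite coefXn eq_sym h.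
rewrite -sum1_size natr_sum; apply: eq_big_seq => s.
by rewrite 2!inE /= => /andP[_ /eqP ->]; rewrite coefXn eqxx.
Qed.

Lemma face_poly_f_vector n (M M' : comb_manifold R n) :
  face_poly (triangulation M) = face_poly (triangulation M') ->
  f_vector M = f_vector M'.
Proof.
move=> e; apply: eq_mkseq => k; apply/eqP; rewrite -(eqr_nat int).
by rewrite /face_number -!coef_face_poly e.
Qed.

Lemma face_poly_euler N (K : {fset {fset 'rV[R]_N}}) : fset0 \notin K ->
  (face_poly K).[-1] = - euler_char K.
Proof.
move=> K0; rewrite /face_poly horner_sum /euler_char -sumrN.
apply: eq_big_seq => s sK; rewrite hornerXn.
have : (0 < #|` s|)%N by rewrite cardfs_gt0; apply: contraNneq K0 => <-.
by case: #|` s| => // m _; rewrite exprS mulN1r.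
Qed.

Lemma size_face_poly n (M : comb_manifold R n) :
  (size (face_poly (triangulation M)) <= n.+2)%N.
Proof.
apply: (leq_trans (size_sum _ _ _)); apply/bigmax_leqP_seq => s sK _.
by rewrite size_polyXn ltnS; exact: comb_manifold_card (comb_manifoldP M) sK.
Qed.

Lemma face_poly0 N (K : {fset {fset 'rV[R]_N}}) : fset0 \notin K -> (face_poly K).[0] = 0.
Proof.
move=> K0; rewrite /face_poly horner_sum; apply: big1_seq => s /= sK.
by rewrite hornerXn expr0n cardfs_eq0; case: eqP sK K0 => //= -> ->.
Qed.

(** The divisor X (1 + X) is monic of size 3, so division stays over the integers and lowers the
    size by exactly two. *)
Lemma divides_two_roots n (p : {poly int}) : (size p <= n.+2)%N ->
  p.[0] = 0 -> p.[-1] = 0 -> exists2 q, p = 'X * (1 + 'X) * q & (size q <= n)%N.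
Proof.
move=> pn p0 p1.
have /factor_theorem[q1 E1] : root p 0 by apply/eqP.
have /factor_theorem[q E2] : root q1 (-1).
  by move: p1; rewrite E1 hornerM !hornerE => /eqP; rewrite mulf_eq0 => /orP[/eqP h|//]; apply/eqP.
have e : p = q * ((1 + 'X) * 'X).
  by rewrite E1 E2 polyC0 subr0 polyCN opprK polyC1 -mulrA [_ + 1]addrC.
exists q; first by rewrite e mulrC [_ * 'X]mulrC.
have [->|q0] := eqVneq q 0; first by rewrite size_poly0.
have mon : (1 + 'X : {poly int}) * 'X \is monic.
  by rewrite monicMl ?monicX// addrC -[1]opprK -polyC1 -polyCN monicXsubC.
have s3 : size ((1 + 'X : {poly int}) * 'X) = 3.
  rewrite size_mulX; last by rewrite -lead_coef_eq0 addrC -[1]opprK -polyC1 -polyCN lead_coefXsubC oner_eq0.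
  by rewrite addrC -[1]opprK -polyC1 -polyCN size_XsubC.
by move: pn; rewrite e size_Mmonic// s3; lia.
Qed.
End Counting.

Theorem theorem1p5 (R : realType) (Phi : forall n : nat, comb_manifold R n -> R)
    (Phi_pl : pl_invariant Phi)
    (Phi_f : depends_only_on_f_vector Phi)
    (n : nat) (M1 M2 : comb_manifold R n)
    (bd1 : boundary M1 !=set0) (bd2 : boundary M2 !=set0)
    (chiM : euler_char (triangulation M1) = euler_char (triangulation M2))
    (chibd : euler_char (boundary_complex M1) =
             euler_char (boundary_complex M2)) :
  Phi n M1 = Phi n M2.
Proof.
have [n0|n_gt0] := posnP n; first by have := boundary_empty_dim0 n0 bd1.
pose G c := forall M M' : comb_manifold R n, boundary M !=set0 -> boundary M' !=set0 ->
  face_poly (triangulation M) = face_poly (triangulation M') + 'X * (1 + 'X) * c ->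
  Phi n M = Phi n M'.
pose H d := forall c, G c <-> G (c + d).
(* To pass from c to c + g refine [M'], which absorbs the surplus g; to pass back refine [M], which
   creates it. [Phi] does not see either refinement. *)
have real_H g : realizable R n g -> H g.
  move=> rg c; split=> Gc M M' bM bM' e.
    have [N' [pl bN' eN']] := rg _ bM'.
    rewrite (Phi_pl _ _ _ _ pl); apply: Gc => //.
    by rewrite e eN' (mulrDr ('X * _)) [X in _ + X = _]addrC addrA.
  have [N' [pl bN' eN']] := rg _ bM.
  rewrite (Phi_pl _ _ _ _ pl); apply: Gc => //.
  by rewrite eN' e (mulrDr ('X * _)) addrA.
have H0 : H 0 by move=> c; rewrite addr0.
have HB p q : H p -> H q -> H (p - q).
  by move=> hp hq c; rewrite (hq (c + (p - q))) addrA subrK; exact: hp.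
(* Removes the contribution p of the first starring from that of both starrings. *)
have Hdiff p q : H p -> H (p + q) -> H q.
  by move=> hp hpq; rewrite -[q](addKr p) addrC; exact: HB.
have Hg k l : (0 < k)%N -> (0 < l)%N -> (k + l = n.+1)%N -> H (pow_diff k * pow_diff l).
  move=> k0 l0 kl; have [r1 r2] := realizable_interior R n_gt0.
  have kn : (0 < k < n.+1)%N by rewrite k0 -kl -addn1 leq_add2l.
  have -> : l = (n.+1 - k)%N by rewrite -kl addKn.
  by apply: Hdiff (real_H _ r1) (real_H _ (r2 k kn)).
have Hh k l : (0 < k)%N -> (0 < l)%N -> (k + l = n)%N -> H ((1 + 'X) * (pow_diff k * pow_diff l)).
  move=> k0 l0 kl; have n1 : (1 < n)%N by rewrite -kl; lia.
  have [r1 r2] := realizable_boundary R n1.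
  have kn : (0 < k < n)%N by rewrite k0 -kl -addn1 leq_add2l.
  have -> : l = (n - k)%N by rewrite -kl addKn.
  by apply: Hdiff (real_H _ r1) (real_H _ (r2 k kn)).
have K0 (M : comb_manifold R n) : fset0 \notin triangulation M.
  by have [[]] := comb_manifoldP M.
have [|||q qE qn] := @divides_two_roots n (face_poly (triangulation M1) - face_poly (triangulation M2)).
- by rewrite (leq_trans (size_polyD _ _))// size_polyN geq_max !size_face_poly.
- by rewrite hornerD hornerN !face_poly0// subrr.
- by rewrite hornerD hornerN !face_poly_euler// chiM subrr.
have Hq := lattice_small_poly H0 HB Hg Hh qn.
have G0 : G 0.
  move=> M M' _ _; rewrite mulr0 addr0 => /face_poly_f_vector; exact: Phi_f.
have := (Hq 0).1 G0; rewrite add0r; apply => //.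
by rewrite -qE addrC subrK.
Qed.
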